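(* Let $J$ be a general abelian surface and let $Z$ be the Zariski closure in $\mathbf{P}B^2\cong\mathbf{P}^5$ of the union of the planes $\mathbf{P}B^2_K$ over all diagonalizable $2$-dimensional Cartan subalgebras $K\hookrightarrow M_2(\mathbf{C})$: $$Z:=\overline{\bigcup_K\mathbf{P}B^2_K}\subset\mathbf{P}B^2 .$$ Then $Z$ is a cubic fourfold in $\mathbf{P}B^2$ defined by the determinant of a symmetric matrix $M_G$: $$Z=(G=0),\qquad G=\det M_G,\qquad M_G:=\begin{pmatrix} 2x_0 & -x_3 & x_1-4x_5 \\ -x_3 & x_1 & x_4 \\ {x_1}-4x_5 & x_4 & 2x_2 \end{pmatrix}.$$ The singular locus of $Z$ is a Veronese surface $S\,(\cong\mathbf{P}^2)$ and $Z$ is the secant variety of $S$. A parametrization of $S$ is given by $$\nu':\mathbf{P}^2\stackrel{\cong}{\longrightarrow}S:=\operatorname{Sing}(Z),$$ $$(s:t:u)\longmapsto(x_0:\dots:x_5):=\bigl(s^2:2u^2:t^2:-2us:2ut:\tfrac12(-st+u^2)\bigr).$$ For every Cartan subalgebra $K$, the intersection of $\mathbf{P}B^2_K$ with $S$ is the conic $C_K$: $$\mathbf{P}B^2_K\cap S=C_K .$$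
   Context: ''General'' means that the Hodge group of $H^1(J,\mathbf{Q})$ is the full symplectic group $\mathrm{Sp}_4$ of a polarization $\omega_J$; in particular $\operatorname{End}_{\mathbf{Q}}(J)=\mathbf{Q}$. Choose a basis $dt_1,\dots,dt_4$ of $H^1(J,\mathbf{Q})$ with $\omega_J=dt_1\wedge dt_2+dt_3\wedge dt_4$, put $dx_j=\pi_1^*dt_j$, $dy_j=\pi_2^*dt_j$ with $\pi_i:J^2\to J$ the projections, and $$\omega_1=dx_1\wedge dx_2+dx_3\wedge dx_4,\quad \omega_2=dy_1\wedge dy_2+dy_3\wedge dy_4,\quad \omega_\sigma=dx_1\wedge dy_2-dx_2\wedge dy_1+dx_3\wedge dy_4-dx_4\wedge dy_3 .$$ With $B^p(J^2)=H^{2p}(J^2,\mathbf{Q})\cap H^{p,p}(J^2)$, let $B^p:=B^p(J^2)\otimes_{\mathbf{Q}}\mathbf{C}$. Then $\omega_1,\omega_\sigma,\omega_2$ is a basis of $B^1$, and $(x_0,\dots,x_5)$ are the coordinates on the six-dimensional space $B^2$ given by $$\theta=x_0\omega_1^2+x_1\omega_1\omega_2+x_2\omega_2^2+x_3\omega_1\omega_\sigma+x_4\omega_2\omega_\sigma+x_5\omega_\sigma^2$$ (cup products). $\mathbf{P}V$ denotes the projective space of lines in $V$. A Cartan subalgebra of $M_2(\mathbf{C})$ is a diagonalizable two-dimensional subalgebra $K$; it is determined by a basis of common eigenvectors $v_\pm=(\alpha_\pm,\beta_\pm)\in\mathbf{C}^2$. Put $$\omega_\pm:=\alpha_\pm^2\omega_1+\alpha_\pm\beta_\pm\omega_\sigma+\beta_\pm^2\omega_2,\qquad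 \omega_K:=2\alpha_+\alpha_-\omega_1+(\alpha_+\beta_-+\alpha_-\beta_+)\omega_\sigma+2\beta_+\beta_-\omega_2 ,$$ and define the three-dimensional space of Hodge classes $B^2_K:=\mathbf{C}\omega_K^2\oplus\mathbf{C}\omega_+^2\oplus\mathbf{C}\omega_-^2\subset B^2$. For distinct Cartan subalgebras $K,K'$, the planes $\mathbf{P}B^2_K$ and $\mathbf{P}B^2_{K'}$ meet in exactly one point; $C_K\subset\mathbf{P}B^2_K$ is the conic which is the union of the points $\mathbf{P}B^2_K\cap\mathbf{P}B^2_{K'}$ where $K'$ runs over all Cartan subalgebras distinct from $K$. The secant variety of $S$ is the closure of the union of the lines joining two distinct points of $S$. A Veronese surface is a surface in $\mathbf{P}^5$ projectively equivalent to the image of $\mathbf{P}^2$ under the complete linear system of conics. *)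

(* Defs.v *)
From HB Require Import structures.
From mathcomp Require Import all_boot all_order all_algebra.
From mathcomp Require Import boolp classical_sets functions reals.
From mathcomp Require Import complex.
From mathcomp Require Import mpoly.

Set Implicit Arguments.
Unset Strict Implicit.
Unset Printing Implicit Defensive.

Import Order.TTheory GRing.Theory Num.Theory.

Local Open Scope ring_scope.

(** * Exterior algebra *)

(* The exterior algebra of F^n: [a A] is the coefficient of the basis monomial
   e_{i_1} /\ ... /\ e_{i_k} for A = {i_1 < ... < i_k}. *)
Notation ext F n := {ffun {set 'I_n} -> F^o}.

Section Exterior.
Variables (F : fieldType) (n : nat).

(* e_A /\ e_B = (-1)^(number of inversions) e_(A :|: B) for disjoint A, B. *)
Definition inversions (A B : {set 'I_n}) : nat :=
  #|[set p : 'I_n * 'I_n | [&& p.1 \in A, p.2 \in B & (p.2 < p.1)%N]]|.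

Definition wedge (a b : ext F n) : ext F n :=
  [ffun A : {set 'I_n} => \sum_(B : {set 'I_n} | B \subset A)
     (-1) ^+ inversions B (A :\: B) * a B * b (A :\: B)].

Definition ext1 : ext F n := [ffun A : {set 'I_n} => (A == finset.set0)%:R].

Definition form1 (v : 'rV[F]_n) : ext F n :=
  [ffun A : {set 'I_n} => \sum_(i < n | A == [set i]%SET) v 0 i].

Definition ext_degree (k : nat) (a : ext F n) : Prop :=
  forall A : {set 'I_n}, #|A| != k -> a A = 0.

End Exterior.

Arguments ext1 {F n}.

Notation "a \^ b" := (wedge a b) (at level 40, left associativity) : ring_scope.

Definition complexify (R : realType) (n : nat) (a : ext rat n) : ext R[i] n :=
  [ffun A : {set 'I_n} => ratr (a A)].

(** * Abelian surfaces and their Hodge theory *)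

(* A complex torus X = C^g / Lambda is given by its period matrix P, whose
   column j holds the coordinates of the j-th generator of Lambda.  Then
   H^k(X, F) is the k-th exterior power of F^n, n = 2g, row vectors being
   written in the basis of H^1 dual to the chosen generators of Lambda; row i
   of P is the class of the holomorphic 1-form dz_i. *)

Section HodgeTheory.
Variable R : realType.
Local Notation C := R[i].

Definition conj_mx (m n : nat) (A : 'M[C]_(m, n)) : 'M[C]_(m, n) :=
  map_mx Num.conj A.

Definition full_periods (P : 'M[C]_(2, 4)) : 'M[C]_4 := col_mx P (conj_mx P).

(* E is the matrix, on the generators of Lambda, of an alternating rational form
   satisfying the Riemann bilinear relations. *)
Definition is_polarization (P : 'M[C]_(2, 4)) (E : 'M[rat]_4) : Prop :=
  let E' : 'M[C]_4 := map_mx ratr (invmx E) in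
  [/\ E^T = - E,
      E \in unitmx,
      P *m E' *m P^T = 0 &
      forall v : 'rV[C]_2, v != 0 ->
        0 < 'i * (v *m P *m E' *m (conj_mx (v *m P))^T) 0 0].

Record abelianSurface := AbelianSurface {
  periods : 'M[C]_(2, 4);
  periods_lattice : full_periods periods \in unitmx;
  periods_polarizable : exists E : 'M[rat]_4, is_polarization periods E }.

(* The rows dt_1, ..., dt_4 of dt form a basis of H^1(J, Q) in which the
   2-form with matrix E is dt_1 /\ dt_2 + dt_3 /\ dt_4. *)
Definition std_symplectic : 'M[rat]_4 :=
  \matrix_(i < 4, j < 4)
    nth 0 (nth [::] [:: [:: 0; 1; 0; 0];
                        [:: -1; 0; 0; 0];
                        [:: 0; 0; 0; 1];
                        [:: 0; 0; -1; 0]] i) j.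

Definition symplectic_basis (E dt : 'M[rat]_4) : Prop :=
  dt \in unitmx /\ E = dt^T *m std_symplectic *m dt.

(* Sets of complex points of algebraic subgroups, defined over Q, of
   GL(H^1(J, Q)); a matrix g acts on row vectors by v |-> v *m g. *)
Definition Q_algebraic_subgroup (H : set 'M[C]_4) : Prop :=
  [/\ H 1%:M,
      forall g h, H g -> H h -> H (g *m h),
      forall g, H g -> H (invmx g) &
      exists P : set {mpoly rat[4 * 4]},
        forall g : 'M[C]_4, H g <->
          g \in unitmx /\
          forall p, P p -> (map_mpoly (ratr : rat -> C) p).@[mxvec g 0] = 0].

(* The circle action: multiplication by z on H^{1,0}, by z^* on H^{0,1}. *)
Definition hodge_circle (J : abelianSurface) (z : C) : 'M[C]_4 :=
  invmx (full_periods (periods J))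
  *m (block_mx z%:M 0 0 (z^*)%:M : 'M[C]_(2 + 2))
  *m full_periods (periods J).

(* The smallest Q-algebraic subgroup containing the image of the circle. *)
Definition hodge_group (J : abelianSurface) : set 'M[C]_4 :=
  [set g | forall H : set 'M[C]_4, Q_algebraic_subgroup H ->
     (forall z : C, `|z| = 1 -> H (hodge_circle J z)) -> H g]%classic.

Definition symplectic_group (E : 'M[rat]_4) : set 'M[C]_4 :=
  let EC : 'M[C]_4 := map_mx ratr E in
  [set g | g^T *m EC *m g = EC]%classic.

(* H^{p,q} is spanned by the dz_I /\ dzbar_K with #|I| = p and #|K| = q. *)
Definition Hpq (g n : nat) (P : 'M[C]_(g, n)) (p q : nat) :
    {vspace ext C n} :=
  let dz_ (M : 'M[C]_(g, n)) (I : {set 'I_g}) : ext C n :=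
    \big[@wedge C n/ext1]_(i in I) form1 (row i M) in
  (\sum_(I : {set 'I_g} | #|I| == p) \sum_(K : {set 'I_g} | #|K| == q)
     <[dz_ P I \^ dz_ (conj_mx P) K]>)%VS.

(* Periods of J x J for the lattice Lambda (+) Lambda. *)
Definition periods2 (J : abelianSurface) : 'M[C]_(2 + 2, 4 + 4) :=
  block_mx (periods J) 0 0 (periods J).

(* H^{2p}(J^2, Q) :&: H^{p,p}(J^2) *)
Definition hodge_class (J : abelianSurface) (p : nat) (a : ext rat (4 + 4)) :
    Prop :=
  ext_degree p.*2 a /\ complexify R a \in Hpq (periods2 J) p p.

(* B^p(J^2) (x)_Q C, as the complex span of the rational Hodge classes *)
Definition hodgeC (J : abelianSurface) (p : nat) : set (ext C (4 + 4)) :=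
  [set a | exists (m : nat) (c : 'I_m -> C) (h : 'I_m -> ext rat (4 + 4)),
     (forall i, hodge_class J p (h i)) /\
     a = \sum_i c i *: complexify R (h i)]%classic.

(** * The classes omega and the spaces B^2_K *)

Section Classes.
Variable dt : 'M[rat]_4.

Definition dtC (j : 'I_4) : 'rV[C]_4 := map_mx ratr (row j dt).
Definition dx (j : 'I_4) : ext C (4 + 4) := form1 (row_mx (dtC j) 0).
Definition dy (j : 'I_4) : ext C (4 + 4) := form1 (row_mx 0 (dtC j)).

(* Indices are shifted by one: dx 0, ..., dx 3 are dx_1, ..., dx_4. *)
Definition omega1 : ext C (4 + 4) := dx 0 \^ dx 1 + dx 2 \^ dx 3.
Definition omega2 : ext C (4 + 4) := dy 0 \^ dy 1 + dy 2 \^ dy 3.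
Definition omega_sigma : ext C (4 + 4) :=
  dx 0 \^ dy 1 - dx 1 \^ dy 0 + dx 2 \^ dy 3 - dx 3 \^ dy 2.

Definition theta (x : 'rV[C]_6) : ext C (4 + 4) :=
  x 0 0 *: (omega1 \^ omega1) + x 0 1 *: (omega1 \^ omega2)
  + x 0 2 *: (omega2 \^ omega2) + x 0 3 *: (omega1 \^ omega_sigma)
  + x 0 4 *: (omega2 \^ omega_sigma) + x 0 5 *: (omega_sigma \^ omega_sigma).

Definition cartan (K : {vspace 'M[C]_2}) : Prop :=
  [/\ 1%:M \in K,
      forall A B, A \in K -> B \in K -> A *m B \in K,
      \dim K = 2%N &
      codiagonalizable (vbasis K)].

Definition eigenbasis (K : {vspace 'M[C]_2}) (vp vm : 'cV[C]_2) : Prop :=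
  (row_mx vp vm : 'M[C]_2) \in unitmx /\
  forall A, A \in K ->
    (exists a, A *m vp = a *: vp) /\ (exists b, A *m vm = b *: vm).

Definition omega_v (v : 'cV[C]_2) : ext C (4 + 4) :=
  let a := v 0 0 in let b := v 1 0 in
  a ^+ 2 *: omega1 + (a * b) *: omega_sigma + b ^+ 2 *: omega2.

Definition omega_K (vp vm : 'cV[C]_2) : ext C (4 + 4) :=
  let ap := vp 0 0 in let bp := vp 1 0 in
  let am := vm 0 0 in let bm := vm 1 0 in
  (2 * ap * am) *: omega1 + (ap * bm + am * bp) *: omega_sigma
  + (2 * bp * bm) *: omega2.

(* The span does not depend on the choice of the eigenbasis. *)
Definition B2K (K : {vspace 'M[C]_2}) : set (ext C (4 + 4)) :=
  [set a | exists vp vm, eigenbasis K vp vm /\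
     a \in <<[:: omega_K vp vm \^ omega_K vp vm;
                 omega_v vp \^ omega_v vp;
                 omega_v vm \^ omega_v vm]>>%VS]%classic.

End Classes.
End HodgeTheory.

(** * Projective geometry *)

(* A subset of P^(n-1) is encoded by the set of the nonzero vectors of
   homogeneous coordinates of its points. *)
Section Projective.
Variable F : fieldType.

Definition pspace (n : nat) : set 'rV[F]_n := [set x | x != 0]%classic.
Arguments pspace : clear implicits.

Definition same_point (n : nat) (x y : 'rV[F]_n) : Prop :=
  exists2 c : F, c != 0 & x = c *: y.

Definition pimage (m n : nat) (f : 'rV[F]_m -> 'rV[F]_n) (X : set 'rV[F]_m) :
    set 'rV[F]_n :=
  [set y | exists2 x, X x & same_point y (f x)]%classic.

Definition zeros (n : nat) (G : {mpoly F[n]}) : set 'rV[F]_n :=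
  [set x | x != 0 /\ G.@[x 0] = 0]%classic.

Definition in_ideal (n : nat) (X : set 'rV[F]_n) (G : {mpoly F[n]}) : Prop :=
  (exists d : nat, G \is d.-homog) /\ forall x, X x -> G.@[x 0] = 0.

Definition zclosure (n : nat) (X : set 'rV[F]_n) : set 'rV[F]_n :=
  [set x | x != 0 /\ forall G, in_ideal X G -> G.@[x 0] = 0]%classic.

(* X is the reduced hypersurface of degree d with equation G: the equation
   generates the homogeneous ideal of X. *)
Definition hypersurface (n d : nat) (G : {mpoly F[n]}) (X : set 'rV[F]_n) :
    Prop :=
  [/\ G \is d.-homog, G != 0, X = zeros G &
      forall H, in_ideal X H -> exists Q, H = Q * G].

(* Jacobian criterion on the homogeneous ideal of X, for X closed in P^(n-1)
   of pure dimension d. *)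
Definition singular_locus (n d : nat) (X : set 'rV[F]_n) : set 'rV[F]_n :=
  let c := (n.-1 - d)%N in
  [set x | X x /\
     ~ exists G : 'I_c -> {mpoly F[n]},
         (forall i, in_ideal X (G i)) /\
         \rank (\matrix_(i < c, j < n) ((G i)^`M(j)).@[x 0]) = c]%classic.

Definition secant_variety (n : nat) (X : set 'rV[F]_n) : set 'rV[F]_n :=
  zclosure [set x | x != 0 /\ exists p q : 'rV[F]_n,
    [/\ X p, X q, ~ same_point p q & exists a b : F, x = a *: p + b *: q]]%classic.

(* f, given on vectors, is locally on X given by homogeneous polynomials of the
   same degree. *)
Definition regular (m n : nat) (X : set 'rV[F]_m) (f : 'rV[F]_m -> 'rV[F]_n) :
    Prop :=
  forall x, X x -> exists (d : nat) (G : 'I_n -> {mpoly F[m]}),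
    let G_ y : 'rV[F]_n := \row_j (G j).@[y 0] in
    [/\ forall j, G j \is d.-homog, G_ x != 0 &
        forall y, X y -> G_ y != 0 -> same_point (f y) (G_ y)].

Definition pisomorphism (m n : nat) (X : set 'rV[F]_m) (Y : set 'rV[F]_n)
    (f : 'rV[F]_m -> 'rV[F]_n) : Prop :=
  exists g : 'rV[F]_n -> 'rV[F]_m,
    [/\ regular X f, regular Y g,
        forall x, X x -> Y (f x) /\ same_point (g (f x)) x &
        forall y, Y y -> X (g y) /\ same_point (f (g y)) y].

Definition row_of (n : nat) (l : seq F) : 'rV[F]_n := \row_(i < n) l`_i.

Definition conics_map (v : 'rV[F]_3) : 'rV[F]_6 :=
  let s := v 0 0 in let t := v 0 1 in let u := v 0 2 in
  row_of 6 [:: s ^+ 2; s * t; s * u; t ^+ 2; t * u; u ^+ 2].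

Definition veronese_surface (S : set 'rV[F]_6) : Prop :=
  exists2 A : 'M[F]_6, A \in unitmx &
    S = pimage (fun v => conics_map v *m A) (pspace 3).

(* W is a plane and X is a smooth conic in W. *)
Definition conic_in (n : nat) (W X : set 'rV[F]_n) : Prop :=
  exists (e : 'M[F]_(3, n)) (q : 'M[F]_3),
    [/\ row_free e, q^T = q /\ q \in unitmx,
        W = [set v *m e | v in pspace 3]%classic &
        X = [set v *m e | v in
               [set v | v != 0 /\ (v *m q *m v^T) 0 0 = 0]]%classic].

End Projective.

Arguments pspace : clear implicits.

(** * The fourfold Z, in the coordinates x_0, ..., x_5 of B^2 *)

Section Fourfold.
Variable R : realType.
Local Notation C := R[i].

Definition PB2K (dt : 'M[rat]_4) (K : {vspace 'M[C]_2}) : set 'rV[C]_6 :=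
  [set x | x != 0 /\ B2K dt K (theta dt x)]%classic.

Definition Z (dt : 'M[rat]_4) : set 'rV[C]_6 :=
  zclosure [set x | exists2 K, cartan K & PB2K dt K x]%classic.

Definition CK (dt : 'M[rat]_4) (K : {vspace 'M[C]_2}) : set 'rV[C]_6 :=
  [set x | PB2K dt K x /\ exists K', [/\ cartan K', K' <> K & PB2K dt K' x]]%classic.

Definition MG : 'M[{mpoly C[6]}]_3 :=
  let x (i : 'I_6) : {mpoly C[6]} := 'X_i in
  \matrix_(i < 3, j < 3)
    nth 0 (nth [::] [:: [:: 2 * x 0; - x 3; x 1 - 4 * x 5];
                        [:: - x 3; x 1; x 4];
                        [:: x 1 - 4 * x 5; x 4; 2 * x 2]] i) j.

Definition G : {mpoly C[6]} := \det MG.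

Definition nu' (v : 'rV[C]_3) : 'rV[C]_6 :=
  let s := v 0 0 in let t := v 0 1 in let u := v 0 2 in
  row_of 6 [:: s ^+ 2; 2 * u ^+ 2; t ^+ 2; - 2 * u * s; 2 * u * t;
               2^-1 * (- s * t + u ^+ 2)].

End Fourfold.

Arguments Z : clear implicits.
Arguments symplectic_group : clear implicits.

(* Main.v *)
Require Import Defs.
From HB Require Import structures.
From mathcomp Require Import all_boot all_order all_algebra.
From mathcomp Require Import boolp reals.
From mathcomp Require Import complex.
From mathcomp Require Import mpoly.
From mathcomp Require Import ring zify.

Set Implicit Arguments.
Unset Strict Implicit.
Unset Printing Implicit Defensive.

Import Order.TTheory GRing.Theory Num.Theory.
Local Open Scope ring_scope.

(** The proof has two halves: the determination of B^2 by invariant theory, and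
    the geometry of symmetric 3 x 3 matrices.

    Hodge classes.  A form [a] of degree 4 is determined by its values
    [eval4 a x y z t], obtained by four contractions, and the value of a product
    of two 2-forms is the six-term sum [product22].  For a rational form [h], the
    matrices whose diagonal action on J x J preserves these values form an
    algebraic group over Q ([eval4_stabilizer_algebraic]).  If [h] is a Hodge
    class, this group contains the circle, which multiplies the dz_i by z and
    their conjugates by z^-1; since the Hodge group of J is the whole symplectic
    group, [h] is invariant under Sp_4 ([hodge_class_invariant]).  An invariant
    alternating form on V + V, where V is the standard representation, vanishes
    when six of its values on basis vectors do ([invariant_values_eq0]): an
    element of the torus kills all but 18 values up to order, and three unipotent
    elements relate these.  The same six values of [theta x] are 1 or 2 times the
    coordinates of [x] ([eval4_theta_coord]).  Hence [theta] is injective and hits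
    every Hodge class.  Conversely, by the first Riemann relation the polarization
    is of type (1,1) ([polarization_type11]), hence so are omega_1, omega_2 and
    omega_sigma, and their products are Hodge classes.

    Geometry.  A point [x] of B^2 is a symmetric matrix [sym_mx x].  The point
    [nu (s, t, u)] is the matrix 2 w^T w for w = (s, u, t), and [polar p q] is its
    polarization p^T q + q^T p.  If [sqv v] denotes the square of [v] in Sym^2 C^2,
    then omega_v^2 = [nu (sqv v)] and omega_K^2 = [4 *: polar (sqv v) (sqv w)] for
    an eigenbasis [v], [w] of K.  So the plane of K consists of the matrices
    whose row space lies in the span of the squares of [v] and [w]; Cartan
    subalgebras correspond to unordered pairs of lines in C^2
    ([cartan_eigenbasis], [cartan_eq]).

    - All these matrices are degenerate.  Conversely a degenerate matrix is
      [polar p q] ([det0_polar]), and for [p], [q] in general position the line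
      through them meets the conic of squares in two points, so that [polar p q]
      lies in one of the planes; hence the planes are dense in (G = 0)
      ([planes_dense]).
    - G generates the ideal of Z because - G is a monic cubic in x_1, with three
      distinct roots for general values of the other variables ([Gpoly_ideal]).
      Therefore a point of Z is singular exactly when the partial derivatives of G
      vanish there, that is, when all cofactors vanish ([gradient_rank_le1]): the
      singular points are the matrices of rank one, which are the multiples of the [nu v]
      ([rank_one_nu]).  The rows of the matrix invert [nu].
    - [polar p q] is a quarter of the difference of [nu (p + q)] and [nu (p - q)],
      so every point of Z lies on a secant line of S ([polar_secant]); conversely a
      sum of two matrices of rank one is degenerate ([pencil_det]).
    - In the plane of a pair, the matrices of rank one form the conic
      c_1^2 = 4 c_0 c_2 ([plane_rank_one]).  A point of rank two lies in no other
      plane, since its row space meets the conic of squares in the two given points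
      only ([planes_meet]), while a point of rank one lies in other planes
      ([other_plane]).  So C_K is the conic of rank one points of the plane. *)

(** * Contraction on the exterior algebra *)

(** The value on four vectors of the product of two alternating forms of
    degree 2, given by the bilinear maps [p] and [q]. *)
Definition product22 (K : pzRingType) (V : Type) (p q : V -> V -> K) (x y z t : V) : K :=
  p x y * q z t - p x z * q y t + p x t * q y z
  + p y z * q x t - p y t * q x z + p z t * q x y.

Lemma product22_scale (K : comPzRingType) (V : Type) (p q : V -> V -> K)
    (f : V -> V) (c d : K) :
  (forall x y, p (f x) (f y) = c * p x y) ->
  (forall x y, q (f x) (f y) = d * q x y) -> c * d = 1 ->
  forall x y z t, product22 p q (f x) (f y) (f z) (f t) = product22 p q x y z t.
Proof.
move=> pf qf cd x y z t; rewrite /product22 !pf !qf.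
have cdM a b : c * a * (d * b) = a * b by rewrite mulrACA cd mul1r.
by rewrite !cdM.
Qed.

(** The expansion of a fourfold contraction of a product of 2-forms: [s] is the
    component of degree 0 and the five factors on which it vanishes have positive
    degree. *)
Lemma additive_mul_expand (F : comNzRingType) (V : zmodType) (s : V -> F)
    (w : V -> V -> V) (sD : forall u v, s (u + v) = s u + s v)
    (sN : forall u, s (- u) = - s u) (sM : forall u v, s (w u v) = s u * s v)
    (u1 v1 u2 v2 u3 v3 u4 v4 u5 v5 u6 v6 u7 v7 u8 v8 u9 v9 u10 v10 u11 v11 : V) :
  s u3 = 0 -> s u4 = 0 -> s u5 = 0 -> s u6 = 0 -> s u9 = 0 ->
  s (w u1 v1 + (w u2 v2 + w u3 v3 + (w u4 v4 - w u5 v5))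
    + (w u6 v6 + (w u7 v7 - w u8 v8) - (w u9 v9 + (w u10 v10 - w u11 v11)))) =
  s u1 * s v1 - s u10 * s v10 + s u11 * s v11 + s u7 * s v7 - s u8 * s v8
   + s u2 * s v2.
Proof.
move=> s3 s4 s5 s6 s9; rewrite !(sD, sN, sM) s3 s4 s5 s6 s9; ring.
Qed.

Section Contraction.
Variables (F : fieldType) (n : nat).
Implicit Types (a b : ext F n) (A B : {set 'I_n}) (i j : 'I_n).

(** The number of elements of [A] below [i]. *)
Definition before i A : nat := #|[set j in A | (j < i)%N]|.

(** Contraction with the [i]-th basis vector. *)
Definition contract1 i a : ext F n :=
  [ffun A : {set 'I_n} =>
     if i \in A then 0 else (-1) ^+ before i A * a (i |: A)%SET].

(** Contractions and values of multilinear forms are locked with this key, so that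
    conversion never unfolds them. *)
Fact contract_key : unit. Proof. by []. Qed.

(** Contraction with the vector [x]. *)
Definition contract (x : 'cV[F]_n) a : ext F n :=
  locked_with contract_key (\sum_i x i 0 *: contract1 i a).

Lemma contractE x a : contract x a = \sum_i x i 0 *: contract1 i a.
Proof. by rewrite /contract unlock. Qed.

(** The component of degree 0. *)
Definition scalar_part a : F := locked_with contract_key (a set0).

Lemma scalar_partE a : scalar_part a = a set0.
Proof. by rewrite /scalar_part unlock. Qed.

(** The grading involution, which is the sign of contraction past a form. *)
Definition involute a : ext F n := [ffun A : {set 'I_n} => (-1) ^+ #|A| * a A].

Lemma wedgeDl a b c : (a + b) \^ c = a \^ c + b \^ c.
Proof.
apply/ffunP => A; rewrite !ffunE -big_split /=; apply: eq_bigr => B _.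
by rewrite !ffunE mulrDr mulrDl.
Qed.

Lemma wedgeDr a b c : c \^ (a + b) = c \^ a + c \^ b.
Proof.
apply/ffunP => A; rewrite !ffunE -big_split /=; apply: eq_bigr => B _.
by rewrite !ffunE mulrDr.
Qed.

Lemma wedgeZl k a c : (k *: a) \^ c = k *: (a \^ c).
Proof.
apply/ffunP => A; rewrite !ffunE scaler_sumr; apply: eq_bigr => B _.
by rewrite !ffunE /GRing.scale /= mulrCA !mulrA.
Qed.

Lemma wedgeZr k a c : c \^ (k *: a) = k *: (c \^ a).
Proof.
apply/ffunP => A; rewrite !ffunE scaler_sumr; apply: eq_bigr => B _.
by rewrite !ffunE /GRing.scale /= mulrCA !mulrA.
Qed.

(** The number of elements of [A] above [i]. *)
Definition after i A : nat := #|[set j in A | (i < j)%N]|.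

Lemma beforeE i A : before i A = (\sum_(j in A) (j < i))%N.
Proof.
by rewrite /before -sum1dep_card big_mkcondr /=; apply: eq_bigr => j _; case: ifP.
Qed.

Lemma afterE i A : after i A = (\sum_(j in A) (i < j))%N.
Proof.
by rewrite /after -sum1dep_card big_mkcondr /=; apply: eq_bigr => j _; case: ifP.
Qed.

Lemma inversionsE A B : inversions A B = (\sum_(i in A) before i B)%N.
Proof.
rewrite /inversions -sum1dep_card.
under [RHS]eq_bigr do rewrite /before -sum1dep_card.
by rewrite pair_big_dep.
Qed.

Lemma inversionsEr A B : inversions A B = (\sum_(j in B) after j A)%N.
Proof.
rewrite inversionsE; under eq_bigr do rewrite beforeE.
by rewrite exchange_big; apply: eq_bigr => j _; rewrite afterE.
Qed.

Lemma before_after i A : i \notin A -> (before i A + after i A = #|A|)%N.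
Proof.
move=> iA; rewrite beforeE afterE -big_split -sum1_card /=.
apply: eq_bigr => j jA; case: (ltngtP j i) => // /val_inj ji.
by move: iA; rewrite -ji jA.
Qed.

Lemma inversionsUl i A B : i \notin A ->
  inversions (i |: A)%SET B = (before i B + inversions A B)%N.
Proof. by move=> iA; rewrite !inversionsE big_setU1. Qed.

Lemma inversionsUr i A B : i \notin B ->
  inversions A (i |: B)%SET = (after i A + inversions A B)%N.
Proof. by move=> iA; rewrite !inversionsEr big_setU1. Qed.

Lemma before_disjoint i A B : B \subset A ->
  before i A = (before i B + before i (A :\: B)%SET)%N.
Proof.
move=> sBA; rewrite !beforeE (big_setID B) /=; congr addn.
by apply: eq_bigl => j; rewrite inE andbC; case: (boolP (j \in B)) => //= /(subsetP sBA).
Qed.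

Lemma setU1S i A B : i \notin B -> (i |: B \subset i |: A)%SET = (B \subset A).
Proof.
move=> iB; apply/idP/idP => [sBA|]; last exact: setUS.
apply/subsetP => j jB; have := subsetP sBA j; rewrite !inE jB orbT => /(_ isT).
by case: eqP => // ji; move: iB; rewrite -ji jB.
Qed.

(** Contraction is an antiderivation. *)
Lemma contract1_wedge i a b :
  contract1 i (a \^ b) = contract1 i a \^ b + involute a \^ contract1 i b.
Proof.
apply/ffunP => A; rewrite !ffunE.
case: (boolP (i \in A)) => iA.
(* Both sums run over the [B] containing [i], the first one after replacing [B]
   by [B :\ i]; their terms cancel in pairs. *)
- rewrite (bigID (fun B : {set 'I_n} => i \in B)) /=.
  rewrite big1 ?add0r; last by move=> B /andP[_ iB]; rewrite !ffunE iB mulr0 mul0r.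
  rewrite [X in _ + X](bigID (fun B : {set 'I_n} => i \in B)) /=.
  rewrite [X in _ + (_ + X)]big1 ?addr0; last first.
    by move=> B /andP[_ iB]; rewrite !ffunE inE iA iB mulr0.
  rewrite (reindex_onto (fun B => B :\ i)%SET (fun B => i |: B)%SET) /=; last first.
    by move=> B /andP[_ iB]; rewrite setU1K.
  rewrite [X in X + _](_ : _ = \sum_(B : {set 'I_n} | (B \subset A) && (i \in B))
      (-1) ^+ inversions (B :\ i)%SET (A :\: (B :\ i))%SET *
      contract1 i a (B :\ i)%SET * b (A :\: (B :\ i))%SET); last first.
    apply: eq_bigl => B; rewrite !inE eqxx /= andbT.
    case: (boolP (i \in B)) => iB.
      rewrite setD1K // eqxx !andbT; apply/idP/idP => sBA.
        by rewrite -(setD1K iB) subUset sub1set iA.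
      by rewrite (subset_trans _ sBA) // subD1set.
    rewrite !andbF; apply/negbTE/negP => /andP[_ /eqP iBB].
    by move: iB; rewrite -iBB !inE eqxx.
  rewrite -big_split big1 //= => B /andP[sBA iB].
  have [C iC eB] : exists2 C : {set 'I_n}, i \notin C & B = (i |: C)%SET.
    by exists (B :\ i)%SET; rewrite ?setD1K // !inE eqxx.
  have iAB : i \notin (A :\: B)%SET by rewrite !inE iB.
  have eA : (A :\: (B :\ i) = i |: (A :\: B))%SET.
    apply/setP => j; rewrite !inE; case: eqP => //= -> ; exact: iA.
  rewrite eA !ffunE (negbTE iAB); move: (A :\: B)%SET iAB => D iD.
  rewrite {}eB setU1K // (negbTE iC) inversionsUr // inversionsUl // cardsU1 iC.
  rewrite -(before_after iC) !exprD.
  set x := (-1) ^+ after _ _; set y := (-1) ^+ inversions _ _.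
  set z := (-1) ^+ before i C; set t := (-1) ^+ before _ _.
  have tt : t * t = 1 by rewrite /t -expr2 sqrr_sign.
  by ring: tt.
(* The terms of the left-hand side with [i] in [B] give the first product, those
   with [i] outside [B] the second. *)
- rewrite mulr_sumr [LHS](bigID (fun B : {set 'I_n} => i \in B)) /=; congr (_ + _).
    rewrite (reindex_onto (fun B => i |: B)%SET (fun B => B :\ i)%SET) /=; last first.
      by move=> B /andP[_ iB]; rewrite setD1K.
    rewrite [RHS](bigID (fun B : {set 'I_n} => i \in B)) /=.
    rewrite [X in _ = X + _]big1 ?add0r; last first.
      by move=> B /andP[_ iB]; rewrite !ffunE iB mulr0 mul0r.
    apply: eq_big => [B|B /andP[/andP[sBA _] /eqP eB]].
      rewrite !inE eqxx andbT; case: (boolP (i \in B)) => iB.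
        rewrite andbF; apply/negbTE/negP => /andP[_ /eqP iBB].
        by move: iB; rewrite -iBB !inE eqxx.
      by rewrite setU1K // eqxx !andbT setU1S.
    have iB : i \notin B by rewrite -eB !inE eqxx.
    have {}sBA : B \subset A by rewrite -(setU1S _ iB).
    rewrite !ffunE (negbTE iB) inversionsUl //.
    have -> : ((i |: A) :\: (i |: B) = A :\: B)%SET.
      apply/setP => j; rewrite !inE; case: eqP => //= ->.
      by rewrite (negbTE iA) andbF.
    rewrite (before_disjoint i sBA) !exprD.
    set t := (-1) ^+ before i (A :\: B)%SET.
    have tt : t * t = 1 by rewrite /t -expr2 sqrr_sign.
    by ring: tt.
  apply: eq_big => [B|B /andP[sBA iB]].
    apply/andP/idP => [[sBA iB]|sBA].
      apply/subsetP => j jB; have := subsetP sBA j jB; rewrite !inE.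
      by case: eqP => // ji; move: iB; rewrite -ji jB.
    split; first by rewrite (subset_trans sBA) // subsetUr.
    by apply/negP => /(subsetP sBA); apply/negP.
  have {}sBA : B \subset A.
    apply/subsetP => j jB; have := subsetP sBA j jB; rewrite !inE.
    by case: eqP => // ji; move: iB; rewrite -ji jB.
  have iAB : i \notin (A :\: B)%SET by rewrite !inE (negbTE iA) andbF.
  rewrite !ffunE (negbTE iAB).
  have -> : ((i |: A) :\: B = i |: (A :\: B))%SET.
    by apply/setP => j; rewrite !inE; case: eqP => //= ->; rewrite iB.
  rewrite inversionsUr // (before_disjoint i sBA) -(before_after iB) !exprD.
  set t := (-1) ^+ before i B.
  have tt : t * t = 1 by rewrite /t -expr2 sqrr_sign.
  by ring: tt.
Qed.

Lemma contract1_is_linear i : linear (contract1 i).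
Proof.
move=> k a b; apply/ffunP => A; rewrite !ffunE /=; case: ifP => _.
  by rewrite scaler0 addr0.
by rewrite /GRing.scale /= mulrDr mulrCA.
Qed.

HB.instance Definition _ i :=
  GRing.isLinear.Build F (ext F n) (ext F n) _ (contract1 i)
    (contract1_is_linear i).

Lemma contract_is_linear x : linear (contract x).
Proof.
move=> k a b; rewrite !contractE scaler_sumr -big_split; apply: eq_bigr => i _.
by rewrite linearP scalerDr !scalerA mulrC.
Qed.

HB.instance Definition _ x :=
  GRing.isLinear.Build F (ext F n) (ext F n) _ (contract x)
    (contract_is_linear x).

Lemma contract0 x : contract x 0 = 0.
Proof. exact: linear0. Qed.

Lemma scalar_partD a b : scalar_part (a + b) = scalar_part a + scalar_part b.
Proof. by rewrite !scalar_partE ffunE. Qed.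

Lemma scalar_partN a : scalar_part (- a) = - scalar_part a.
Proof. by rewrite !scalar_partE ffunE. Qed.

Lemma scalar_partZ k a : scalar_part (k *: a) = k * scalar_part a.
Proof. by rewrite !scalar_partE ffunE. Qed.

Lemma contractD x a b : contract x (a + b) = contract x a + contract x b.
Proof. exact: linearD. Qed.

Lemma contractN x a : contract x (- a) = - contract x a.
Proof. exact: linearN. Qed.

Lemma contractDl x y a : contract (x + y) a = contract x a + contract y a.
Proof. by rewrite !contractE -big_split; apply: eq_bigr => i _ /=; rewrite mxE scalerDl. Qed.

Lemma contractZl k x a : contract (k *: x) a = k *: contract x a.
Proof. by rewrite !contractE scaler_sumr; apply: eq_bigr => i _ /=; rewrite mxE scalerA. Qed.

Lemma contract0l a : contract 0 a = 0.
Proof. by rewrite !contractE big1 // => i _; rewrite mxE scale0r. Qed.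

Lemma contract_delta i a : contract (delta_mx i 0) a = contract1 i a.
Proof.
rewrite !contractE (bigD1 i) //= mxE !eqxx scale1r big1 ?addr0 // => j ji.
by rewrite mxE (negbTE ji) scale0r.
Qed.

Lemma wedge0l a : 0 \^ a = 0.
Proof. by rewrite -(scale0r (0 : ext F n)) wedgeZl !scale0r. Qed.

Lemma wedge0r a : a \^ 0 = 0.
Proof. by rewrite -(scale0r (0 : ext F n)) wedgeZr !scale0r. Qed.

Lemma wedge_suml (I : Type) (r : seq I) (P : pred I) (f : I -> ext F n) a :
  (\sum_(i <- r | P i) f i) \^ a = \sum_(i <- r | P i) f i \^ a.
Proof. by apply: (big_morph (fun b => b \^ a)) => [b c|]; rewrite ?wedgeDl ?wedge0l. Qed.

Lemma wedge_sumr (I : Type) (r : seq I) (P : pred I) (f : I -> ext F n) a :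
  a \^ (\sum_(i <- r | P i) f i) = \sum_(i <- r | P i) a \^ f i.
Proof. by apply: (big_morph (fun b => a \^ b)) => [b c|]; rewrite ?wedgeDr ?wedge0r. Qed.

Lemma contract_wedge x a b :
  contract x (a \^ b) = contract x a \^ b + involute a \^ contract x b.
Proof.
rewrite !contractE wedge_suml wedge_sumr -big_split; apply: eq_bigr => i _.
by rewrite contract1_wedge scalerDr wedgeZl wedgeZr.
Qed.

Lemma inversions0l A : inversions set0 A = 0%N.
Proof. by rewrite inversionsE big_set0. Qed.

Lemma inversions0r A : inversions A set0 = 0%N.
Proof. by rewrite inversionsEr big_set0. Qed.

Lemma scalar_part_wedge a b :
  scalar_part (a \^ b) = scalar_part a * scalar_part b.
Proof.
rewrite !scalar_partE ffunE (big_pred1 set0) => [|B]; last by rewrite subset0.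
by rewrite setD0 inversions0l expr0 mul1r.
Qed.

Lemma wedge1r a : a \^ ext1 = a.
Proof.
apply/ffunP => A; rewrite ffunE (bigD1 A) //= setDv ffunE eqxx mulr1.
rewrite big1 ?addr0 => [|B /andP[sBA neqBA]].
  by rewrite inversions0r expr0 mul1r.
rewrite ffunE setD_eq0; case: (boolP (A \subset B)) => [sAB|_]; last by rewrite mulr0.
by case/eqP: neqBA; apply/eqP; rewrite eqEsubset sBA.
Qed.

Lemma ext_degreeD k a b : ext_degree k a -> ext_degree k b -> ext_degree k (a + b).
Proof. by move=> da db A kA; rewrite ffunE da ?db ?addr0. Qed.

Lemma ext_degreeZ k c a : ext_degree k a -> ext_degree k (c *: a).
Proof. by move=> da A kA; rewrite ffunE da ?scaler0. Qed.

Lemma ext_degreeN k a : ext_degree k a -> ext_degree k (- a).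
Proof. by move=> da; rewrite -scaleN1r; apply: ext_degreeZ. Qed.

Lemma ext_degree_sum k (I : Type) (r : seq I) (P : pred I) (f : I -> ext F n) :
  (forall u, P u -> ext_degree k (f u)) -> ext_degree k (\sum_(u <- r | P u) f u).
Proof.
move=> df; apply: (big_ind (ext_degree k)) => // [A _|a b]; first by rewrite ffunE.
exact: ext_degreeD.
Qed.

Lemma ext_degree_wedge k l a b :
  ext_degree k a -> ext_degree l b -> ext_degree (k + l) (a \^ b).
Proof.
move=> da db A neqA; rewrite ffunE big1 // => B sBA.
have [kB|/da->] := eqVneq #|B| k; last by rewrite mulr0 mul0r.
rewrite db ?mulr0 //; apply: contraNneq neqA => lB.
by rewrite -kB -lB -(cardsID B A) (setIidPr sBA).
Qed.

Lemma ext_degree_form1 v : ext_degree 1 (form1 v : ext F n).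
Proof.
move=> A neqA; rewrite ffunE big1 // => i /eqP eA.
by rewrite eA cards1 in neqA.
Qed.

Lemma ext_degree_contract k x a : ext_degree k.+1 a -> ext_degree k (contract x a).
Proof.
move=> da; rewrite contractE; apply: ext_degree_sum => i _; apply: ext_degreeZ => A neqA.
rewrite ffunE; case: ifP => // /negbT iA; rewrite da ?mulr0 //.
by rewrite cardsU1 iA.
Qed.

Lemma contract_degree0 x a : ext_degree 0 a -> contract x a = 0.
Proof.
move=> da; rewrite !contractE big1 // => i _; apply/ffunP => A; rewrite !ffunE.
case: ifP => // _; rewrite ?scaler0 // da ?mulr0 ?scaler0 //.
by rewrite cards_eq0; apply/set0Pn; exists i; rewrite !inE eqxx.
Qed.

Lemma involute_degree k a : ext_degree k a -> involute a = (-1) ^+ k *: a.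
Proof.
move=> da; apply/ffunP => A; rewrite !ffunE /GRing.scale /=.
by have [->//|/da->] := eqVneq #|A| k; rewrite !mulr0.
Qed.

Lemma scalar_part_degree k a : ext_degree k.+1 a -> scalar_part a = 0.
Proof. by rewrite scalar_partE; apply; rewrite cards0. Qed.

Lemma contract_form1 x v : contract x (form1 v) = (v *m x) 0 0 *: ext1.
Proof.
apply/ffunP => A; rewrite !contractE sum_ffunE !ffunE mxE /GRing.scale /=.
rewrite mulr_suml; apply: eq_bigr => i _; rewrite !ffunE.
rewrite /GRing.scale /= [v 0 i * _]mulrC -mulrA; congr (_ * _).
case: (boolP (i \in A)) => iA.
  by case: eqP => [A0|_]; [move: iA; rewrite A0 inE | rewrite mulr0].
have [->|/set0Pn[j jA]] := eqVneq A set0.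
  rewrite /= mulr1 setU0 beforeE big_set0 expr0 mul1r (big_pred1 i) // => j.
  by rewrite /= (inj_eq set1_inj) eq_sym.
rewrite mulr0 big1 ?mulr0 // => l /eqP eA.
have := cards1 l; rewrite -eA cardsU1 iA (cardsD1 j) jA.
by [].
Qed.

(** [eval2 a] and [eval4 a] are the alternating multilinear forms of a form
    [a] of degree 2 and 4. *)
Definition eval2 a x y : F :=
  locked_with contract_key (scalar_part (contract y (contract x a))).

Lemma eval2E a x y : eval2 a x y = scalar_part (contract y (contract x a)).
Proof. by rewrite /eval2 unlock. Qed.

Definition eval4 a x y z t : F := locked_with contract_key
  (scalar_part (contract t (contract z (contract y (contract x a))))).

Lemma eval4E a x y z t : eval4 a x y z t =
  scalar_part (contract t (contract z (contract y (contract x a)))).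
Proof. by rewrite /eval4 unlock. Qed.

Lemma contract2_wedge k a b x y : ext_degree k a ->
  contract y (contract x (a \^ b)) =
    contract y (contract x a) \^ b + a \^ contract y (contract x b)
  + (-1) ^+ k *: (contract y a \^ contract x b - contract x a \^ contract y b).
Proof.
case: k => [|k] da.
  rewrite !contract_wedge !(contract_degree0 _ da) contract0 !wedge0l !add0r.
  rewrite !(involute_degree da) expr0 !scale1r contract_wedge.
  by rewrite (contract_degree0 _ da) (involute_degree da) expr0 wedge0l scale1r add0r oppr0 addr0.
rewrite contract_wedge contractD !contract_wedge.
rewrite (involute_degree da) (involute_degree (ext_degree_contract (x) da)).
have -> : contract y ((-1) ^+ k.+1 *: a) = (-1) ^+ k.+1 *: contract y a.
  exact: linearZ.
have -> : involute ((-1) ^+ k.+1 *: a) = a.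
  rewrite (involute_degree (k := k.+1)); last exact: ext_degreeZ.
  by rewrite scalerA -expr2 sqrr_sign scale1r.
rewrite !wedgeZl exprS mulN1r scalerBr !scaleNr opprK.
rewrite -!addrA; congr (_ + _); rewrite addrA addrC; congr (_ + _).
exact: addrC.
Qed.

Local Opaque contract wedge scalar_part.

Lemma contract2_wedge0 a b x y : ext_degree 0 a ->
  contract y (contract x (a \^ b)) = a \^ contract y (contract x b).
Proof.
move=> da; rewrite (contract2_wedge _ _ _ da) !(contract_degree0 _ da) contract0.
by rewrite !wedge0l subr0 scaler0 add0r addr0.
Qed.

Lemma contract2_wedge1 a b x y : ext_degree 1 a ->
  contract y (contract x (a \^ b)) = a \^ contract y (contract x b)
    + (contract x a \^ contract y b - contract y a \^ contract x b).
Proof.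
move=> da; rewrite (contract2_wedge _ _ _ da) contract_degree0; last first.
  exact: ext_degree_contract.
by rewrite wedge0l add0r expr1 scaleN1r opprB.
Qed.

Lemma eval4_wedge a b x y z t : ext_degree 2 a -> ext_degree 2 b ->
  eval4 (a \^ b) x y z t = product22 (eval2 a) (eval2 b) x y z t.
Proof.
move=> da db; rewrite /product22 !eval4E !eval2E.
have d1 (c : ext F n) u : ext_degree 2 c -> ext_degree 1 (contract u c).
  exact: ext_degree_contract.
have d0 (c : ext F n) u v : ext_degree 2 c -> ext_degree 0 (contract v (contract u c)).
  by move=> dc; apply: ext_degree_contract; apply: d1.
rewrite (contract2_wedge _ _ _ da) sqrrN expr1n scale1r !contractD !contractN.
rewrite (contract2_wedge _ _ _ da) (contract2_wedge0 _ _ _ (d0 a x y da)).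
rewrite (contract2_wedge1 _ _ _ (d1 a x da)) (contract2_wedge1 _ _ _ (d1 a y da)).
rewrite sqrrN expr1n scale1r.
apply: (additive_mul_expand scalar_partD scalar_partN scalar_part_wedge).
all: by [exact: (scalar_part_degree da) | exact: (scalar_part_degree (d1 _ _ da))].
Qed.

Lemma eval2_wedge_form1 u v x y :
  eval2 (form1 u \^ form1 v) x y =
  (u *m x) 0 0 * (v *m y) 0 0 - (u *m y) 0 0 * (v *m x) 0 0.
Proof.
rewrite eval2E (contract2_wedge _ _ _ (ext_degree_form1 u)) !contract_form1.
rewrite !(scalar_partD, scalar_partN, scalar_partZ, scalar_part_wedge).
have e0 w : scalar_part (form1 w) = 0 := scalar_part_degree (ext_degree_form1 w).
have e1 : scalar_part ext1 = 1 :> F by rewrite scalar_partE ffunE eqxx.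
rewrite !e0 e1; ring.
Qed.

(** A form of positive degree with vanishing contractions is zero. *)
Lemma contract1_inj k a : ext_degree k.+1 a -> (forall i, contract1 i a = 0) -> a = 0.
Proof.
move=> da a0; apply/ffunP => A; rewrite [RHS]ffunE.
have [kA|/da//] := eqVneq #|A| k.+1.
have [i iA] : exists i, i \in A by apply/set0Pn; rewrite -cards_eq0 kA.
have /ffunP/(_ (A :\ i)%SET) := a0 i; rewrite !ffunE !inE eqxx /= setD1K //.
by move/eqP; rewrite mulf_eq0 signr_eq0 => /eqP.
Qed.

Lemma contract1C i j a : contract1 i (contract1 j a) = - contract1 j (contract1 i a).
Proof.
apply/ffunP => A; rewrite !ffunE !inE.
case: (boolP (i \in A)) => iA; case: (boolP (j \in A)) => jA;
  rewrite ?(orbT, orbF) ?(mulr0, oppr0) //.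
rewrite [j == i]eq_sym; case: eqP => [_|/eqP ij]; rewrite ?mulr0 ?oppr0 //.
rewrite !setUA [(j |: [set i])%SET]setUC -!mulrN.
rewrite !beforeE !big_setU1 //= !exprD.
case: (ltngtP i j) => [||/val_inj] /=; last by move/eqP: ij.
  move=> _; rewrite ?expr0 ?expr1; ring.
move=> _; rewrite ?expr0 ?expr1; ring.
Qed.

Lemma contractC x y a : contract x (contract y a) = - contract y (contract x a).
Proof.
rewrite contractE [in RHS]contractE -sumrN.
under eq_bigr do rewrite !contractE linear_sum scaler_sumr.
rewrite exchange_big; apply: eq_bigr => j _ /=.
rewrite !contractE linear_sum scaler_sumr -sumrN; apply: eq_bigr => i _ /=.
by rewrite !linearZ /= contract1C !scalerN !scalerA mulrC.
Qed.

Lemma eval4_swap12 a x y z t : eval4 a y x z t = - eval4 a x y z t.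
Proof. by rewrite !eval4E [contract x (contract y _)]contractC !contractN scalar_partN. Qed.

Lemma eval4_swap23 a x y z t : eval4 a x z y t = - eval4 a x y z t.
Proof. by rewrite !eval4E [contract y (contract z _)]contractC !contractN scalar_partN. Qed.

Lemma eval4_swap34 a x y z t : eval4 a x y t z = - eval4 a x y z t.
Proof. by rewrite !eval4E [contract z (contract t _)]contractC scalar_partN. Qed.

Lemma eval4D a b x y z t : eval4 (a + b) x y z t = eval4 a x y z t + eval4 b x y z t.
Proof. by rewrite !eval4E !contractD scalar_partD. Qed.

Lemma eval4N a x y z t : eval4 (- a) x y z t = - eval4 a x y z t.
Proof. by rewrite !eval4E !contractN scalar_partN. Qed.

Lemma eval4_inj a b : ext_degree 4 a -> ext_degree 4 b ->
  (forall x y z t, eval4 a x y z t = eval4 b x y z t) -> a = b.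
Proof.
move=> da db ab; have ab0 x y z t : eval4 (a - b) x y z t = 0.
  by rewrite eval4D eval4N ab subrr.
apply/eqP; rewrite -subr_eq0; apply/eqP.
have d4 : ext_degree 4 (a - b) by apply/ext_degreeD/ext_degreeN.
apply: (contract1_inj d4) => i.
have d3 := ext_degree_contract (delta_mx i 0) d4; rewrite -contract_delta.
apply: (contract1_inj d3) => j.
have d2 := ext_degree_contract (delta_mx j 0) d3; rewrite -contract_delta.
apply: (contract1_inj d2) => k.
have d1 := ext_degree_contract (delta_mx k 0) d2; rewrite -contract_delta.
apply: (contract1_inj d1) => l.
have d0 := ext_degree_contract (delta_mx l 0) d1; rewrite -contract_delta.
apply/ffunP => A; rewrite [RHS]ffunE; have [->|A0] := eqVneq A set0.
  by rewrite -scalar_partE -eval4E ab0.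
by apply: d0; rewrite cards_eq0.
Qed.

End Contraction.

(** * Multilinear values and the algebraicity of their stabilizers *)

Section Multilinear.
Variables (F : fieldType) (n : nat).
Implicit Types (a b : ext F n) (x y z t : 'cV[F]_n).
Local Notation e i := (delta_mx i 0 : 'cV[F]_n).

Lemma contract_suml (I : Type) (r : seq I) (P : pred I) (x : I -> 'cV[F]_n) a :
  contract (\sum_(i <- r | P i) x i) a = \sum_(i <- r | P i) contract (x i) a.
Proof.
by apply: (big_morph (fun x => contract x a)) => [y z|];
  rewrite ?contractDl ?contract0l.
Qed.

Lemma scalar_part_sum (I : Type) (r : seq I) (P : pred I) (f : I -> ext F n) :
  scalar_part (\sum_(i <- r | P i) f i) = \sum_(i <- r | P i) scalar_part (f i).
Proof.
apply: (big_morph (@scalar_part F n) (@scalar_partD F n)).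
by rewrite scalar_partE ffunE.
Qed.

Lemma contract_sumr (I : Type) (r : seq I) (P : pred I) (f : I -> ext F n) x :
  contract x (\sum_(i <- r | P i) f i) = \sum_(i <- r | P i) contract x (f i).
Proof. exact: linear_sum. Qed.

Lemma contractZ k x a : contract x (k *: a) = k *: contract x a.
Proof. exact: linearZ. Qed.

Lemma col_basis x : x = \sum_i x i 0 *: e i.
Proof.
apply/colP => j; rewrite summxE (bigD1 j) //= !mxE !eqxx mulr1 big1 ?addr0 // => i ij.
by rewrite !mxE eq_sym (negbTE ij) mulr0.
Qed.

Lemma eval4_sum4 (u : 'I_n -> 'cV[F]_n) a (x y z t : 'cV[F]_n) :
  eval4 a (\sum_i x i 0 *: u i) (\sum_i y i 0 *: u i) (\sum_i z i 0 *: u i)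
    (\sum_i t i 0 *: u i) =
  \sum_i \sum_j \sum_k \sum_l x i 0 * y j 0 * z k 0 * t l 0
    * eval4 a (u i) (u j) (u k) (u l).
Proof.
rewrite !eval4E [contract (\sum_i x i 0 *: _) _]contract_suml !contract_sumr scalar_part_sum.
apply: eq_bigr => i _; rewrite contractZl !contractZ.
rewrite [contract (\sum_i y i 0 *: _) _]contract_suml !contract_sumr scaler_sumr scalar_part_sum.
apply: eq_bigr => j _; rewrite contractZl !contractZ scalerA.
rewrite [contract (\sum_i z i 0 *: _) _]contract_suml !contract_sumr scaler_sumr scalar_part_sum.
apply: eq_bigr => k _; rewrite contractZl !contractZ scalerA.
rewrite [contract (\sum_i t i 0 *: _) _]contract_suml scaler_sumr scalar_part_sum.
by apply: eq_bigr => l _; rewrite contractZl scalerA scalar_partZ eval4E.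
Qed.

Lemma eval4_basis a x y z t : eval4 a x y z t =
  \sum_i \sum_j \sum_k \sum_l x i 0 * y j 0 * z k 0 * t l 0
    * eval4 a (e i) (e j) (e k) (e l).
Proof. by rewrite -eval4_sum4 -!col_basis. Qed.

(** A linear substitution preserves the values of [a] as soon as it preserves
    its values on the standard basis. *)
Lemma eval4_subst (N : 'M[F]_n) a :
  (forall i j k l, eval4 a (N *m e i) (N *m e j) (N *m e k) (N *m e l)
     = eval4 a (e i) (e j) (e k) (e l)) ->
  forall x y z t, eval4 a (N *m x) (N *m y) (N *m z) (N *m t) = eval4 a x y z t.
Proof.
move=> Na x y z t; rewrite [RHS]eval4_basis.
have Nx w : N *m w = \sum_i w i 0 *: (N *m e i).
  rewrite {1}(col_basis w) mulmx_sumr; apply: eq_bigr => i _.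
  by rewrite -scalemxAr.
rewrite !Nx eval4_sum4.
by do 4![apply: eq_bigr => ? _]; rewrite Na.
Qed.

Lemma eval4Z k a x y z t : eval4 (k *: a) x y z t = k * eval4 a x y z t.
Proof. by rewrite !eval4E !contractZ scalar_partZ. Qed.

Lemma eval4_sum (I : Type) (r : seq I) (P : pred I) (f : I -> ext F n) x y z t :
  eval4 (\sum_(i <- r | P i) f i) x y z t = \sum_(i <- r | P i) eval4 (f i) x y z t.
Proof.
rewrite eval4E !contract_sumr scalar_part_sum.
by apply: eq_bigr => ? _; rewrite eval4E.
Qed.

End Multilinear.

Section Complexify.
Variable (R : realType).
Local Notation C := R[i].

Lemma complexify_contract1 n i (a : ext rat n) :
  complexify R (contract1 i a) = contract1 i (complexify R a).
Proof.
apply/ffunP => A; rewrite !ffunE; case: ifP => _; first by rewrite rmorph0.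
by rewrite rmorphM rmorphXn rmorphN1.
Qed.

Lemma eval4_complexify n (a : ext rat n) i j k l :
  eval4 (complexify R a) (delta_mx i 0) (delta_mx j 0) (delta_mx k 0) (delta_mx l 0) =
  ratr (eval4 a (delta_mx i 0) (delta_mx j 0) (delta_mx k 0) (delta_mx l 0)).
Proof.
rewrite !eval4E !contract_delta -!complexify_contract1 !scalar_partE.
by rewrite ffunE.
Qed.

(** The diagonal action on [J x J]. *)
Definition diag2 (K : pzRingType) (g : 'M[K]_4) : 'M[K]_(4 + 4) := block_mx g 0 0 g.

(** The matrices acting on H^1(J) whose diagonal action preserves the values of
    [a]. *)
Definition eval4_stabilizer (a : ext C (4 + 4)) : 'M[C]_4 -> Prop :=
  fun g => g \in unitmx /\ forall x y z t,
    eval4 a (diag2 g *m x) (diag2 g *m y) (diag2 g *m z) (diag2 g *m t)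
    = eval4 a x y z t.

Lemma diag2M (K : comPzRingType) (g h : 'M[K]_4) : diag2 (g *m h) = diag2 g *m diag2 h.
Proof. by rewrite /diag2 mulmx_block !mul0mx !mulmx0 !addr0 !add0r. Qed.

Lemma diag2_1 (K : comPzRingType) : diag2 (1%:M : 'M[K]_4) = 1%:M.
Proof. by rewrite /diag2 -scalar_mx_block. Qed.

Lemma diag2_col (g : 'M[C]_4) j i : (diag2 g *m (delta_mx j 0 : 'cV_(4 + 4))) i 0 = diag2 g i j.
Proof. by rewrite -colE mxE. Qed.

Lemma eval4_stabilizer_algebraic (h : ext rat (4 + 4)) :
  Q_algebraic_subgroup (eval4_stabilizer (complexify R h)).
Proof.
set a := complexify R h; split.
- by split=> [|x y z t]; [apply: unitmx1 | rewrite diag2_1 !mul1mx].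
- move=> g1 g2 [u1 s1] [u2 s2]; split; first by rewrite unitmx_mul u1.
  by move=> x y z t; rewrite diag2M -!mulmxA s1 s2.
- move=> g [ug sg]; split; first by rewrite unitmx_inv.
  have gK (x : 'cV_(4 + 4)) : diag2 g *m (diag2 (invmx g) *m x) = x.
    by rewrite mulmxA -diag2M mulmxV // diag2_1 mul1mx.
  by move=> x y z t; rewrite -sg !gK.
(* The equations say that the generic matrix preserves the values of [h] on the
   standard basis. *)
pose X : 'M[{mpoly rat[4 * 4]}]_4 := \matrix_(i, j) 'X_(mxvec_index i j).
pose e i : 'cV[rat]_(4 + 4) := delta_mx i 0.
pose B i j k l := eval4 h (e i) (e j) (e k) (e l).
pose p i' j' k' l' : {mpoly rat[4 * 4]} :=
  (\sum_i \sum_j \sum_k \sum_l diag2 X i i' * diag2 X j j' * diag2 X k k'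
    * diag2 X l l' * (B i j k l)%:MP) - (B i' j' k' l')%:MP.
exists (fun q => exists i j k l, q = p i j k l) => g.
pose ev (q : {mpoly rat[4 * 4]}) : C := (map_mpoly (ratr : rat -> C) q).@[mxvec g 0].
have evB q r : ev (q - r) = ev q - ev r by rewrite /ev !raddfB.
have evM q r : ev (q * r) = ev q * ev r by rewrite /ev !rmorphM.
have evC c : ev c%:MP = ratr c by rewrite /ev map_mpolyC mevalC.
have ev0 : ev 0 = 0 by rewrite /ev !raddf0.
have evD q r : ev (q + r) = ev q + ev r by rewrite /ev !raddfD.
have ev_sum (f : 'I_(4 + 4) -> {mpoly rat[4 * 4]}) : ev (\sum_i f i) = \sum_i ev (f i).
  exact: (big_morph ev evD ev0).
have Xg i j : ev (diag2 X i j) = diag2 g i j.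
  rewrite /diag2; case: (split_ordP i) => i' ->; case: (split_ordP j) => j' ->;
  rewrite ?(block_mxEul, block_mxEur, block_mxEdl, block_mxEdr) !mxE ?ev0 //;
  by rewrite /ev map_mpolyX mevalXU mxvecE.
have pg i j k l : ev (p i j k l) =
  eval4 a (diag2 g *m delta_mx i 0) (diag2 g *m delta_mx j 0)
   (diag2 g *m delta_mx k 0) (diag2 g *m delta_mx l 0)
  - eval4 a (delta_mx i 0) (delta_mx j 0) (delta_mx k 0) (delta_mx l 0).
  rewrite eval4_basis /p evB evC eval4_complexify; congr (_ - _).
  do 4![rewrite ev_sum; apply: eq_bigr => ? _].
  by rewrite !evM evC !Xg !diag2_col eval4_complexify.
split=> [[ug sg]|[ug sg]]; split; [exact: ug | | exact: ug | ].
  move=> q [i [j [k [l ->]]]]; apply: etrans (pg i j k l) _.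
  by rewrite sg subrr.
apply: eval4_subst => i j k l; apply/eqP; rewrite -subr_eq0; apply/eqP.
by apply: etrans (esym (pg i j k l)) _; apply: sg; exists i, j, k, l.
Qed.
End Complexify.

(** * Invariance of the Hodge classes *)

Lemma ext_degree_wedge_form1 (F : fieldType) n (u v : 'rV[F]_n) :
  ext_degree 2 (form1 u \^ form1 v : ext F n).
Proof. exact: (ext_degree_wedge (ext_degree_form1 u) (ext_degree_form1 v)). Qed.

Section Circle.
Variable (R : realType).
Local Notation C := R[i].

(** The ordered product over a two-element set is a product of two of the forms. *)
Lemma holomorphic_monomial (g n : nat) (M : 'M[C]_(g, n)) (I : {set 'I_g}) :
  #|I| = 2 -> exists i j, \big[@wedge C n/ext1]_(i in I) form1 (row i M)
    = form1 (row i M) \^ form1 (row j M).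
Proof.
have [e big_e _ [_ sz_e]] := big_enumP (fun i => i \in I).
rewrite -big_e -[#|I|]sz_e; case: e {big_e sz_e} => [|i [|j []]] //= _.
by exists i, j; rewrite !big_cons big_nil wedge1r.
Qed.

Lemma eval2_eigen n (N : 'M[C]_n) (u v : 'rV[C]_n) (z : C) x y :
  u *m N = z *: u -> v *m N = z *: v ->
  eval2 (form1 u \^ form1 v) (N *m x) (N *m y)
  = z ^+ 2 * eval2 (form1 u \^ form1 v) x y.
Proof.
move=> uN vN; rewrite !eval2_wedge_form1 !mulmxA uN vN -!scalemxAl !mxE.
ring.
Qed.

(** A transformation that multiplies the [dz_i] by [z] and their conjugates by
    [z^-1] preserves the forms of type (2,2). *)
Lemma Hpq22_invariant (g n : nat) (M : 'M[C]_(g, n)) (N : 'M[C]_n) (z w : C)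
    (b : ext C n) :
  M *m N = z *: M -> conj_mx M *m N = w *: conj_mx M -> z * w = 1 ->
  b \in Hpq M 2 2 -> forall x y u v,
  eval4 b (N *m x) (N *m y) (N *m u) (N *m v) = eval4 b x y u v.
Proof.
move=> MN McN zw /memv_sumP[f fP ->] x y u v; rewrite !eval4_sum.
apply: eq_bigr => I cI; have /memv_sumP[h hP ->] := fP I cI.
rewrite !eval4_sum; apply: eq_bigr => K cK.
have /vlineP[k hk] := hP K cK.
rewrite {}hk.
rewrite [LHS]eval4Z [RHS]eval4Z.
apply: (congr1 (fun c => k * c)).
have [i [j ->]] := holomorphic_monomial M (eqP cI).
have [i' [j' ->]] := holomorphic_monomial (conj_mx M) (eqP cK).
have rN (L : 'M[C]_(g, n)) c l : L *m N = c *: L -> row l L *m N = c *: row l L.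
  by move=> LN; rewrite -row_mul LN linearZ.
rewrite !eval4_wedge; try exact: ext_degree_wedge_form1.
apply: (product22_scale (c := z ^+ 2) (d := w ^+ 2)).
- by move=> s t; apply: eval2_eigen; apply: rN.
- by move=> s t; apply: eval2_eigen; apply: rN.
- by rewrite -exprMn zw expr1n.
Qed.

Variable J : abelianSurface R.
Local Notation P := (periods J).

Lemma full_periods_circle z : full_periods P *m hodge_circle J z =
  (block_mx z%:M 0 0 (z^*)%:M : 'M[C]_(2 + 2)) *m full_periods P.
Proof. by rewrite /hodge_circle !mulmxA mulmxV ?mul1mx // periods_lattice. Qed.

Lemma periods_circle z : P *m hodge_circle J z = z *: P /\
  conj_mx P *m hodge_circle J z = z^* *: conj_mx P.
Proof.
apply: eq_col_mx; rewrite -mul_col_mx; apply: etrans (full_periods_circle z) _.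
apply: etrans (@mul_block_col _ 2 2 2 2 4 _ _ _ _ _ _) _.
by rewrite !mul0mx addr0 add0r !mul_scalar_mx.
Qed.

Lemma periods2_circle z :
  periods2 J *m diag2 (hodge_circle J z) = z *: periods2 J /\
  conj_mx (periods2 J) *m diag2 (hodge_circle J z) = z^* *: conj_mx (periods2 J).
Proof.
have [h1 h2] := periods_circle z.
rewrite /periods2 /diag2 /conj_mx map_block_mx -!/(conj_mx _) !mulmx_block.
rewrite !mul0mx !mulmx0 !addr0 !add0r h1 h2 !scale_block_mx !scaler0.
by rewrite /conj_mx !map_mx0 !mul0mx !scaler0.
Qed.

Lemma hodge_circle_unit z : `|z| = 1 -> hodge_circle J z \in unitmx.
Proof.
move=> z1; rewrite /hodge_circle !unitmx_mul unitmx_inv periods_lattice andbT /=.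
have z0 : z != 0 by rewrite -normr_eq0 z1 oner_eq0.
suff : (block_mx z%:M 0 0 (z^*)%:M : 'M[C]_(2 + 2)) \in unitmx by [].
rewrite unitmxE det_ublock !det_scalar unitfE mulf_neq0 // expf_neq0 //.
by rewrite conjC_eq0.
Qed.

(** On a general abelian surface, Hodge classes are invariant under Sp_4. *)
Lemma hodge_class_invariant (E : 'M[rat]_4) (h : ext rat (4 + 4)) :
  hodge_group J = symplectic_group R E -> hodge_class J 2 h ->
  forall g, symplectic_group R E g -> forall x y z t,
    eval4 (complexify R h) (diag2 g *m x) (diag2 g *m y) (diag2 g *m z)
      (diag2 g *m t) = eval4 (complexify R h) x y z t.
Proof.
move=> gen [_ hH] g; rewrite -gen => /(_ _ (eval4_stabilizer_algebraic R h)).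
case=> [z z1|//]; split; first exact: hodge_circle_unit.
have [h1 h2] := periods2_circle z.
apply: (Hpq22_invariant h1 h2 _ hH).
by rewrite -normCK z1 expr1n.
Qed.
End Circle.

(** * Alternating forms of degree 4 invariant under the symplectic group *)

(** An alternating form [f] of degree 4 is given on a space with a family
    [e 0, ..., e 7], which stands for two copies [e 0, ..., e 3] and
    [e 4, ..., e 7] of a symplectic basis. *)
Section SymplecticInvariants.
Variables (K : numFieldType) (V : lmodType K) (f : V -> V -> V -> V -> K).

Hypothesis f1 : forall c x x' y z t, f (c *: x + x') y z t = c * f x y z t + f x' y z t.
Hypothesis f2 : forall c y y' x z t, f x (c *: y + y') z t = c * f x y z t + f x y' z t.
Hypothesis f3 : forall c z z' x y t, f x y (c *: z + z') t = c * f x y z t + f x y z' t.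
Hypothesis f4 : forall c t t' x y z, f x y z (c *: t + t') = c * f x y z t + f x y z t'.
Hypothesis f12 : forall x y z t, f y x z t = - f x y z t.
Hypothesis f23 : forall x y z t, f x z y t = - f x y z t.
Hypothesis f34 : forall x y z t, f x y t z = - f x y z t.

Variable e : nat -> V.

(** [f] takes the same values on the vectors [u k] as on the [e k]. *)
Definition preserves (u : nat -> V) : Prop := forall i j k l : nat,
  (i < 8)%N -> (j < 8)%N -> (k < 8)%N -> (l < 8)%N ->
  f (u i) (u j) (u k) (u l) = f (e i) (e j) (e k) (e l).

(** Numerators and denominators of the eigenvalues 2, 1/2, 3, 1/3 of an element
    of the torus.  As 2 and 3 are multiplicatively independent, only products of
    weight zero have eigenvalue 1. *)
Definition torus_num (k : nat) : nat := nth 0%N [:: 2; 1; 3; 1; 2; 1; 3; 1] k.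
Definition torus_den (k : nat) : nat := nth 0%N [:: 1; 2; 1; 3; 1; 2; 1; 3] k.

Hypothesis torus_f : preserves (fun k => ((torus_num k)%:R / (torus_den k)%:R) *: e k).
(* Unipotent elements for two long roots and for a short root. *)
Hypothesis root01_f : preserves (fun k =>
  if k == 0%N then e 0%N + e 1%N else if k == 4%N then e 4%N + e 5%N else e k).
Hypothesis root23_f : preserves (fun k =>
  if k == 2%N then e 2%N + e 3%N else if k == 6%N then e 6%N + e 7%N else e k).
Hypothesis root02_f : preserves (fun k =>
  if k == 0%N then e 0%N + e 2%N else if k == 4%N then e 4%N + e 6%N else
  if k == 3%N then e 3%N - e 1%N else if k == 7%N then e 7%N - e 5%N else e k).

Let F (i j k l : nat) := f (e i) (e j) (e k) (e l).

Local Arguments F (_ _ _ _)%_N.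

(** The torus element fixes the product of four basis vectors. *)
Definition balanced (i j k l : nat) : bool :=
  torus_num i * torus_num j * torus_num k * torus_num l
  == torus_den i * torus_den j * torus_den k * torus_den l.

Local Lemma f1D x x' y z t : f (x + x') y z t = f x y z t + f x' y z t.
Proof. by have := f1 1 x x' y z t; rewrite scale1r mul1r. Qed.
Local Lemma f2D x x' y z t : f y (x + x') z t = f y x z t + f y x' z t.
Proof. by have := f2 1 x x' y z t; rewrite scale1r mul1r. Qed.
Local Lemma f3D x x' y z t : f y z (x + x') t = f y z x t + f y z x' t.
Proof. by have := f3 1 x x' y z t; rewrite scale1r mul1r. Qed.
Local Lemma f4D x x' y z t : f y z t (x + x') = f y z t x + f y z t x'.
Proof. by have := f4 1 x x' y z t; rewrite scale1r mul1r. Qed.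
Local Lemma f1_0 y z t : f 0 y z t = 0.
Proof. by apply: (@addrI _ (f 0 y z t)); rewrite -f1D !addr0. Qed.
Local Lemma f2_0 y z t : f y 0 z t = 0.
Proof. by rewrite f12 f1_0 oppr0. Qed.
Local Lemma f3_0 y z t : f y z 0 t = 0.
Proof. by rewrite f23 f2_0 oppr0. Qed.
Local Lemma f4_0 y z t : f y z t 0 = 0.
Proof. by rewrite f34 f3_0 oppr0. Qed.
Local Lemma f1Z c x y z t : f (c *: x) y z t = c * f x y z t.
Proof. by rewrite -[c *: x]addr0 f1 f1_0 addr0. Qed.
Local Lemma f2Z c x y z t : f x (c *: y) z t = c * f x y z t.
Proof. by rewrite -[c *: y]addr0 f2 f2_0 addr0. Qed.
Local Lemma f3Z c x y z t : f x y (c *: z) t = c * f x y z t.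
Proof. by rewrite -[c *: z]addr0 f3 f3_0 addr0. Qed.
Local Lemma f4Z c x y z t : f x y z (c *: t) = c * f x y z t.
Proof. by rewrite -[c *: t]addr0 f4 f4_0 addr0. Qed.
Local Lemma f3N x y z t : f x y (- z) t = - f x y z t.
Proof. by rewrite -scaleN1r f3Z mulN1r. Qed.
Local Lemma f4N x y z t : f x y z (- t) = - f x y z t.
Proof. by rewrite -scaleN1r f4Z mulN1r. Qed.
Local Lemma f2N x y z t : f x (- y) z t = - f x y z t.
Proof. by rewrite -scaleN1r f2Z mulN1r. Qed.

Lemma torus_den_neq0 k : (k < 8)%N -> (torus_den k)%:R != 0 :> K.
Proof. by case: k => [|[|[|[|[|[|[|[|]]]]]]]] //= _; rewrite pnatr_eq0. Qed.

Lemma value_unbalanced i j k l : (i < 8)%N -> (j < 8)%N -> (k < 8)%N -> (l < 8)%N ->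
  ~~ balanced i j k l -> F i j k l = 0.
Proof.
move=> i8 j8 k8 l8 nb; have := torus_f i8 j8 k8 l8.
rewrite f1Z f2Z f3Z f4Z -/(F i j k l) => e0; apply/eqP; move: nb; apply: contraNT => nz.
have /(mulIf nz) : ((torus_num i)%:R / (torus_den i)%:R * ((torus_num j)%:R / (torus_den j)%:R)
  * ((torus_num k)%:R / (torus_den k)%:R) * ((torus_num l)%:R / (torus_den l)%:R))
   * F i j k l = 1 * F i j k l.
  by rewrite mul1r -[RHS]e0 !mulrA.
rewrite !mulf_div => /(congr1 (fun c => c * ((torus_den i)%:R * (torus_den j)%:R *
  (torus_den k)%:R * (torus_den l)%:R))).
rewrite mul1r mulfVK ?mulf_neq0 ?torus_den_neq0 // -!natrM => /eqP.
by rewrite eqr_nat.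
Qed.

(** The value of [f] on four basis vectors listed in a sequence. *)
Definition evalF (s : seq nat) : K := F (nth 0%N s 0) (nth 0%N s 1) (nth 0%N s 2) (nth 0%N s 3).

(** Adjacent transpositions reduce a statement to increasing indices. *)
Lemma sort4_ind (P : nat -> nat -> nat -> nat -> Prop) :
  (forall i j k l, P i j k l -> P j i k l) ->
  (forall i j k l, P i j k l -> P i k j l) ->
  (forall i j k l, P i j k l -> P i j l k) ->
  (forall i j k l, (i <= j)%N -> (j <= k)%N -> (k <= l)%N -> P i j k l) ->
  forall i j k l, P i j k l.
Proof.
move=> P12 P23 P34 Ps.
have P13 i j k l : P i j k l -> P k j i l by move=> /P12 /P23 /P12.
have P24 i j k l : P i j k l -> P i l k j by move=> /P23 /P34 /P23.
have Q1 i j k l : (i <= j)%N -> (i <= k)%N -> (j <= l)%N -> (k <= l)%N -> P i j k l.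
  move=> ij ik jl kl; have [jk|/ltnW kj] := leqP j k; first exact: Ps.
  by apply: P23; apply: Ps.
have Q2 i j k l : (i <= j)%N -> (k <= l)%N -> P i j k l.
  move=> ij kl; have [ik|ki] := leqP i k; have [jl|lj] := leqP j l.
  - by apply: Q1 => //; lia.
  - by apply: P24; apply: Q1; lia.
  - by apply: P13; apply: Q1; lia.
  - by apply: P13; apply: P24; apply: Q1; lia.
have Q3 i j k l : (i <= j)%N -> P i j k l.
  by move=> ij; have [kl|/ltnW lk] := leqP k l; [|apply: P34]; apply: Q2.
move=> i j k l.
by have [ij|/ltnW ji] := leqP i j; [|apply: P12]; apply: Q3.
Qed.

(** Values on basis vectors vanish together with those on any rearrangement. *)
Lemma value_sort i j k l : (F i j k l = 0) <-> (evalF (sort leq [:: i; j; k; l]) = 0).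
Proof.
have opp0 (c : K) : - c = 0 <-> c = 0.
  by split=> [/eqP|->]; rewrite ?oppr0 // oppr_eq0 => /eqP.
move: i j k l; apply: sort4_ind => [i j k l|i j k l|i j k l|i j k l ij jk kl].
- rewrite (_ : sort leq [:: j; i; k; l] = sort leq [:: i; j; k; l]).
    move=> <-; rewrite /F [X in X = 0 <-> _]f12; exact: opp0.
  apply/(perm_sortP leq_total leq_trans anti_leq).
  by rewrite (perm_catCA [:: j] [:: i] [:: k; l]).
- rewrite (_ : sort leq [:: i; k; j; l] = sort leq [:: i; j; k; l]).
    move=> <-; rewrite /F [X in X = 0 <-> _]f23; exact: opp0.
  apply/(perm_sortP leq_total leq_trans anti_leq).
  by rewrite perm_cons (perm_catCA [:: k] [:: j] [:: l]).
- rewrite (_ : sort leq [:: i; j; l; k] = sort leq [:: i; j; k; l]).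
    move=> <-; rewrite /F [X in X = 0 <-> _]f34; exact: opp0.
  apply/(perm_sortP leq_total leq_trans anti_leq).
  by rewrite !perm_cons (perm_catCA [:: l] [:: k] [::]).
- by rewrite (sorted_sort leq_trans) //= ij jk kl.
Qed.

Lemma value_repeat i j k l : ~~ uniq [:: i; j; k; l] -> F i j k l = 0.
Proof.
have opp0 (c : K) : c = - c -> c = 0.
  by move/eqP; rewrite -addr_eq0 -mulr2n mulrn_eq0 => /eqP.
move: i j k l; apply: sort4_ind => [i j k l|i j k l|i j k l|i j k l ij jk kl].
- move=> Fu nu; rewrite /F f12 [f _ _ _ _]Fu ?oppr0 //; apply: contra nu.
  by rewrite (perm_uniq (s2 := [:: j; i; k; l])) // (perm_catCA [:: i] [:: j] [:: k; l]).
- move=> Fu nu; rewrite /F f23 [f _ _ _ _]Fu ?oppr0 //; apply: contra nu.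
  by rewrite (perm_uniq (s2 := [:: i; k; j; l])) // perm_cons (perm_catCA [:: j] [:: k] [:: l]).
- move=> Fu nu; rewrite /F f34 [f _ _ _ _]Fu ?oppr0 //; apply: contra nu.
  by rewrite (perm_uniq (s2 := [:: i; j; l; k])) // !perm_cons (perm_catCA [:: k] [:: l] [::]).
rewrite /= !inE !negb_and !negbK !orbF => nu; apply: opp0; rewrite /F.
have [eij|nij] := eqVneq i j; first by rewrite -f12 eij.
have [ejk|njk] := eqVneq j k; first by rewrite -f23 ejk.
have [ekl|nkl] := eqVneq k l; first by rewrite -f34 ekl.
by exfalso; lia.
Qed.

(** The 18 quadruples of distinct basis vectors of weight zero, up to order. *)
Definition balanced_monomials : seq (seq nat) :=
  [:: [:: 0; 4; 1; 5]; [:: 2; 6; 3; 7];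
      [:: 0; 1; 2; 3]; [:: 0; 1; 2; 7]; [:: 0; 1; 6; 3]; [:: 0; 1; 6; 7];
      [:: 0; 5; 2; 3]; [:: 0; 5; 2; 7]; [:: 0; 5; 6; 3]; [:: 0; 5; 6; 7];
      [:: 4; 1; 2; 3]; [:: 4; 1; 2; 7]; [:: 4; 1; 6; 3]; [:: 4; 1; 6; 7];
      [:: 4; 5; 2; 3]; [:: 4; 5; 2; 7]; [:: 4; 5; 6; 3]; [:: 4; 5; 6; 7]]%N.

(** The three kinds of quadruples: of nonzero weight, with a repetition, listed. *)
Definition is_balanced_monomial (i j k l : nat) : bool :=
  [|| ~~ balanced i j k l, ~~ uniq [:: i; j; k; l] |
      sort leq [:: i; j; k; l] \in [seq sort leq s | s <- balanced_monomials]].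

(** Checked on all 8^4 quadruples by computation. *)
Lemma balanced_monomialsP i j k l :
  (i < 8)%N -> (j < 8)%N -> (k < 8)%N -> (l < 8)%N -> is_balanced_monomial i j k l.
Proof.
have /allP h : all (fun i => all (fun j => all (fun k => all (is_balanced_monomial i j k)
   (iota 0 8)) (iota 0 8)) (iota 0 8)) (iota 0 8) by vm_compute.
move=> i8 j8 k8 l8; have m8 m : (m < 8)%N -> m \in iota 0 8 by rewrite mem_iota.
have /allP/(_ _ (m8 j j8))/allP/(_ _ (m8 k k8))/allP/(_ _ (m8 l l8)) := h i (m8 i i8).
by [].
Qed.

(** Expands an invariance relation, dropping the values that vanish for reasons of
    weight or of repetition. *)
Local Ltac expand H := move: H; rewrite /= ?(f1D, f2D, f3D, f4D, f2N, f3N, f4N);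
  repeat match goal with |- context [f (e ?i) (e ?j) (e ?k) (e ?l)] =>
    first [ rewrite [f (e i) (e j) (e k) (e l)](@value_unbalanced i j k l isT isT isT isT isT)
          | rewrite [f (e i) (e j) (e k) (e l)](@value_repeat i j k l isT) ]
  end.

Hypotheses (F0123 : F 0 1 2 3 = 0) (F4567 : F 4 5 6 7 = 0)
  (F0127 : F 0 1 2 7 = 0) (F0567 : F 0 5 6 7 = 0)
  (F0167 : F 0 1 6 7 = 0) (F0527 : F 0 5 2 7 = 0).

(** The long root elements identify values that differ by exchanging the two copies
    within a symplectic pair; the short root element gives the other relations. *)
Lemma balanced_monomials0 s : s \in balanced_monomials -> evalF s = 0.
Proof.
have r01_23 : F 4 1 2 3 = F 0 5 2 3.
  expand (@root01_f 0%N 4%N 2%N 3%N isT isT isT isT).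
  by rewrite add0r addr0 => /eqP; rewrite addr_eq0 /F => /eqP ->; rewrite f12.
have r01_27 : F 4 1 2 7 = F 0 5 2 7.
  expand (@root01_f 0%N 4%N 2%N 7%N isT isT isT isT).
  by rewrite add0r addr0 => /eqP; rewrite addr_eq0 /F => /eqP ->; rewrite f12.
have r01_63 : F 4 1 6 3 = F 0 5 6 3.
  expand (@root01_f 0%N 4%N 6%N 3%N isT isT isT isT).
  by rewrite add0r addr0 => /eqP; rewrite addr_eq0 /F => /eqP ->; rewrite f12.
have r01_67 : F 4 1 6 7 = F 0 5 6 7.
  expand (@root01_f 0%N 4%N 6%N 7%N isT isT isT isT).
  by rewrite add0r addr0 => /eqP; rewrite addr_eq0 /F => /eqP ->; rewrite f12.
have r23_01 : F 0 1 6 3 = F 0 1 2 7.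
  expand (@root23_f 0%N 1%N 2%N 6%N isT isT isT isT).
  by rewrite add0r addr0 => /eqP; rewrite addr_eq0 /F => /eqP ->; rewrite f34.
have r23_05 : F 0 5 6 3 = F 0 5 2 7.
  expand (@root23_f 0%N 5%N 2%N 6%N isT isT isT isT).
  by rewrite add0r addr0 => /eqP; rewrite addr_eq0 /F => /eqP ->; rewrite f34.
have r23_41 : F 4 1 6 3 = F 4 1 2 7.
  expand (@root23_f 4%N 1%N 2%N 6%N isT isT isT isT).
  by rewrite add0r addr0 => /eqP; rewrite addr_eq0 /F => /eqP ->; rewrite f34.
have r23_45 : F 4 5 6 3 = F 4 5 2 7.
  expand (@root23_f 4%N 5%N 2%N 6%N isT isT isT isT).
  by rewrite add0r addr0 => /eqP; rewrite addr_eq0 /F => /eqP ->; rewrite f34.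

have F0163 : F 0 1 6 3 = 0 by rewrite r23_01.
have F0563 : F 0 5 6 3 = 0 by rewrite r23_05.
have F4127 : F 4 1 2 7 = 0 by rewrite r01_27.
have F4163 : F 4 1 6 3 = 0 by rewrite r01_63.
have F4167 : F 4 1 6 7 = 0 by rewrite r01_67.
have F4123 : F 4 1 2 3 = 0.
  expand (@root02_f 0%N 4%N 1%N 3%N isT isT isT isT).
  rewrite !(oppr0, addr0, add0r, subr0, sub0r).
  rewrite -!/(F _ _ _ _).
  have sw_0613 : F 0 6 1 3 = - F 0 1 6 3 by rewrite /F [LHS]f23.
  have sw_2413 : F 2 4 1 3 = F 4 1 2 3 by rewrite /F [LHS]f12 [X in - X]f23 opprK.
  rewrite ?(sw_0613, sw_2413, F0163)
    ?(oppr0, addr0, add0r, subr0, sub0r, opprK) => /eqP; rewrite ?oppr_eq0 => /eqP //.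
have F0523 : F 0 5 2 3 = 0 by rewrite -r01_23.
have F4527 : F 4 5 2 7 = 0.
  expand (@root02_f 0%N 4%N 5%N 7%N isT isT isT isT).
  rewrite !(oppr0, addr0, add0r, subr0, sub0r).
  rewrite -!/(F _ _ _ _).
  have sw_0657 : F 0 6 5 7 = - F 0 5 6 7 by rewrite /F [LHS]f23.
  have sw_2457 : F 2 4 5 7 = F 4 5 2 7 by rewrite /F [LHS]f12 [X in - X]f23 opprK.
  rewrite ?(sw_0657, sw_2457, F0567)
    ?(oppr0, addr0, add0r, subr0, sub0r, opprK) => /eqP; rewrite ?oppr_eq0 => /eqP //.
have F4563 : F 4 5 6 3 = 0 by rewrite r23_45.
have F0415 : F 0 4 1 5 = 0.
  expand (@root02_f 0%N 4%N 1%N 7%N isT isT isT isT).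
  rewrite !(oppr0, addr0, add0r, subr0, sub0r).
  rewrite -!/(F _ _ _ _).
  have sw_0617 : F 0 6 1 7 = - F 0 1 6 7 by rewrite /F [LHS]f23.
  have sw_2417 : F 2 4 1 7 = F 4 1 2 7 by rewrite /F [LHS]f12 [X in - X]f23 opprK.
  rewrite ?(sw_0617, sw_2417, F0167, F4127)
    ?(oppr0, addr0, add0r, subr0, sub0r, opprK) => /eqP; rewrite ?oppr_eq0 => /eqP //.
have F4523 : F 4 5 2 3 = 0.
  expand (@root02_f 0%N 4%N 5%N 3%N isT isT isT isT).
  rewrite !(oppr0, addr0, add0r, subr0, sub0r).
  rewrite -!/(F _ _ _ _).
  have sw_0653 : F 0 6 5 3 = - F 0 5 6 3 by rewrite /F [LHS]f23.
  have sw_2453 : F 2 4 5 3 = F 4 5 2 3 by rewrite /F [LHS]f12 [X in - X]f23 opprK.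
  have sw_0451 : F 0 4 5 1 = - F 0 4 1 5 by rewrite /F [LHS]f34.
  rewrite ?(sw_0653, sw_2453, sw_0451, F0563, F0415)
    ?(oppr0, addr0, add0r, subr0, sub0r, opprK) => /eqP; rewrite ?oppr_eq0 => /eqP //.
have F2637 : F 2 6 3 7 = 0.
  expand (@root02_f 0%N 3%N 7%N 6%N isT isT isT isT).
  rewrite !(oppr0, addr0, add0r, subr0, sub0r).
  rewrite -!/(F _ _ _ _).
  have sw_0176 : F 0 1 7 6 = - F 0 1 6 7 by rewrite /F [LHS]f34.
  have sw_0356 : F 0 3 5 6 = F 0 5 6 3 by rewrite /F [LHS]f23 [X in - X]f34 opprK.
  have sw_2376 : F 2 3 7 6 = F 2 6 3 7 by rewrite /F [LHS]f34 [X in - X]f23 opprK.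
  rewrite ?(sw_0176, sw_0356, sw_2376, F0167, F0563)
    ?(oppr0, addr0, add0r, subr0, sub0r, opprK) => /eqP; rewrite ?oppr_eq0 => /eqP //.
rewrite /balanced_monomials !inE /evalF.
by do 17![case/orP => [/eqP -> //|]]; move/eqP ->.
Qed.

(** An invariant form vanishes if it does at six products of basis vectors. *)
Lemma invariant_values_eq0 i j k l : (i < 8)%N -> (j < 8)%N -> (k < 8)%N -> (l < 8)%N ->
  F i j k l = 0.
Proof.
move=> i8 j8 k8 l8; case/or3P: (balanced_monomialsP i8 j8 k8 l8) => [nb|nu|].
- exact: value_unbalanced.
- exact: value_repeat.
case/mapP => s sb es; apply/value_sort; rewrite es.
have := balanced_monomials0 sb.
have : size s = 4%N.
  by move: sb; rewrite /balanced_monomials !inE; do 17![case/orP => [/eqP -> //|]]; move/eqP ->.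
by case: s {sb es} => [|i' [|j' [|k' [|l' []]]]] //= _ /value_sort.
Qed.
End SymplecticInvariants.

(** * Products of forms of type (1,1) *)

(** For linear forms, (f1 f2)(f3 f4) = - (f1 f3)(f2 f4) in the exterior algebra,
    on values. *)
Lemma product22_exchange (K : comPzRingType) (V : Type) (f1 f2 f3 f4 : V -> K) (x y z t : V) :
  let w (f g : V -> K) u v := f u * g v - f v * g u in
  product22 (w f1 f2) (w f3 f4) x y z t = - product22 (w f1 f3) (w f2 f4) x y z t.
Proof. by rewrite /product22 /=; ring. Qed.

Section Reorder.
Variables (F : fieldType) (n : nat).
Implicit Types (a b : ext F n) (u v : 'rV[F]_n) (x y : 'cV[F]_n).

Lemma eval2D a b x y : eval2 (a + b) x y = eval2 a x y + eval2 b x y.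
Proof. by rewrite !eval2E !contractD scalar_partD. Qed.

Lemma eval2N a x y : eval2 (- a) x y = - eval2 a x y.
Proof. by rewrite !eval2E !contractN scalar_partN. Qed.

Lemma eval2Z k a x y : eval2 (k *: a) x y = k * eval2 a x y.
Proof. by rewrite !eval2E !contractZ scalar_partZ. Qed.

Lemma eval2_sum (I : Type) (r : seq I) (P : pred I) (f : I -> ext F n) x y :
  eval2 (\sum_(i <- r | P i) f i) x y = \sum_(i <- r | P i) eval2 (f i) x y.
Proof.
rewrite eval2E !contract_sumr scalar_part_sum.
by apply: eq_bigr => ? _; rewrite eval2E.
Qed.

Lemma eval2_inj a b : ext_degree 2 a -> ext_degree 2 b ->
  (forall x y, eval2 a x y = eval2 b x y) -> a = b.
Proof.
move=> da db ab; have ab0 x y : eval2 (a - b) x y = 0.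
  by rewrite eval2D eval2N ab subrr.
apply/eqP; rewrite -subr_eq0; apply/eqP.
have d2 : ext_degree 2 (a - b) by apply/ext_degreeD/ext_degreeN.
apply: (contract1_inj d2) => i; rewrite -contract_delta.
have d1 := ext_degree_contract (delta_mx i 0) d2.
apply: (contract1_inj d1) => j; rewrite -contract_delta.
have d0 := ext_degree_contract (delta_mx j 0) d1.
apply/ffunP => A; rewrite [RHS]ffunE; have [->|A0] := eqVneq A set0.
  by rewrite -scalar_partE -eval2E ab0.
by apply: d0; rewrite cards_eq0.
Qed.

Lemma wedge_form1C u v : form1 v \^ form1 u = - (form1 u \^ form1 v) :> ext F n.
Proof.
apply: eval2_inj; [|apply: ext_degreeN|]; try exact: ext_degree_wedge_form1.
by move=> x y; rewrite eval2N !eval2_wedge_form1; ring.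
Qed.

Lemma wedge_form1_same u : form1 u \^ form1 u = 0 :> ext F n.
Proof.
apply: eval2_inj; [exact: ext_degree_wedge_form1|by move=> A _; rewrite ffunE|].
move=> x y; rewrite eval2_wedge_form1 -(scale0r (0 : ext F n)) eval2Z mul0r; ring.
Qed.

Lemma wedge_form1_exchange u v u' v' :
  (form1 u \^ form1 v) \^ (form1 u' \^ form1 v')
  = - ((form1 u \^ form1 u') \^ (form1 v \^ form1 v')) :> ext F n.
Proof.
have d (f g : 'rV[F]_n) : ext_degree 2 (form1 f \^ form1 g : ext F n).
  exact: ext_degree_wedge_form1.
apply: eval4_inj; [|apply: ext_degreeN|]; try exact: (ext_degree_wedge (d _ _) (d _ _)).
move=> x y z t; rewrite eval4N !eval4_wedge; try exact: d.
pose ev (f : 'rV[F]_n) x := (f *m x) 0 0.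
have E f g : eval2 (form1 f \^ form1 g) =2 (fun x y => ev f x * ev g y - ev f y * ev g x).
  by move=> ? ?; rewrite eval2_wedge_form1.
have P (a b c e : 'rV[F]_n) : product22 (eval2 (form1 a \^ form1 b)) (eval2 (form1 c \^ form1 e)) x y z t
   = product22 (fun x y => ev a x * ev b y - ev a y * ev b x)
      (fun x y => ev c x * ev e y - ev c y * ev e x) x y z t.
  by rewrite /product22 !E.
by rewrite !P; apply: product22_exchange.
Qed.
End Reorder.

Section HodgeType.
Variable (R : realType).
Local Notation C := R[i].

(** Forms of type (1,1) with respect to the rows [dz_i] of [M]. *)
Definition type11 (g n : nat) (M : 'M[C]_(g, n)) (a : ext C n) : Prop :=
  exists W : 'M[C]_g,
    a = \sum_i \sum_j W i j *: (form1 (row i M) \^ form1 (row j (conj_mx M))).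

(** The ordered product over a two-element set is the product of the two factors
    up to sign. *)
Lemma holomorphic_monomial2 (g n : nat) (M : 'M[C]_(g, n)) i k : i != k ->
  exists c : C, form1 (row i M) \^ form1 (row k M)
    = c *: \big[@wedge C n/ext1]_(j in [set i; k]%SET) form1 (row j M).
Proof.
move=> ik; have [e big_e [Ue mem_e] [_ sz_e]] := big_enumP (fun j => j \in [set i; k]%SET).
rewrite -big_e; have {}sz_e : size e = 2 by rewrite sz_e; move: (cards2 i k); rewrite ik.
case: e {big_e} Ue mem_e sz_e => [|j [|l []]] //= Ue mem_e _.
have := mem_e i; have := mem_e k; rewrite !big_cons big_nil wedge1r !inE !eqxx orbT.
move/orP=> [/eqP kj|/eqP kl] /orP[/eqP ij|/eqP il].
- by rewrite ij kj eqxx in ik.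
- by exists (-1); rewrite scaleN1r kj il wedge_form1C.
- by exists 1; rewrite scale1r kl ij.
- by rewrite il kl eqxx in ik.
Qed.

(** dz_i dzbar_j dz_k dzbar_l = - dz_i dz_k dzbar_j dzbar_l. *)
Lemma type11_wedge (g n : nat) (M : 'M[C]_(g, n)) a b :
  type11 M a -> type11 M b -> a \^ b \in Hpq M 2 2.
Proof.
move=> [W ->] [W' ->]; rewrite wedge_suml; apply: memv_suml => i _.
rewrite wedge_suml; apply: memv_suml => j _; rewrite wedgeZl; apply: memvZ.
rewrite wedge_sumr; apply: memv_suml => k _.
rewrite wedge_sumr; apply: memv_suml => l _; rewrite wedgeZr; apply: memvZ.
rewrite wedge_form1_exchange; rewrite memvN.
have [<-|ik] := eqVneq i k; first by rewrite wedge_form1_same wedge0l mem0v.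
have [<-|jl] := eqVneq j l; first by rewrite wedge_form1_same wedge0r mem0v.
have [c ->] := holomorphic_monomial2 M ik.
have [d ->] := holomorphic_monomial2 (conj_mx M) jl.
rewrite wedgeZl wedgeZr scalerA; apply: memvZ.
have card2 (s t : 'I_g) : s != t -> #|[set s; t]%SET| == 2 by move=> st; rewrite cards2 st.
apply: (subvP (sumv_sup [set i; k]%SET (card2 _ _ ik) (subvv _))).
apply: (subvP (sumv_sup [set j; l]%SET (card2 _ _ jl) (subvv _))).
exact: memv_line.
Qed.

(** A 2-form is of type (1,1) if its values are those of a matrix [W] paired with
    the [dz_i] and their conjugates. *)
Lemma type11_bilinear (g n : nat) (M : 'M[C]_(g, n)) (W : 'M[C]_g) (a : ext C n) :
  ext_degree 2 a ->
  (forall x y, eval2 a x y = ((M *m x)^T *m W *m (conj_mx M *m y)) 0 0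
     - ((M *m y)^T *m W *m (conj_mx M *m x)) 0 0) ->
  type11 M a.
Proof.
move=> da aW; exists W; apply: eval2_inj da _ _.
  apply: ext_degree_sum => i _; apply: ext_degree_sum => j _.
  by apply: ext_degreeZ; apply: ext_degree_wedge_form1.
move=> x y; rewrite aW eval2_sum.
have B (u v : 'cV[C]_g) : (u^T *m W *m v) 0 0 = \sum_i \sum_j W i j * (u i 0 * v j 0).
  rewrite -mulmxA mxE; apply: eq_bigr => i _; rewrite !mxE mulr_sumr.
  by apply: eq_bigr => j _; rewrite mulrCA.
rewrite !B -sumrB; apply: eq_bigr => i _.
rewrite eval2_sum -sumrB; apply: eq_bigr => j _.
rewrite eval2Z eval2_wedge_form1 -!row_mul !mxE; ring.
Qed.

End HodgeType.

(** * The classes omega are of type (1,1) *)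

Lemma block_bilinear (K : comPzRingType) m (w : 'M[K]_m) (al be ga : K)
    (p1 p2 q1 q2 : 'cV[K]_m) : ((col_mx p1 p2)^T
    *m block_mx (al *: w) (be *: w) (be *: w) (ga *: w) *m col_mx q1 q2) 0 0
  = al * (p1^T *m w *m q1) 0 0 + be * ((p1^T *m w *m q2) 0 0 + (p2^T *m w *m q1) 0 0)
    + ga * (p2^T *m w *m q2) 0 0.
Proof.
rewrite tr_col_mx mul_row_block mul_row_col !mulmxDl -!scalemxAr -!scalemxAl.
have addE (u v : 'M[K]_1) : (u + v) 0 0 = u 0 0 + v 0 0 by rewrite mxE.
have scaleE k (u : 'M[K]_1) : (k *: u) 0 0 = k * u 0 0 by rewrite mxE.
by rewrite !addE !scaleE; ring.
Qed.

Lemma block_bilinear_alt (K : comPzRingType) m (al be ga : K)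
    (p1 p2 q1 q2 : 'rV[K]_m) (c1 c2 d1 d2 : 'cV[K]_m) :
  al * ((p1 *m d1) 0 0 - (q1 *m c1) 0 0)
  + be * ((p1 *m d2) 0 0 - (q2 *m c1) 0 0 + ((p2 *m d1) 0 0 - (q1 *m c2) 0 0))
  + ga * ((p2 *m d2) 0 0 - (q2 *m c2) 0 0) =
  al * (p1 *m d1) 0 0 + be * ((p1 *m d2) 0 0 + (p2 *m d1) 0 0) + ga * (p2 *m d2) 0 0
  - (al * (q1 *m c1) 0 0 + be * ((q1 *m c2) 0 0 + (q2 *m c1) 0 0) + ga * (q2 *m c2) 0 0).
Proof. ring. Qed.

(** The standard symplectic form. *)
Definition std_form (K : pzRingType) (u v : 'cV[K]_4) : K :=
  u 0 0 * v 1 0 - u 1 0 * v 0 0 + (u 2 0 * v 3 0 - u 3 0 * v 2 0).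

Lemma std_formE (K : numFieldType) (u v : 'cV[K]_4) :
  (u^T *m map_mx ratr std_symplectic *m v) 0 0 = std_form u v.
Proof.
rewrite -mulmxA mxE 4!big_ord_recl big_ord0 !mxE 16!big_ord_recl !big_ord0 !mxE /=.
rewrite !(rmorph0, rmorph1, rmorphN) /=.
rewrite /std_form.
have -> : 2 = lift ord0 (lift ord0 ord0) :> 'I_4 by apply: val_inj.
have -> : 3 = lift ord0 (lift ord0 (lift ord0 ord0)) :> 'I_4 by apply: val_inj.
have -> : 1 = lift ord0 ord0 :> 'I_4 by apply: val_inj.
have -> : 0 = ord0 :> 'I_4 by apply: val_inj.
by ring.
Qed.

Section Omegas.
Variable (R : realType).
Local Notation C := R[i].
Variables (J : abelianSurface R) (E dt : 'M[rat]_4).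
Hypotheses (polE : is_polarization (periods J) E) (basis_dt : symplectic_basis E dt).

Local Notation P := (periods J).
Local Notation Pc := (conj_mx (periods J)).
Local Notation D := (map_mx ratr dt : 'M[C]_4).
Local Notation EC := (map_mx ratr E : 'M[C]_4).

(** The polarization is of type (1,1). *)
Lemma polarization_type11 : exists w : 'M[C]_2, forall a b : 'cV[C]_4,
  (a^T *m EC *m b) 0 0 =
  ((P *m a)^T *m w *m (Pc *m b)) 0 0 - ((P *m b)^T *m w *m (Pc *m a)) 0 0.
Proof.
case: polE => Ealt Eunit PP _.
pose F : 'M[C]_(2 + 2) := col_mx P Pc; pose X : 'M[C]_(2 + 2) := invmx EC.
have Funit : F \in unitmx by apply: periods_lattice.
have ECunit : (EC : 'M[C]_(2 + 2)) \in unitmx by rewrite map_unitmx.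
have XE : X = map_mx ratr (invmx E) by rewrite map_invmx.
pose W : 'M[C]_(2 + 2) := invmx F^T *m EC *m invmx F.
have Q1 : F *m X *m F^T *m W = 1%:M.
  rewrite /W -!mulmxA (mulmxA F^T) mulmxV ?unitmx_tr // mul1mx (mulmxA X).
  by rewrite mulVmx // mul1mx mulmxV.
(* In the basis of the [dz_i] and their conjugates, the inverse of [E] has zero
   diagonal blocks by the first Riemann relation and its conjugate; so does [E]. *)
have PX0 : P *m X *m P^T = 0 by rewrite XE.
have PcX0 : Pc *m X *m Pc^T = 0.
  have Xc : X = conj_mx X.
    by rewrite XE /conj_mx -map_mx_comp; apply/matrixP => i j; rewrite !mxE /= fmorph_rat.
  by rewrite Xc /conj_mx map_trmx -!map_mxM PX0 map_mx0.
have FX : F *m X *m F^T = block_mx 0 (P *m X *m Pc^T) (Pc *m X *m P^T) 0.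
  by rewrite /F mul_col_mx tr_col_mx mul_col_row PX0 PcX0.
move: Q1; rewrite FX -[W]submxK mulmx_block !mul0mx !add0r !addr0.
rewrite scalar_mx_block => /eq_block_mx[q1 q2 q3 q4].
have [u1 _] := mulmx1_unit q1; have [u2 _] := mulmx1_unit q4.
have W22 : drsubmx W = 0.
  by rewrite -[LHS](mulKmx u1) q2 mulmx0.
have W11 : ulsubmx W = 0.
  by rewrite -[LHS](mulKmx u2) q3 mulmx0.
have WT : W^T = - W.
  have ECT : (EC : 'M[C]_(2 + 2))^T = - EC.
    apply/matrixP => i j; have := congr1 (fun M : 'M_4 => M i j) Ealt.
    by rewrite !mxE => ->; rewrite rmorphN.
  by rewrite /W !trmx_mul !trmx_inv trmxK ECT mulNmx mulmxN mulmxA.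
have W21 : dlsubmx W = - (ursubmx W)^T.
  by rewrite trmx_ursub WT; apply/matrixP => i j; rewrite !mxE opprK.
exists (ursubmx W) => a b.
have -> : (a^T *m EC *m b) = (F *m a)^T *m W *m (F *m b).
  rewrite /W trmx_mul -!mulmxA (mulmxA F^T (invmx _)) mulmxV ?unitmx_tr // mul1mx.
  by rewrite (mulmxA (invmx F)) mulVmx // mul1mx.
rewrite -[W in LHS]submxK W11 W22 W21 /F !mul_col_mx tr_col_mx.
rewrite mul_row_block mul_row_col !mulmx0 add0r addr0 mulmxN mulNmx.
have -> : (Pc *m a)^T *m (ursubmx W)^T *m (P *m b)
  = ((P *m b)^T *m ursubmx W *m (Pc *m a))^T by rewrite !trmx_mul !trmxK !mulmxA.
by move: (_ *m ursubmx W *m _) ((P *m a)^T *m _ *m _) => A B; rewrite !mxE addrC.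
Qed.

Lemma std_form_basis a b : (a^T *m EC *m b) 0 0 = std_form (D *m a) (D *m b).
Proof.
rewrite -std_formE trmx_mul; case: basis_dt => _ ->.
have -> : map_mx ratr (dt^T *m std_symplectic *m dt) = D^T *m map_mx ratr std_symplectic *m D.
  have DT : map_mx ratr dt^T = D^T by apply/matrixP => i j; rewrite !mxE.
  by rewrite !map_mxM DT.
by rewrite !mulmxA.
Qed.

Lemma dx_eval j (x : 'cV[C]_(4 + 4)) :
  (row_mx (dtC R dt j) 0 *m x) 0 0 = (D *m usubmx x) j 0.
Proof.
rewrite -[x in LHS]vsubmxK mul_row_col mul0mx addr0 /dtC map_row -row_mul mxE.
by [].
Qed.

Lemma dy_eval j (x : 'cV[C]_(4 + 4)) :
  (row_mx 0 (dtC R dt j) *m x) 0 0 = (D *m dsubmx x) j 0.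
Proof.
rewrite -[x in LHS]vsubmxK mul_row_col mul0mx add0r /dtC map_row -row_mul mxE.
by [].
Qed.

(** The values of [f0 f1 + f2 f3]. *)
Lemma eval2_two_planes (f0 f1 f2 f3 : 'rV[C]_(4 + 4)) (x y : 'cV[C]_(4 + 4))
    (u v : 'cV[C]_4) :
  (f0 *m x) 0 0 = u 0 0 -> (f1 *m x) 0 0 = u 1 0 ->
  (f2 *m x) 0 0 = u 2 0 -> (f3 *m x) 0 0 = u 3 0 ->
  (f0 *m y) 0 0 = v 0 0 -> (f1 *m y) 0 0 = v 1 0 ->
  (f2 *m y) 0 0 = v 2 0 -> (f3 *m y) 0 0 = v 3 0 ->
  eval2 (form1 f0 \^ form1 f1 + form1 f2 \^ form1 f3) x y = std_form u v.
Proof.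
move=> x0 x1 x2 x3 y0 y1 y2 y3; rewrite eval2D !eval2_wedge_form1.
rewrite x0 x1 x2 x3 y0 y1 y2 y3 /std_form.
by move: (u 0 0) (u 1 0) (u 2 0) (u 3 0) (v 0 0) (v 1 0) (v 2 0) (v 3 0) => *; ring.
Qed.

(** The values of [f0 g1 - f1 g0 + f2 g3 - f3 g2]. *)
Lemma eval2_four_planes (f0 f1 f2 f3 g0 g1 g2 g3 : 'rV[C]_(4 + 4))
    (x y : 'cV[C]_(4 + 4)) (u v u' v' : 'cV[C]_4) :
  (f0 *m x) 0 0 = u 0 0 -> (f1 *m x) 0 0 = u 1 0 ->
  (f2 *m x) 0 0 = u 2 0 -> (f3 *m x) 0 0 = u 3 0 ->
  (f0 *m y) 0 0 = v 0 0 -> (f1 *m y) 0 0 = v 1 0 ->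
  (f2 *m y) 0 0 = v 2 0 -> (f3 *m y) 0 0 = v 3 0 ->
  (g0 *m x) 0 0 = u' 0 0 -> (g1 *m x) 0 0 = u' 1 0 ->
  (g2 *m x) 0 0 = u' 2 0 -> (g3 *m x) 0 0 = u' 3 0 ->
  (g0 *m y) 0 0 = v' 0 0 -> (g1 *m y) 0 0 = v' 1 0 ->
  (g2 *m y) 0 0 = v' 2 0 -> (g3 *m y) 0 0 = v' 3 0 ->
  eval2 (form1 f0 \^ form1 g1 - form1 f1 \^ form1 g0
         + form1 f2 \^ form1 g3 - form1 f3 \^ form1 g2) x y
  = std_form u v' + std_form u' v.
Proof.
move=> x0 x1 x2 x3 y0 y1 y2 y3 x0' x1' x2' x3' y0' y1' y2' y3'.
rewrite !(eval2D, eval2N) !eval2_wedge_form1.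
rewrite x0 x1 x2 x3 y0 y1 y2 y3 x0' x1' x2' x3' y0' y1' y2' y3' /std_form.
move: (u 0 0) (u 1 0) (u 2 0) (u 3 0) (v 0 0) (v 1 0) (v 2 0) (v 3 0).
move: (u' 0 0) (u' 1 0) (u' 2 0) (u' 3 0) (v' 0 0) (v' 1 0) (v' 2 0) (v' 3 0).
by move=> *; ring.
Qed.

Lemma eval2_omega1 x y : eval2 (omega1 R dt) x y
  = std_form (D *m usubmx x) (D *m usubmx y).
Proof. by apply: eval2_two_planes; apply: dx_eval. Qed.

Lemma eval2_omega2 x y : eval2 (omega2 R dt) x y
  = std_form (D *m dsubmx x) (D *m dsubmx y).
Proof. by apply: eval2_two_planes; apply: dy_eval. Qed.

Lemma eval2_omega_sigma x y : eval2 (omega_sigma R dt) x y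
  = std_form (D *m usubmx x) (D *m dsubmx y) + std_form (D *m dsubmx x) (D *m usubmx y).
Proof. by apply: eval2_four_planes; (apply: dx_eval || apply: dy_eval). Qed.

Lemma ext_degree_omega1 : ext_degree 2 (omega1 R dt).
Proof. by apply: ext_degreeD; apply: ext_degree_wedge_form1. Qed.

Lemma ext_degree_omega2 : ext_degree 2 (omega2 R dt).
Proof. by apply: ext_degreeD; apply: ext_degree_wedge_form1. Qed.

Lemma ext_degree_omega_sigma : ext_degree 2 (omega_sigma R dt).
Proof.
apply: ext_degreeD; last by apply: ext_degreeN; apply: ext_degree_wedge_form1.
apply: ext_degreeD; last exact: ext_degree_wedge_form1.
apply: ext_degreeD; first exact: ext_degree_wedge_form1.
by apply: ext_degreeN; apply: ext_degree_wedge_form1.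
Qed.

(** A linear combination of the pullbacks of the polarization under the two
    projections and of its polarization is of type (1,1). *)
Lemma type11_diag2 (al be ga : C) (a : ext C (4 + 4)) : ext_degree 2 a ->
  (forall x y, eval2 a x y = al * std_form (D *m usubmx x) (D *m usubmx y)
    + be * (std_form (D *m usubmx x) (D *m dsubmx y)
            + std_form (D *m dsubmx x) (D *m usubmx y))
    + ga * std_form (D *m dsubmx x) (D *m dsubmx y)) ->
  type11 (periods2 J) a.
Proof.
move=> da aE; have [w wE] := polarization_type11.
apply: (@type11_bilinear _ _ _ _ (block_mx (al *: w) (be *: w) (be *: w) (ga *: w))) => //.
move=> x y; rewrite aE -!std_form_basis !wE.
have PE (z : 'cV[C]_(4 + 4)) : periods2 J *m z = col_mx (P *m usubmx z) (P *m dsubmx z).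
  by rewrite /periods2 -[z in LHS]vsubmxK mul_block_col !mul0mx addr0 add0r.
have PcE (z : 'cV[C]_(4 + 4)) : conj_mx (periods2 J) *m z = col_mx (Pc *m usubmx z) (Pc *m dsubmx z).
  rewrite /periods2 /conj_mx map_block_mx !map_mx0 -[z in LHS]vsubmxK mul_block_col.
  by rewrite !mul0mx addr0 add0r.
rewrite (PE x) (PE y) (PcE x) (PcE y) !block_bilinear.
exact: block_bilinear_alt.
Qed.

Lemma type11_omega1 : type11 (periods2 J) (omega1 R dt).
Proof.
apply: (@type11_diag2 1 0 0) ext_degree_omega1 _ => x y.
by rewrite eval2_omega1 mul1r !mul0r !addr0.
Qed.

Lemma type11_omega2 : type11 (periods2 J) (omega2 R dt).
Proof.
apply: (@type11_diag2 0 0 1) ext_degree_omega2 _ => x y.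
by rewrite eval2_omega2 mul1r !mul0r !add0r.
Qed.

Lemma type11_omega_sigma : type11 (periods2 J) (omega_sigma R dt).
Proof.
apply: (@type11_diag2 0 1 0) ext_degree_omega_sigma _ => x y.
by rewrite eval2_omega_sigma mul1r !mul0r add0r addr0.
Qed.

End Omegas.

(** * Symplectic matrices *)

Section SymplecticMatrices.
Variable K : numFieldType.

(** The matrix with given table of entries. *)
Definition mx4 (t : seq (seq K)) : 'M[K]_4 := \matrix_(i, j) nth 0 (nth [::] t i) j.

(** The standard basis vectors, indexed by natural numbers. *)
Definition unit4 (k : nat) : 'cV[K]_4 := delta_mx (inord k) 0.

Lemma unit4E k (i : 'I_4) : (k < 4)%N -> unit4 k i 0 = (i == k :> nat)%:R.
Proof. by move=> k4; rewrite mxE eqxx andbT -val_eqE /= inordK. Qed.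

Lemma mx4_unit4 t k (i : 'I_4) : (k < 4)%N -> (mx4 t *m unit4 k) i 0 = nth 0 (nth [::] t i) k.
Proof. by move=> k4; rewrite -colE !mxE inordK. Qed.

Lemma mx4_mul t (u : 'cV[K]_4) (i : 'I_4) : let r := nth [::] t i in
  (mx4 t *m u) i 0 = nth 0 r 0%N * u 0 0 + (nth 0 r 1%N * u 1 0
    + (nth 0 r 2%N * u 2 0 + nth 0 r 3%N * u 3 0)).
Proof.
rewrite /= mxE 4!big_ord_recl big_ord0 !mxE addr0 /=.
by congr (_ * u _ _ + (_ * u _ _ + (_ * u _ _ + _ * u _ _))); apply: val_inj.
Qed.

Lemma symplecticP (g : 'M[K]_4) :
  (forall u v, std_form (g *m u) (g *m v) = std_form u v) ->
  g^T *m map_mx ratr std_symplectic *m g = map_mx ratr std_symplectic.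
Proof.
move=> gP; apply/matrixP => i j.
have E (M : 'M[K]_4) : M i j = ((delta_mx i 0 : 'cV[K]_4)^T *m M *m (delta_mx j 0 : 'cV[K]_4)) 0 0.
  by rewrite trmx_delta -rowE -colE !mxE.
rewrite E [RHS]E std_formE -gP -std_formE trmx_mul !mulmxA.
by [].
Qed.

(** An element of the torus of Sp_4, unipotent elements for its two long roots
    preserving a plane of the basis, and one for a short root. *)
Definition torus_mx := mx4 [:: [:: 2; 0; 0; 0]; [:: 0; 2^-1; 0; 0];
                               [:: 0; 0; 3; 0]; [:: 0; 0; 0; 3^-1]].
Definition root01_mx := mx4 [:: [:: 1; 0; 0; 0]; [:: 1; 1; 0; 0];
                               [:: 0; 0; 1; 0]; [:: 0; 0; 0; 1]].
Definition root23_mx := mx4 [:: [:: 1; 0; 0; 0]; [:: 0; 1; 0; 0];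
                               [:: 0; 0; 1; 0]; [:: 0; 0; 1; 1]].
Definition root02_mx := mx4 [:: [:: 1; 0; 0; 0]; [:: 0; 1; 0; -1];
                               [:: 1; 0; 1; 0]; [:: 0; 0; 0; 1]].

Local Ltac symplectic := apply: symplecticP;
  let u := fresh in let v := fresh in intros u v; rewrite /std_form !mx4_mul /=;
  move: (u 0 0) (u 1 0) (u 2 0) (u 3 0) (v 0 0) (v 1 0) (v 2 0) (v 3 0) => *.

Lemma torus_symplectic :
  torus_mx^T *m map_mx ratr std_symplectic *m torus_mx = map_mx ratr std_symplectic.
Proof. by symplectic; field. Qed.

Lemma root01_symplectic :
  root01_mx^T *m map_mx ratr std_symplectic *m root01_mx = map_mx ratr std_symplectic.
Proof. by symplectic; ring. Qed.

Lemma root23_symplectic :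
  root23_mx^T *m map_mx ratr std_symplectic *m root23_mx = map_mx ratr std_symplectic.
Proof. by symplectic; ring. Qed.

Lemma root02_symplectic :
  root02_mx^T *m map_mx ratr std_symplectic *m root02_mx = map_mx ratr std_symplectic.
Proof. by symplectic; ring. Qed.

Local Lemma colZE (c : K) (u : 'cV[K]_4) i : (c *: u) i 0 = c * u i 0.
Proof. by rewrite mxE. Qed.

Local Lemma colDE (u v : 'cV[K]_4) i : (u + v) i 0 = u i 0 + v i 0.
Proof. by rewrite mxE. Qed.

Local Lemma colNE (u : 'cV[K]_4) i : (- u) i 0 = - u i 0.
Proof. by rewrite mxE. Qed.

Local Ltac unit4_entries := apply/colP; case=> [[|[|[|[|?]]]] ?] //=;
  rewrite mx4_unit4 // ?(colZE, colDE, colNE) ?unit4E //=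
    ?(mulr0, mulr1, addr0, add0r, oppr0).

Lemma torus_unit4 k : (k < 4)%N -> torus_mx *m unit4 k =
  nth 0 [:: 2; 2^-1; 3; 3^-1] k *: unit4 k.
Proof.
by case: k => [|[|[|[|]]]] //= _; unit4_entries.
Qed.

Lemma root01_unit4 k : (k < 4)%N -> root01_mx *m unit4 k =
  if k == 0%N then unit4 0 + unit4 1 else unit4 k.
Proof.
by case: k => [|[|[|[|]]]] //= _; unit4_entries.
Qed.

Lemma root23_unit4 k : (k < 4)%N -> root23_mx *m unit4 k =
  if k == 2%N then unit4 2 + unit4 3 else unit4 k.
Proof.
by case: k => [|[|[|[|]]]] //= _; unit4_entries.
Qed.

Lemma root02_unit4 k : (k < 4)%N -> root02_mx *m unit4 k =
  if k == 0%N then unit4 0 + unit4 2 else if k == 3%N then unit4 3 - unit4 1 else unit4 k.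
Proof.
by case: k => [|[|[|[|]]]] //= _; unit4_entries.
Qed.
End SymplecticMatrices.

(** * Invariant forms in a basis adapted to the polarization *)

Section Eval4Linear.
Variables (F : fieldType) (n : nat) (a : ext F n).

Lemma eval4_linear1 c (x x' y z t : 'cV[F]_n) :
  eval4 a (c *: x + x') y z t = c * eval4 a x y z t + eval4 a x' y z t.
Proof.
by rewrite !eval4E !(contractDl, contractZl, contractD, contractZ, scalar_partD, scalar_partZ).
Qed.

Lemma eval4_linear2 c (y y' x z t : 'cV[F]_n) :
  eval4 a x (c *: y + y') z t = c * eval4 a x y z t + eval4 a x y' z t.
Proof.
by rewrite !eval4E !(contractDl, contractZl, contractD, contractZ, scalar_partD, scalar_partZ).
Qed.

Lemma eval4_linear3 c (z z' x y t : 'cV[F]_n) :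
  eval4 a x y (c *: z + z') t = c * eval4 a x y z t + eval4 a x y z' t.
Proof.
by rewrite !eval4E !(contractDl, contractZl, contractD, contractZ, scalar_partD, scalar_partZ).
Qed.

Lemma eval4_linear4 c (t t' x y z : 'cV[F]_n) :
  eval4 a x y z (c *: t + t') = c * eval4 a x y z t + eval4 a x y z t'.
Proof.
by rewrite !eval4E !(contractDl, contractZl, contractD, contractZ, scalar_partD, scalar_partZ).
Qed.
End Eval4Linear.

Lemma conj_congruence (K : fieldType) n (d g S : 'M[K]_n) :
  d \in unitmx -> g^T *m S *m g = S ->
  (invmx d *m g *m d)^T *m (d^T *m S *m d) *m (invmx d *m g *m d) = d^T *m S *m d.
Proof.
move=> du gS; rewrite !trmx_mul trmx_inv -!mulmxA (mulKVmx du) mulKmx ?unitmx_tr //.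
by rewrite (mulmxA S) (mulmxA g^T) (mulmxA g^T) gS.
Qed.

Lemma conj_mulK (K : fieldType) n (d g : 'M[K]_n) (v : 'cV[K]_n) :
  d \in unitmx -> (invmx d *m g *m d) *m (invmx d *m v) = invmx d *m (g *m v).
Proof. by move=> du; rewrite -!mulmxA mulKVmx. Qed.

Lemma diag2_col_mx (K : comPzRingType) (g : 'M[K]_4) (u v : 'cV[K]_4) :
  diag2 g *m col_mx u v = col_mx (g *m u) (g *m v).
Proof. by rewrite /diag2 mul_block_col !mul0mx addr0 add0r. Qed.

Section AdaptedBasis.
Variable (R : realType).
Local Notation C := R[i].
Variables (E dt : 'M[rat]_4).
Hypothesis basis_dt : symplectic_basis E dt.
Local Notation D := (map_mx ratr dt : 'M[C]_4).

(** Invariance under the diagonal action of the symplectic group of [E]. *)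
Definition Sp_invariant (a : ext C (4 + 4)) : Prop :=
  forall g, symplectic_group R E g -> forall x y z t,
    eval4 a (diag2 g *m x) (diag2 g *m y) (diag2 g *m z) (diag2 g *m t)
    = eval4 a x y z t.

(** The vectors of the first and of the second copy of H_1(J) with given
    coordinates [dt_1, ..., dt_4]. *)
Definition inj1 (v : 'cV[C]_4) : 'cV[C]_(4 + 4) := col_mx (invmx D *m v) 0.
Definition inj2 (v : 'cV[C]_4) : 'cV[C]_(4 + 4) := col_mx 0 (invmx D *m v).

Lemma inj1D u v : inj1 (u + v) = inj1 u + inj1 v.
Proof. by rewrite /inj1 mulmxDr add_col_mx addr0. Qed.
Lemma inj2D u v : inj2 (u + v) = inj2 u + inj2 v.
Proof. by rewrite /inj2 mulmxDr add_col_mx addr0. Qed.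
Lemma inj1Z c u : inj1 (c *: u) = c *: inj1 u.
Proof. by rewrite /inj1 -scalemxAr scale_col_mx scaler0. Qed.
Lemma inj2Z c u : inj2 (c *: u) = c *: inj2 u.
Proof. by rewrite /inj2 -scalemxAr scale_col_mx scaler0. Qed.
Lemma inj1N u : inj1 (- u) = - inj1 u.
Proof. by rewrite -scaleN1r inj1Z scaleN1r. Qed.
Lemma inj2N u : inj2 (- u) = - inj2 u.
Proof. by rewrite -scaleN1r inj2Z scaleN1r. Qed.

(** The basis of [C^8] dual to [dx_1, ..., dx_4, dy_1, ..., dy_4]. *)
Definition dual_basis (k : nat) : 'cV[C]_(4 + 4) :=
  if (k < 4)%N then inj1 (unit4 C k) else inj2 (unit4 C (k - 4)).

Lemma D_unit : D \in unitmx.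
Proof. by rewrite map_unitmx; case: basis_dt. Qed.

(** The transformation with matrix [g] in the coordinates [dt_1, ..., dt_4]. *)
Definition conj_dt (g : 'M[C]_4) : 'M[C]_4 := invmx D *m g *m D.

Lemma conj_dt_symplectic g :
  g^T *m map_mx ratr std_symplectic *m g = map_mx ratr std_symplectic ->
  symplectic_group R E (conj_dt g).
Proof.
move=> gS; rewrite /symplectic_group /=; case: basis_dt => _ ->.
have -> : map_mx ratr (dt^T *m std_symplectic *m dt) = D^T *m map_mx ratr std_symplectic *m D.
  have DT : map_mx ratr dt^T = D^T by apply/matrixP => i j; rewrite !mxE.
  by rewrite !map_mxM DT.
exact: conj_congruence D_unit gS.
Qed.

Lemma conj_dt_inj1 g v : diag2 (conj_dt g) *m inj1 v = inj1 (g *m v).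
Proof.
rewrite /inj1.
apply: etrans (diag2_col_mx _ _ _) _.
rewrite /conj_dt.
rewrite (conj_mulK _ _ D_unit).
rewrite mulmx0.
by [].
Qed.

Lemma conj_dt_inj2 g v : diag2 (conj_dt g) *m inj2 v = inj2 (g *m v).
Proof.
rewrite /inj2.
apply: etrans (diag2_col_mx _ _ _) _.
rewrite /conj_dt (conj_mulK _ _ D_unit) mulmx0.
by [].
Qed.

Lemma Sp_invariant_preserves a g (u : nat -> 'cV[C]_(4 + 4)) : Sp_invariant a ->
  g^T *m map_mx ratr std_symplectic *m g = map_mx ratr std_symplectic ->
  (forall k, (k < 8)%N -> diag2 (conj_dt g) *m dual_basis k = u k) ->
  preserves (eval4 a) dual_basis u.
Proof.
move=> inv_a gS gu i j k l i8 j8 k8 l8; rewrite -(gu _ i8) -(gu _ j8) -(gu _ k8) -(gu _ l8).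
by apply: inv_a; apply: conj_dt_symplectic.
Qed.

(** Six values that determine an invariant form of degree 4. *)
Lemma Sp_invariant_eq0 a : ext_degree 4 a -> Sp_invariant a ->
  let F i j k l := eval4 a (dual_basis i) (dual_basis j) (dual_basis k) (dual_basis l) in
  F 0%N 1%N 2%N 3%N = 0 -> F 4%N 5%N 6%N 7%N = 0 -> F 0%N 1%N 2%N 7%N = 0 ->
  F 0%N 5%N 6%N 7%N = 0 -> F 0%N 1%N 6%N 7%N = 0 -> F 0%N 5%N 2%N 7%N = 0 -> a = 0.
Proof.
move=> da inv_a F F1 F2 F3 F4 F5 F6.
have F0 : forall i j k l, (i < 8)%N -> (j < 8)%N -> (k < 8)%N -> (l < 8)%N ->
    F i j k l = 0.
  apply: (@invariant_values_eq0 _ _ (eval4 a) (eval4_linear1 a) (eval4_linear2 a) (eval4_linear3 a)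
    (eval4_linear4 a) (eval4_swap12 a) (eval4_swap23 a) (eval4_swap34 a) dual_basis
    _ _ _ _ F1 F2 F3 F4 F5 F6).
  - apply: (Sp_invariant_preserves inv_a (torus_symplectic C)) => k.
    case: k => [|[|[|[|[|[|[|[|]]]]]]]] //= _;
    rewrite /dual_basis /= (conj_dt_inj1, conj_dt_inj2) torus_unit4 //= ?(inj1Z, inj2Z);
    by rewrite ?divr1 ?mul1r.
  - apply: (Sp_invariant_preserves inv_a (root01_symplectic C)) => k.
    by case: k => [|[|[|[|[|[|[|[|]]]]]]]] //= _;
    rewrite /dual_basis /= (conj_dt_inj1, conj_dt_inj2) root01_unit4 //= ?(inj1D, inj2D).
  - apply: (Sp_invariant_preserves inv_a (root23_symplectic C)) => k.
    by case: k => [|[|[|[|[|[|[|[|]]]]]]]] //= _;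
    rewrite /dual_basis /= (conj_dt_inj1, conj_dt_inj2) root23_unit4 //= ?(inj1D, inj2D).
  - apply: (Sp_invariant_preserves inv_a (root02_symplectic C)) => k.
    by case: k => [|[|[|[|[|[|[|[|]]]]]]]] //= _;
    rewrite /dual_basis /= (conj_dt_inj1, conj_dt_inj2) root02_unit4 //=
      ?(inj1D, inj2D, inj1N, inj2N).
apply: eval4_inj da _ _ => [A _|x y z t]; first by rewrite ffunE.
have -> : eval4 (0 : ext C (4 + 4)) x y z t = 0.
  by rewrite -(scale0r (0 : ext C (4 + 4))) eval4Z mul0r.
have basis8 (w : 'cV[C]_(4 + 4)) : exists c : 'cV[C]_(4 + 4), w = \sum_i c i 0 *: dual_basis i.
  exists (diag2 D *m w).
  rewrite big_split_ord /=.
  have lo (i : 'I_4) : dual_basis (lshift 4 i) = inj1 (delta_mx i 0).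
    rewrite /dual_basis /= ltn_ord /unit4; congr (inj1 (delta_mx _ _)).
    by apply: val_inj; rewrite /= inordK.
  have hi (i : 'I_4) : dual_basis (rshift 4 i) = inj2 (delta_mx i 0).
    have -> : dual_basis (rshift 4 i) = inj2 (unit4 C i).
      by rewrite /dual_basis -[nat_of_ord (rshift 4 i)]/(4 + i)%N ltnNge leq_addr /= addKn.
    congr (inj2 (delta_mx _ _)).
    by apply: val_inj; rewrite /= inordK.
  under eq_bigr do rewrite lo -inj1Z.
  under [X in _ + X]eq_bigr do rewrite hi -inj2Z.
  have s1 := big_morph inj1 inj1D (_ : inj1 0 = 0).
  have s2 := big_morph inj2 inj2D (_ : inj2 0 = 0).
  rewrite -s1 ?/inj1 ?mulmx0 ?col_mx0 // -/(inj1 _) -s2 ?/inj2 ?mulmx0 ?col_mx0 // -/(inj2 _).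
  have Dw : diag2 D *m w = col_mx (D *m usubmx w) (D *m dsubmx w).
    by rewrite /diag2 -[w in LHS]vsubmxK mul_block_col !mul0mx addr0 add0r.
  rewrite Dw.
  under eq_bigr do rewrite col_mxEu.
  under [X in _ + inj2 X]eq_bigr do rewrite col_mxEd.
  rewrite -!col_basis /inj1 /inj2 add_col_mx addr0 add0r !mulKmx ?D_unit //.
  by rewrite vsubmxK.
have [x' ->] := basis8 x; have [y' ->] := basis8 y.
have [z' ->] := basis8 z; have [t' ->] := basis8 t.
rewrite eval4_sum4 big1 // => i _; rewrite big1 // => j _; rewrite big1 // => k _.
by rewrite big1 // => l _; rewrite [eval4 _ _ _ _ _]F0 ?mulr0.
Qed.

End AdaptedBasis.

(** * The monomials in the classes omega are Hodge classes *)

Section ComplexifyMorphism.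
Variables (R : realType) (n : nat).
Implicit Types a b : ext rat n.

Lemma complexifyD a b : complexify R (a + b) = complexify R a + complexify R b.
Proof. by apply/ffunP => A; rewrite !ffunE rmorphD. Qed.

Lemma complexifyN a : complexify R (- a) = - complexify R a.
Proof. by apply/ffunP => A; rewrite !ffunE rmorphN. Qed.

Lemma complexify_wedge a b : complexify R (a \^ b) = complexify R a \^ complexify R b.
Proof.
apply/ffunP => A; rewrite !ffunE rmorph_sum; apply: eq_bigr => B _.
by rewrite !ffunE !rmorphM rmorphXn rmorphN1.
Qed.

Lemma complexify_form1 (v : 'rV[rat]_n) : complexify R (form1 v) = form1 (map_mx ratr v).
Proof.
apply/ffunP => A; rewrite !ffunE rmorph_sum; apply: eq_bigr => i _.
by rewrite mxE.
Qed.
End ComplexifyMorphism.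

(** The standard symplectic form on integral vectors. *)
Definition std_formz (p q : nat -> bool) : int :=
  (p 0%N)%:Z * (q 1%N)%:Z - (p 1%N)%:Z * (q 0%N)%:Z
  + ((p 2%N)%:Z * (q 3%N)%:Z - (p 3%N)%:Z * (q 2%N)%:Z).

Lemma sum_row6 (K : pzRingType) (V : lmodType K) (x : 'rV[K]_6) (v : nat -> V) :
  \sum_(m < 6) x 0 m *: v m = x 0 0 *: v 0%N + x 0 1 *: v 1%N + x 0 2 *: v 2%N
    + x 0 3 *: v 3%N + x 0 4 *: v 4%N + x 0 5 *: v 5%N.
Proof.
rewrite 6!big_ord_recl big_ord0 addr0 !addrA.
by congr (x _ _ *: _ + x _ _ *: _ + x _ _ *: _ + x _ _ *: _ + x _ _ *: _ + x _ _ *: _);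
  apply: val_inj.
Qed.

Section Theta.
Variable (R : realType).
Local Notation C := R[i].
Variables (J : abelianSurface R) (E dt : 'M[rat]_4).
Hypotheses (polE : is_polarization (periods J) E) (basis_dt : symplectic_basis E dt).
Local Notation D := (map_mx ratr dt : 'M[C]_4).
Local Notation e := (dual_basis R dt).

(** The rational 2-forms. *)
Definition rational2 (a : ext C (4 + 4)) : Prop :=
  exists2 h : ext rat (4 + 4), ext_degree 2 h & complexify R h = a.

Lemma rational2D a b : rational2 a -> rational2 b -> rational2 (a + b).
Proof.
move=> [h dh <-] [k dk <-]; exists (h + k); first exact: ext_degreeD.
by rewrite complexifyD.
Qed.

Lemma rational2N a : rational2 a -> rational2 (- a).
Proof.
move=> [h dh <-]; exists (- h); first exact: ext_degreeN.
by rewrite complexifyN.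
Qed.

Lemma rational2_form1 (u v : 'rV[rat]_(4 + 4)) :
  rational2 (form1 (map_mx ratr u) \^ form1 (map_mx ratr v)).
Proof.
exists (form1 u \^ form1 v); first exact: ext_degree_wedge_form1.
by rewrite complexify_wedge !complexify_form1.
Qed.

Lemma dxE j : dx R dt j = form1 (map_mx ratr (row_mx (row j dt) 0)).
Proof. by rewrite map_row_mx map_mx0. Qed.

Lemma dyE j : dy R dt j = form1 (map_mx ratr (row_mx 0 (row j dt))).
Proof. by rewrite map_row_mx map_mx0. Qed.

Lemma rational2_omega1 : rational2 (omega1 R dt).
Proof. by rewrite /omega1 !dxE; apply: rational2D; apply: rational2_form1. Qed.

Lemma rational2_omega2 : rational2 (omega2 R dt).
Proof. by rewrite /omega2 !dyE; apply: rational2D; apply: rational2_form1. Qed.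

Lemma rational2_omega_sigma : rational2 (omega_sigma R dt).
Proof.
rewrite /omega_sigma !dxE !dyE.
apply: rational2D; last by apply: rational2N; apply: rational2_form1.
apply: rational2D; last exact: rational2_form1.
apply: rational2D; last by apply: rational2N; apply: rational2_form1.
exact: rational2_form1.
Qed.

Lemma hodge_class_wedge a b :
  rational2 a -> rational2 b -> type11 (periods2 J) a -> type11 (periods2 J) b ->
  exists2 h, hodge_class J 2 h & complexify R h = a \^ b.
Proof.
move=> [h dh ha] [k dk kb] ta tb; exists (h \^ k); last first.
  by rewrite complexify_wedge ha kb.
split; first exact: (ext_degree_wedge dh dk).
by rewrite complexify_wedge ha kb; apply: type11_wedge.
Qed.

(** The six products of the classes omega, in the order of the coordinates. *)
Definition theta_basis (m : nat) : ext C (4 + 4) :=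
  let w1 := omega1 R dt in let w2 := omega2 R dt in let ws := omega_sigma R dt in
  nth 0 [:: w1 \^ w1; w1 \^ w2; w2 \^ w2; w1 \^ ws; w2 \^ ws; ws \^ ws] m.

Lemma thetaE (x : 'rV[C]_6) : theta dt x = \sum_(m < 6) x 0 m *: theta_basis m.
Proof. exact: (esym (sum_row6 x theta_basis)). Qed.

Lemma theta_basis_hodge (m : 'I_6) :
  exists2 h, hodge_class J 2 h & complexify R h = theta_basis m.
Proof.
have H a b := @hodge_class_wedge a b.
have r1 := rational2_omega1; have r2 := rational2_omega2; have rs := rational2_omega_sigma.
have t1 := type11_omega1 polE basis_dt; have t2 := type11_omega2 polE basis_dt.
have ts := type11_omega_sigma polE basis_dt.
rewrite /theta_basis.
by case: m => [[|[|[|[|[|[|?]]]]]] ?] //=; apply: H.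
Qed.

Lemma theta_degree x : ext_degree 4 (theta dt x : ext C (4 + 4)).
Proof.
rewrite thetaE; apply: ext_degree_sum => m _; apply: ext_degreeZ.
have H (a b : ext C (4 + 4)) : ext_degree 2 a -> ext_degree 2 b -> ext_degree 4 (a \^ b).
  exact: (@ext_degree_wedge _ _ 2 2).
have d1 := @ext_degree_omega1 R dt; have d2 := @ext_degree_omega2 R dt.
have ds := @ext_degree_omega_sigma R dt.
rewrite /theta_basis.
by case: m => [[|[|[|[|[|[|?]]]]]] ?] //=; apply: H.
Qed.

End Theta.

(** * The values of theta *)

(** The coordinate [dx_j], resp. [dy_j], of the [k]-th vector of the dual basis,
    with [j] and [k] numbered from 0. *)
Definition upper (k : nat) (j : nat) : bool := k == j.
Definition lower (k : nat) (j : nat) : bool := k == (4 + j)%N.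

Lemma std_form_int (K : comPzRingType) (u v : 'cV[K]_4) (p q : nat -> bool) :
  (forall j, u j 0 = (p j)%:R) -> (forall j, v j 0 = (q j)%:R) ->
  std_form u v = (std_formz p q)%:~R.
Proof.
by move=> up vq; rewrite /std_form /std_formz !up !vq !(intrD, intrM, mulrNz) !pmulrn.
Qed.

(** The coefficients of [x_0, ..., x_5] in the value of [theta] on four vectors
    of the basis dual to [dx_1, ..., dx_4, dy_1, ..., dy_4]. *)
Definition theta_coefs (i j k l : nat) : seq int :=
  let w1 a b := std_formz (upper a) (upper b) in
  let w2 a b := std_formz (lower a) (lower b) in
  let ws a b := std_formz (upper a) (lower b) + std_formz (lower a) (upper b) in
  [:: product22 w1 w1 i j k l; product22 w1 w2 i j k l; product22 w2 w2 i j k l;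
      product22 w1 ws i j k l; product22 w2 ws i j k l; product22 ws ws i j k l].

Lemma product22_int (K : comPzRingType) (V : Type) (p q : V -> V -> K) (e : nat -> V)
    (wp wq : nat -> nat -> int) i j k l :
  (forall m n, (m < 8)%N -> (n < 8)%N -> p (e m) (e n) = (wp m n)%:~R) ->
  (forall m n, (m < 8)%N -> (n < 8)%N -> q (e m) (e n) = (wq m n)%:~R) ->
  (i < 8)%N -> (j < 8)%N -> (k < 8)%N -> (l < 8)%N ->
  product22 p q (e i) (e j) (e k) (e l) = (product22 wp wq i j k l)%:~R.
Proof.
move=> aE bE i8 j8 k8 l8; rewrite /product22.
rewrite (aE i j) // (aE i k) // (aE i l) // (aE j k) // (aE j l) // (aE k l) //.
rewrite (bE i j) // (bE i k) // (bE i l) // (bE j k) // (bE j l) // (bE k l) //.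
by rewrite !(intrD, mulrNz, intrM).
Qed.

Section ThetaValues.
Variable (R : realType).
Local Notation C := R[i].
Variables (E dt : 'M[rat]_4).
Hypothesis basis_dt : symplectic_basis E dt.
Local Notation D := (map_mx ratr dt : 'M[C]_4).
Local Notation e := (dual_basis R dt).

Lemma dual_basis_upper k (j : 'I_4) : (k < 8)%N ->
  (D *m usubmx (e k)) j 0 = (upper k j)%:R.
Proof.
move=> k8; rewrite /dual_basis /upper; case: ltnP => k4.
  by rewrite /inj1 col_mxKu mulKVmx ?(D_unit _ basis_dt) // unit4E // eq_sym.
rewrite /inj2 col_mxKu mulmx0 mxE; case: eqP => // kj.
by move: k4; rewrite kj leqNgt ltn_ord.
Qed.

Lemma dual_basis_lower k (j : 'I_4) : (k < 8)%N ->
  (D *m dsubmx (e k)) j 0 = (lower k j)%:R.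
Proof.
move=> k8; rewrite /dual_basis /lower; case: ltnP => k4.
  rewrite /inj1 col_mxKd mulmx0 mxE; case: eqP => // kj.
  by move: k4; rewrite kj ltnNge leq_addr.
have k44 : (k - 4 < 4)%N by rewrite ltn_subLR.
rewrite /inj2 col_mxKd mulKVmx ?(D_unit _ basis_dt) // unit4E //.
by rewrite eq_sym -(eqn_add2l 4) subnKC.
Qed.

Lemma eval4_wedge_dual a b (wa wb : nat -> nat -> int) i j k l :
  ext_degree 2 a -> ext_degree 2 b ->
  (forall m n, (m < 8)%N -> (n < 8)%N -> eval2 a (e m) (e n) = (wa m n)%:~R) ->
  (forall m n, (m < 8)%N -> (n < 8)%N -> eval2 b (e m) (e n) = (wb m n)%:~R) ->
  (i < 8)%N -> (j < 8)%N -> (k < 8)%N -> (l < 8)%N ->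
  eval4 (a \^ b) (e i) (e j) (e k) (e l) = (product22 wa wb i j k l)%:~R.
Proof.
move=> da db aE bE i8 j8 k8 l8; apply: etrans (eval4_wedge _ _ _ _ da db) _.
exact: (product22_int aE bE).
Qed.

Lemma eval4_theta_basis (m : 'I_6) i j k l :
  (i < 8)%N -> (j < 8)%N -> (k < 8)%N -> (l < 8)%N ->
  eval4 (theta_basis R dt m) (e i) (e j) (e k) (e l) = ((theta_coefs i j k l)`_m)%:~R.
Proof.
move=> i8 j8 k8 l8.
have d1 := @ext_degree_omega1 R dt; have d2 := @ext_degree_omega2 R dt.
have ds := @ext_degree_omega_sigma R dt.
have e1 a b : (a < 8)%N -> (b < 8)%N -> eval2 (omega1 R dt) (e a) (e b)
   = (std_formz (upper a) (upper b))%:~R.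
  move=> a8 b8; rewrite eval2_omega1.
  by apply: std_form_int => n; apply: dual_basis_upper.
have e2 a b : (a < 8)%N -> (b < 8)%N -> eval2 (omega2 R dt) (e a) (e b)
   = (std_formz (lower a) (lower b))%:~R.
  move=> a8 b8; rewrite eval2_omega2.
  by apply: std_form_int => n; apply: dual_basis_lower.
have es a b : (a < 8)%N -> (b < 8)%N -> eval2 (omega_sigma R dt) (e a) (e b)
   = (std_formz (upper a) (lower b) + std_formz (lower a) (upper b))%:~R.
  move=> a8 b8; rewrite eval2_omega_sigma intrD.
  by congr (_ + _); apply: std_form_int => n; (apply: dual_basis_lower || apply: dual_basis_upper).
rewrite /theta_basis.
by case: m => [[|[|[|[|[|[|?]]]]]] ?] //=; apply: eval4_wedge_dual.
Qed.

Lemma eval4_theta (x : 'rV[C]_6) i j k l :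
  (i < 8)%N -> (j < 8)%N -> (k < 8)%N -> (l < 8)%N ->
  eval4 (theta dt x) (e i) (e j) (e k) (e l) =
  \sum_(m < 6) x 0 m * ((theta_coefs i j k l)`_m)%:~R.
Proof.
move=> i8 j8 k8 l8; rewrite thetaE eval4_sum; apply: eq_bigr => m _.
by rewrite eval4Z eval4_theta_basis.
Qed.

(** Only one of the coefficients is nonzero. *)
Lemma sum_single (K : pzRingType) n (x : 'rV[K]_n) (s : seq int) (m : 'I_n) c :
  (forall i : 'I_n, s`_i = (if i == m then c else 0)) ->
  \sum_(i < n) x 0 i * (s`_i)%:~R = x 0 m * c%:~R.
Proof.
move=> sE; rewrite (bigD1 m) //= sE eqxx big1 ?addr0 // => i im.
by rewrite sE (negbTE im) mulr0.
Qed.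

(** Six values of [theta x] that determine [x]. *)
Lemma eval4_theta_coord (x : 'rV[C]_6) :
  let F i j k l := eval4 (theta dt x) (e i) (e j) (e k) (e l) in
  [/\ F 0%N 1%N 2%N 3%N = x 0 0 * 2, F 4%N 5%N 6%N 7%N = x 0 2 * 2,
      F 0%N 1%N 2%N 7%N = x 0 3 * 1 & 
      [/\ F 0%N 5%N 6%N 7%N = x 0 4 * 1, F 0%N 1%N 6%N 7%N = x 0 1 * 1 &
          F 0%N 5%N 2%N 7%N = x 0 5 * 2]].
Proof.
split; [| | |split]; rewrite /= eval4_theta //.
- apply: (@sum_single C 6 x (theta_coefs 0 1 2 3) 0 2).
  by case=> [[|[|[|[|[|[|?]]]]]] ?]; vm_compute.
- apply: (@sum_single C 6 x (theta_coefs 4 5 6 7) 2 2).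
  by case=> [[|[|[|[|[|[|?]]]]]] ?]; vm_compute.
- apply: (@sum_single C 6 x (theta_coefs 0 1 2 7) 3 1).
  by case=> [[|[|[|[|[|[|?]]]]]] ?]; vm_compute.
- apply: (@sum_single C 6 x (theta_coefs 0 5 6 7) 4 1).
  by case=> [[|[|[|[|[|[|?]]]]]] ?]; vm_compute.
- apply: (@sum_single C 6 x (theta_coefs 0 1 6 7) 1 1).
  by case=> [[|[|[|[|[|[|?]]]]]] ?]; vm_compute.
- apply: (@sum_single C 6 x (theta_coefs 0 5 2 7) 5 2).
  by case=> [[|[|[|[|[|[|?]]]]]] ?]; vm_compute.
Qed.
End ThetaValues.

(** * The map theta is a bijection onto B^2 *)

Section HodgeBijection.
Variable (R : realType).
Local Notation C := R[i].
Variables (J : abelianSurface R) (E dt : 'M[rat]_4).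
Hypotheses (polE : is_polarization (periods J) E)
  (general : hodge_group J = symplectic_group R E) (basis_dt : symplectic_basis E dt).
Local Notation e := (dual_basis R dt).

Lemma Sp_invariantD (a b : ext C (4 + 4)) : Sp_invariant E a -> Sp_invariant E b -> Sp_invariant E (a + b).
Proof. by move=> ia ib g gE x y z t; rewrite [LHS]eval4D [RHS]eval4D (ia _ gE) (ib _ gE). Qed.

Lemma Sp_invariantZ c (a : ext C (4 + 4)) : Sp_invariant E a -> Sp_invariant E (c *: a).
Proof. by move=> ia g gE x y z t; rewrite [LHS]eval4Z [RHS]eval4Z (ia _ gE). Qed.

Lemma Sp_invariant_hodge h : hodge_class J 2 h -> Sp_invariant E (complexify R h).
Proof. by move=> hh g gE x y z t; apply: (hodge_class_invariant general hh gE). Qed.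

Lemma Sp_invariant_theta (x : 'rV[C]_6) : Sp_invariant E (theta dt x).
Proof.
rewrite thetaE; apply: (big_ind (@Sp_invariant R E)) => [|a b|m _].
- by rewrite -(scale0r (theta_basis R dt 0)); apply: Sp_invariantZ;
    have [h hh <-] := theta_basis_hodge polE basis_dt ord0; apply: Sp_invariant_hodge.
- exact: Sp_invariantD.
- apply: Sp_invariantZ; have [h hh <-] := theta_basis_hodge polE basis_dt m.
  exact: Sp_invariant_hodge.
Qed.

Lemma thetaD x y : theta dt (x + y) = theta dt x + theta dt y :> ext C (4 + 4).
Proof.
by rewrite !thetaE -big_split; apply: eq_bigr => m _; rewrite /= mxE scalerDl.
Qed.

Lemma thetaZ c x : theta dt (c *: x) = c *: theta dt x :> ext C (4 + 4).
Proof. by rewrite !thetaE scaler_sumr; apply: eq_bigr => m _; rewrite mxE scalerA. Qed.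

Lemma theta_eq0 (x : 'rV[C]_6) : theta dt x = 0 -> x = 0.
Proof.
move=> x0; have [h0 h2 h3 [h4 h1 h5]] := eval4_theta_coord basis_dt x.
have z0 u v w t : 0 = eval4 (theta dt x) u v w t.
  by rewrite x0 -(scale0r (0 : ext C (4 + 4))) eval4Z mul0r.
have two : (2 : C) != 0 by rewrite pnatr_eq0.
have cancel2 (c : C) : 0 = c * 2 -> c = 0.
  by move/esym/eqP; rewrite mulf_eq0 (negbTE two) orbF => /eqP.
have cancel1 (c : C) : 0 = c * 1 -> c = 0 by rewrite mulr1.
have {}h0 := cancel2 _ (etrans (z0 _ _ _ _) h0).
have {}h1 := cancel1 _ (etrans (z0 _ _ _ _) h1).
have {}h2 := cancel2 _ (etrans (z0 _ _ _ _) h2).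
have {}h3 := cancel1 _ (etrans (z0 _ _ _ _) h3).
have {}h4 := cancel1 _ (etrans (z0 _ _ _ _) h4).
have {}h5 := cancel2 _ (etrans (z0 _ _ _ _) h5).
apply/rowP => m; rewrite [RHS]mxE.
case: m => [[|[|[|[|[|[|?]]]]]] m6] //.
- by rewrite -[RHS]h0; congr (x _ _); apply: val_inj.
- by rewrite -[RHS]h1; congr (x _ _); apply: val_inj.
- by rewrite -[RHS]h2; congr (x _ _); apply: val_inj.
- by rewrite -[RHS]h3; congr (x _ _); apply: val_inj.
- by rewrite -[RHS]h4; congr (x _ _); apply: val_inj.
- by rewrite -[RHS]h5; congr (x _ _); apply: val_inj.
Qed.

Lemma theta_inj : injective (theta dt : 'rV[C]_6 -> ext C (4 + 4)).
Proof.
move=> x y xy; apply/eqP; rewrite -subr_eq0; apply/eqP/theta_eq0.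
by rewrite -scaleN1r thetaD thetaZ xy scaleN1r subrr.
Qed.

Lemma hodge_class_theta h : hodge_class J 2 h ->
  exists x : 'rV[C]_6, complexify R h = theta dt x.
Proof.
move=> hh; pose F i j k l := eval4 (complexify R h) (e i) (e j) (e k) (e l).
pose x : 'rV[C]_6 := \row_m nth 0 [:: F 0%N 1%N 2%N 3%N / 2; F 0%N 1%N 6%N 7%N;
  F 4%N 5%N 6%N 7%N / 2; F 0%N 1%N 2%N 7%N; F 0%N 5%N 6%N 7%N; F 0%N 5%N 2%N 7%N / 2] m.
exists x; apply/eqP; rewrite -subr_eq0; apply/eqP.
have dh : ext_degree 4 (complexify R h).
  by move=> A A4; rewrite ffunE (proj1 hh) // rmorph0.
have da : ext_degree 4 (complexify R h - theta dt x).
  by apply: ext_degreeD dh _; apply/ext_degreeN/theta_degree.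
have ia : Sp_invariant E (complexify R h - theta dt x).
  rewrite -scaleN1r; apply: Sp_invariantD; first exact: Sp_invariant_hodge.
  exact/Sp_invariantZ/Sp_invariant_theta.
have two : (2 : C) != 0 by rewrite pnatr_eq0.
have [h0 h2 h3 [h4 h1 h5]] := eval4_theta_coord basis_dt x.
have B (c d : C) : d = c -> c - d = 0 by move->; rewrite subrr.
apply: (Sp_invariant_eq0 basis_dt da ia); rewrite [LHS]eval4D [X in _ + X]eval4N; apply: B.
- by apply: etrans h0 _; rewrite mxE /= mulfVK.
- by apply: etrans h2 _; rewrite mxE /= mulfVK.
- by apply: etrans h3 _; rewrite mxE /= mulr1.
- by apply: etrans h4 _; rewrite mxE /= mulr1.
- by apply: etrans h1 _; rewrite mxE /= mulr1.
- by apply: etrans h5 _; rewrite mxE /= mulfVK.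
Qed.

Lemma hodgeC_theta x : hodgeC J 2 (theta dt x).
Proof.
have H m := theta_basis_hodge polE basis_dt m.
have /fin_all_exists[h hP] : forall m : 'I_6, exists h,
    hodge_class J 2 h /\ complexify R h = theta_basis R dt m.
  by move=> m; have [h hh he] := H m; exists h.
exists 6%N, (fun m => x 0 m), h; split; first by move=> m; have [] := hP m.
by rewrite thetaE; apply: eq_bigr => m _; have [_ ->] := hP m.
Qed.

Lemma theta_hodgeC a : hodgeC J 2 a -> exists x : 'rV[C]_6, theta dt x = a.
Proof.
case=> m [c [h [hh ->]]].
apply: (big_ind (fun b => exists x : 'rV[C]_6, theta dt x = b)) => [|b b'|i _].
- by exists 0; rewrite -(scale0r 0) thetaZ scale0r.
- by move=> [x <-] [y <-]; exists (x + y); rewrite thetaD.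
- by have [x xE] := hodge_class_theta (hh i); exists (c i *: x); rewrite thetaZ -xE.
Qed.
End HodgeBijection.

(** * Polynomials vanishing everywhere *)

Section VanishingPolynomials.
Variable (K : numFieldType).

Lemma poly_eq0_everywhere (p : {poly K}) : (forall t, p.[t] = 0) -> p = 0.
Proof.
move=> p0; apply: (@roots_geq_poly_eq0 _ p [seq i%:R | i <- iota 0 (size p)]).
- by apply/allP => _ /mapP[i _ ->]; rewrite rootE p0.
- by rewrite map_inj_uniq ?iota_uniq // => i j /eqP; rewrite eqr_nat => /eqP.
- by rewrite size_map size_iota.
Qed.

(** The point [v] extended by a last coordinate [t]. *)
Definition extend n (v : 'I_n -> K) (t : K) (i : 'I_n.+1) : K :=
  if unlift ord_max i is Some j then v j else t.

Lemma extend_max n (v : 'I_n -> K) t : extend v t ord_max = t.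
Proof. by rewrite /extend unlift_none. Qed.

Lemma extend_widen n (v : 'I_n -> K) t (i : 'I_n) :
  extend v t (widen_ord (leqnSn n) i) = v i.
Proof.
rewrite /extend (_ : widen_ord _ i = lift ord_max i) ?liftK //.
by apply: val_inj; rewrite /= /bump leqNgt ltn_ord.
Qed.

Lemma muni_eval n (p : {mpoly K[n.+1]}) v t :
  (map_poly (meval v) (muni p)).[t] = p.@[extend v t].
Proof.
rewrite muniE rmorph_sum horner_sum mevalE; apply: eq_bigr => m _.
rewrite /= map_polyZ map_polyXn hornerZ hornerXn /= mevalZ mevalX.
rewrite big_ord_recr /= extend_max mulrA; congr (_ * _ * _).
by apply: eq_bigr => i _; rewrite extend_widen mnmE.
Qed.

Lemma muni_inj n (p : {mpoly K[n.+1]}) : muni p = 0 -> p = 0.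
Proof.
move=> p0; suff <- : (map_poly (@mwiden n K) (muni p)).['X_ord_max] = p.
  by rewrite p0 rmorph0 horner0.
rewrite muniE rmorph_sum horner_sum [RHS]mpolyE; apply: eq_bigr => m _.
rewrite /= map_polyZ map_polyXn hornerZ hornerXn /= mwidenZ mwidenX -scalerAl.
congr (_ *: _); rewrite mpolyXn -mpolyXD; congr ('X_[_]); apply/mnmP => i.
rewrite mnmDE mulmnE mnm1E.
case: (unliftP ord_max i) => [j ->|->].
  rewrite (_ : lift ord_max j = widen_ord (leqnSn n) j); last first.
    by apply: val_inj; rewrite /= /bump leqNgt ltn_ord.
  rewrite mnmwiden_widen mnmE -val_eqE /= eq_sym ltn_eqF ?ltn_ord //.
  by rewrite mul0n addn0.
by rewrite mnmwiden_ordmax eqxx mul1n.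
Qed.

(** A polynomial over an infinite field that vanishes everywhere is zero. *)
Lemma mpoly_eq0_everywhere n (p : {mpoly K[n]}) : (forall v, p.@[v] = 0) -> p = 0.
Proof.
elim: n p => [|n IHn] p p0.
  apply/mpolyP => m; rewrite mcoeff0; have := p0 (fun _ => 0).
  rewrite (_ : p = (p@_0)%:MP); last first.
    apply/mpolyP => m'; rewrite mcoeffC.
    have -> : m' = 0%MM by apply/mnmP; case.
    by rewrite eqxx mulr1.
  by rewrite mevalC => ->; rewrite mpolyC0 mcoeff0.
apply: muni_inj; apply/polyP => i; rewrite coef0; apply: IHn => v.
have : map_poly (meval v) (muni p) = 0.
  by apply: poly_eq0_everywhere => t; rewrite muni_eval.
by move=> /polyP/(_ i); rewrite coef_map coef0.
Qed.
End VanishingPolynomials.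

(** * Polynomials monic in one variable *)

Section DivisionInOneVariable.
Variables (K : numClosedFieldType) (n : nat) (i0 : 'I_n).

(** The point [x] with its coordinate [i0] replaced by [t]. *)
Definition update (x : 'I_n -> K) (t : K) (i : 'I_n) : K := if i == i0 then t else x i.

(** A polynomial of [K[X_1, ..., X_n]] seen as a polynomial in [X_i0]. *)
Definition in_variable (p : {mpoly K[n]}) : {poly {mpoly K[n]}} :=
  mmap (polyC \o @mpolyC n K) (fun i => if i == i0 then 'X else ('X_i)%:P) p.

Lemma in_variable_eval p x t :
  (map_poly (meval x) (in_variable p)).[t] = p.@[update x t].
Proof.
rewrite /in_variable /mmap rmorph_sum horner_sum mevalE; apply: eq_bigr => m _.
rewrite rmorphM /= map_polyC /= mevalC hornerM hornerC; congr (_ * _).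
rewrite /mmap1 rmorph_prod horner_prod; apply: eq_bigr => i _.
rewrite rmorphXn /= horner_exp /update; congr (_ ^+ _).
case: ifP => _; first by rewrite map_polyX hornerX.
by rewrite map_polyC hornerC /= mevalXU.
Qed.

Lemma in_variable_id p : (in_variable p).['X_i0] = p.
Proof.
rewrite /in_variable /mmap horner_sum [RHS]mpolyE; apply: eq_bigr => m _.
rewrite hornerM hornerC mul_mpolyC; congr (_ *: _).
rewrite [RHS]mpolyXE_id /mmap1 horner_prod; apply: eq_bigr => i _.
rewrite horner_exp; congr (_ ^+ _); case: eqP => [->|_]; first by rewrite hornerX.
by rewrite hornerC.
Qed.

(** A polynomial that vanishes on the hypersurface of a polynomial monic in one
    variable and generically without multiple roots is a multiple of it. *)
Lemma monic_dvd (g : {poly {mpoly K[n]}}) (disc H : {mpoly K[n]}) :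
  g \is monic -> disc != 0 ->
  (forall x, disc.@[x] != 0 -> exists2 rs : seq K, uniq rs /\ (size g <= (size rs).+1)%N &
     {in rs, forall t, root (map_poly (meval x) g) t /\ H.@[update x t] = 0}) ->
  exists Q, H = Q * g.['X_i0].
Proof.
move=> gm disc0 rsP.
have := Pdiv.RingMonic.rdivp_eq gm (in_variable H).
set q := Pdiv.Ring.rdivp _ _; set r := Pdiv.Ring.rmodp _ _ => HE.
have sr : (size r < size g)%N by apply: Pdiv.Ring.ltn_rmodpN0; apply: monic_neq0.
suff r0 : r = 0.
  by exists q.['X_i0]; rewrite -[LHS]in_variable_id HE r0 addr0 hornerM.
apply/polyP => k; rewrite coef0; apply/eqP.
suff : disc * r`_k == 0 by rewrite mulf_eq0 (negbTE disc0).
apply/eqP; apply: mpoly_eq0_everywhere => x; rewrite mevalM.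
have [->|dx] := eqVneq disc.@[x] 0; first by rewrite mul0r.
have [rs [Urs srs] rsH] := rsP x dx.
suff /polyP/(_ k) : map_poly (meval x) r = 0.
  by rewrite coef_map coef0 /= => ->; rewrite mulr0.
apply: (@roots_geq_poly_eq0 _ _ rs) => //.
  apply/allP => t /rsH[gt Ht]; rewrite rootE; apply/eqP.
  have := in_variable_eval H x t; rewrite HE Ht rmorphD rmorphM /= hornerD hornerM.
  by rewrite (eqP gt) mulr0 add0r.
rewrite (leq_trans (size_poly _ _)) // -ltnS; exact: leq_trans sr srs.
Qed.
End DivisionInOneVariable.

(** The cubic t^3 + p t^2 + q t + w. *)
Definition cubic_poly (A : nzRingType) (p q w : A) : {poly A} :=
  'X^3 + (p *: 'X^2 + (q *: 'X + w%:P)).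

Lemma horner_cubic_poly (A : comNzRingType) (p q w t : A) :
  (cubic_poly p q w).[t] = t ^+ 3 + p * t ^+ 2 + q * t + w.
Proof. by rewrite !(hornerD, hornerZ, hornerXn, hornerX, hornerC) !addrA. Qed.

Lemma map_cubic_poly (A B : nzRingType) (f : {rmorphism A -> B}) p q w :
  map_poly f (cubic_poly p q w) = cubic_poly (f p) (f q) (f w).
Proof.
by rewrite /cubic_poly !rmorphD /= !map_polyZ !map_polyXn map_polyX map_polyC.
Qed.

Lemma size_cubic_poly (A : nzRingType) (p q w : A) : size (cubic_poly p q w) = 4.
Proof.
rewrite /cubic_poly size_polyDl size_polyXn // (leq_ltn_trans (size_polyD _ _)) //.
rewrite gtn_max (leq_ltn_trans (size_scale_leq _ _)) ?size_polyXn //=.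
rewrite (leq_ltn_trans (size_polyD _ _)) // gtn_max.
by rewrite (leq_ltn_trans (size_scale_leq _ _)) ?size_polyX //= (leq_ltn_trans (size_polyC_leq1 _)).
Qed.

Lemma cubic_poly_monic (A : nzRingType) (p q w : A) : cubic_poly p q w \is monic.
Proof.
rewrite monicE lead_coefE size_cubic_poly.
by rewrite !(coefD, coefXn, coefZ, coefX, coefC) /= !mulr0 !addr0.
Qed.

Section Cubic.
Variable K : numClosedFieldType.

(** Its discriminant. *)
Definition cubic_disc (R : comPzRingType) (p q w : R) : R :=
  p ^+ 2 * q ^+ 2 - 4 * q ^+ 3 - 4 * p ^+ 3 * w + 18 * p * q * w - 27 * w ^+ 2.

Lemma cubic_roots (p q w : K) : cubic_disc p q w != 0 ->
  exists2 rs : seq K, uniq rs /\ size rs = 3 &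
    {in rs, forall t, t ^+ 3 + p * t ^+ 2 + q * t + w = 0}.
Proof.
move=> d0; pose f := cubic_poly p q w; have sf : size f = 4 := size_cubic_poly p q w.
have fm : lead_coef f = 1 by apply/eqP; rewrite -monicE; apply: cubic_poly_monic.
have [rs fE] := closed_field_poly_normal f; rewrite fm scale1r in fE.
have srs : size rs = 3 by have := size_prod_XsubC rs id; rewrite -fE sf => -[].
have fx t : f.[t] = t ^+ 3 + p * t ^+ 2 + q * t + w := horner_cubic_poly p q w t.
exists rs; last first.
  by move=> t trs; rewrite -fx; apply/eqP; rewrite -/(root f t) fE root_prod_XsubC.
split=> //.
case: rs fE srs => [|a [|b [|c []]]] //= fE _.
have h t : t ^+ 3 + p * t ^+ 2 + q * t + w = (t - a) * ((t - b) * (t - c)).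
  by rewrite -fx fE !big_cons big_nil !hornerE /=; ring.
have hw : w = - (a * b * c).
  by have := h 0; rewrite !expr0n /= !mulr0 !add0r => ->; ring.
(* Viete's formulas, from the values at 0, 1 and -1. *)
have hpq1 : p + q = - (a + b + c) + (a * b + b * c + a * c).
  have -> : p + q = (1 ^+ 3 + p * 1 ^+ 2 + q * 1 + w) - 1 - w by ring.
  by rewrite h hw; ring.
have hpq2 : p - q = - (a + b + c) - (a * b + b * c + a * c).
  have -> : p - q = ((-1) ^+ 3 + p * (-1) ^+ 2 + q * (-1) + w) + 1 - w by ring.
  by rewrite h hw; ring.
have two : (2 : K) != 0 by rewrite pnatr_eq0.
have hp : p = - (a + b + c).
  apply: (mulfI two); have -> : 2 * p = p + q + (p - q) by ring.
  by rewrite hpq1 hpq2; ring.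
have hq : q = a * b + b * c + a * c.
  apply: (mulfI two); have -> : 2 * q = p + q - (p - q) by ring.
  by rewrite hpq1 hpq2; ring.
have dE : cubic_disc p q w = ((a - b) * (a - c) * (b - c)) ^+ 2.
  by rewrite /cubic_disc hp hq hw; ring.
move: d0; rewrite dE expf_eq0 /= !mulf_eq0 !negb_or !subr_eq0.
by case/andP => /andP[-> ->] ->.
Qed.
End Cubic.

(** * The symmetric determinant generates its ideal *)

Section Determinant.
Variable R : comPzRingType.

Lemma det_mx2 (B : 'M[R]_2) : \det B = B 0 0 * B 1 1 - B 0 1 * B 1 0.
Proof.
rewrite (expand_det_row B ord0) 2!big_ord_recl big_ord0 /cofactor !det_mx11 !mxE /=.
have -> : 1 = lift ord0 ord0 :> 'I_2 by apply: val_inj.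
rewrite (_ : lift (lift ord0 ord0) 0 = ord0 :> 'I_2); last by apply: val_inj.
by rewrite expr0 expr1 addr0; ring.
Qed.

Lemma det_mx3 (A : 'M[R]_3) : \det A =
  A 0 0 * (A 1 1 * A 2 2 - A 1 2 * A 2 1)
  - A 0 1 * (A 1 0 * A 2 2 - A 1 2 * A 2 0)
  + A 0 2 * (A 1 0 * A 2 1 - A 1 1 * A 2 0).
Proof.
have E2 : 2 = lift ord0 (lift ord0 ord0) :> 'I_3 by apply: val_inj.
have E1 : 1 = lift ord0 ord0 :> 'I_3 by apply: val_inj.
rewrite (expand_det_row A ord0) 3!big_ord_recl big_ord0 /cofactor.
rewrite !det_mx2 !mxE /= addr0.
have -> : lift (lift ord0 (lift ord0 ord0)) 0 = 0 :> 'I_3 by apply: val_inj.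
have -> : lift (lift ord0 (lift ord0 ord0)) 1 = 1 :> 'I_3 by apply: val_inj.
have -> : lift (lift ord0 ord0) 0 = 0 :> 'I_3 by apply: val_inj.
have -> : lift (lift ord0 ord0) 1 = 2 :> 'I_3 by apply: val_inj.
have -> : lift ord0 0 = 1 :> 'I_3 by apply: val_inj.
have -> : lift ord0 1 = 2 :> 'I_3 by apply: val_inj.
rewrite -?E2 -?E1 (_ : ord0 = 0 :> 'I_3); last by apply: val_inj.
rewrite /bump /= addn0 !add0n !addn0 expr0 expr1 sqrrN expr1n.
by ring.
Qed.
End Determinant.

(** The symmetric matrix of linear forms whose determinant is [G]. *)
Definition sym_mx (R : pzRingType) (x : 'I_6 -> R) : 'M[R]_3 :=
  \matrix_(i < 3, j < 3)
    nth 0 (nth [::] [:: [:: 2 * x 0; - x 3; x 1 - 4 * x 5];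
                        [:: - x 3; x 1; x 4];
                        [:: x 1 - 4 * x 5; x 4; 2 * x 2]] i) j.

(** The determinant of [sym_mx x], expanded along the first row. *)
Definition det_form (R : pzRingType) (x : 'I_6 -> R) : R :=
  2 * x 0 * (2 * x 1 * x 2 - x 4 ^+ 2)
  + x 3 * (- (2 * x 2 * x 3) - x 4 * (x 1 - 4 * x 5))
  + (x 1 - 4 * x 5) * (- (x 3 * x 4) - x 1 * (x 1 - 4 * x 5)).

Lemma det_sym_mx (R : comPzRingType) (x : 'I_6 -> R) : \det (sym_mx x) = det_form x.
Proof. by rewrite det_mx3 !mxE /= /det_form; ring. Qed.

(** The cofactors of [sym_mx x], in the order (0,0), (0,1), (0,2), (1,1), (1,2),
    (2,2). *)
Definition cofactor_form (R : pzRingType) (x : 'I_6 -> R) : seq R :=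
  let y := x 1 - 4 * x 5 in
  [:: 2 * x 1 * x 2 - x 4 ^+ 2; 2 * x 2 * x 3 + x 4 * y; - (x 3 * x 4) - x 1 * y;
      4 * x 0 * x 2 - y ^+ 2; - (2 * x 0 * x 4 + x 3 * y); 2 * x 0 * x 1 - x 3 ^+ 2].

Lemma rmorph_cubic_disc (A B : comPzRingType) (f : {rmorphism A -> B}) p q w :
  f (cubic_disc p q w) = cubic_disc (f p) (f q) (f w).
Proof.
rewrite /cubic_disc !(rmorph_nat, rmorphB, rmorphD, rmorphM, rmorphXn) ?rmorph1; ring.
Qed.

Local Ltac meval_ring := rewrite !(mevalD, mevalM, mevalN, mevalXU, meval1); ring.

Section CubicPolynomial.
Variable K : numClosedFieldType.
Implicit Types (x : 'I_6 -> K).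

(** The determinant as a polynomial. *)
Definition Gpoly : {mpoly K[6]} := det_form (fun i => 'X_i).

Lemma Gpoly_eval x : Gpoly.@[x] = det_form x.
Proof.
rewrite /Gpoly /det_form.
by meval_ring.
Qed.

Let X (i : 'I_6) : {mpoly K[6]} := 'X_i.

(* The coefficients of - G as a monic cubic in [X_1]. *)
Let p2 : {mpoly K[6]} := - 8 * X 5.
Let p1 : {mpoly K[6]} := 16 * X 5 ^+ 2 - 4 * X 0 * X 2 + 2 * X 3 * X 4.
Let p0 : {mpoly K[6]} := 2 * X 0 * X 4 ^+ 2 + 2 * X 2 * X 3 ^+ 2 - 8 * X 3 * X 4 * X 5.

Lemma Gpoly_monic : Gpoly = - (X 1 ^+ 3 + p2 * X 1 ^+ 2 + p1 * X 1 + p0).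
Proof. by rewrite /Gpoly /det_form /p0 /p1 /p2 /X; ring. Qed.

Let p2_eval x : p2.@[x] = - 8 * x 5.
Proof. by rewrite /p2 /X; meval_ring. Qed.

Let p1_eval x : p1.@[x] = 16 * x 5 ^+ 2 - 4 * x 0 * x 2 + 2 * x 3 * x 4.
Proof. by rewrite /p1 /X; meval_ring. Qed.

Let p0_eval x : p0.@[x] = 2 * x 0 * x 4 ^+ 2 + 2 * x 2 * x 3 ^+ 2 - 8 * x 3 * x 4 * x 5.
Proof. by rewrite /p0 /X; meval_ring. Qed.

Let disc : {mpoly K[6]} := cubic_disc p2 p1 p0.

Let disc_eval x : disc.@[x] = cubic_disc p2.@[x] p1.@[x] p0.@[x].
Proof. exact: rmorph_cubic_disc. Qed.

Let disc_neq0 : disc != 0.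
Proof.
(* At x_0 = x_2 = 1 and x_3 = x_4 = x_5 = 0 the cubic is t^3 - 4 t. *)
apply/eqP => d0; pose x (i : 'I_6) : K := if (i == 0) || (i == 2) then 1 else 0.
have := disc_eval x; rewrite d0 meval0 p2_eval p1_eval p0_eval /x /=.
have -> : cubic_disc (- 8 * 0) (16 * 0 ^+ 2 - 4 * 1 * 1 + 2 * 0 * 0)
   (2 * 1 * 0 ^+ 2 + 2 * 1 * 0 ^+ 2 - 8 * 0 * 0 * 0) = 256%:R :> K.
  by rewrite /cubic_disc; ring.
by move/esym/eqP; rewrite pnatr_eq0.
Qed.

Let g : {poly {mpoly K[6]}} := cubic_poly p2 p1 p0.

(** The equation generates the ideal of the cubic hypersurface. *)
Lemma Gpoly_ideal (H : {mpoly K[6]}) :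
  (forall v : 'rV[K]_6, v != 0 -> Gpoly.@[v 0] = 0 -> H.@[v 0] = 0) -> exists Q, H = Q * Gpoly.
Proof.
move=> H0; have [] := @monic_dvd _ _ 1 g disc H (cubic_poly_monic p2 p1 p0) disc_neq0; last first.
  move=> Q HQ; exists (- Q); rewrite HQ mulNr -mulrN; congr (_ * _).
  by rewrite Gpoly_monic opprK horner_cubic_poly.
move=> x dx; move: (dx); rewrite disc_eval => /cubic_roots[rs [Urs srs] rsP].
exists rs; first by rewrite size_cubic_poly srs.
move=> t /rsP tP; split.
  by rewrite rootE map_cubic_poly horner_cubic_poly; apply/eqP.
pose v : 'rV[K]_6 := \row_i update 1 x t i.
have vE : v 0 =1 update 1 x t by move=> i; rewrite mxE.
rewrite -(meval_eq _ vE); apply: H0.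
  apply: contraNneq dx => v0.
  have x0 (i : 'I_6) : i != 1 -> x i = 0.
    by move=> i1; have := vE i; rewrite v0 mxE /update (negbTE i1).
  by rewrite disc_eval p2_eval p1_eval p0_eval !x0 // /cubic_disc; apply/eqP; ring.
rewrite (meval_eq _ vE) Gpoly_eval -[RHS]oppr0 -tP p2_eval p1_eval p0_eval.
by rewrite /det_form /update /=; ring.
Qed.
End CubicPolynomial.

(** * Symmetric matrices of rank one *)

Lemma mderiv1 (A : nzRingType) n (i : 'I_n) : (1 : {mpoly A[n]})^`M(i) = 0.
Proof. by rewrite -mpolyC1 mderivC. Qed.

Lemma mderivXU (A : nzRingType) n (i j : 'I_n) : ('X_j : {mpoly A[n]})^`M(i) = (j == i)%:R.
Proof.
rewrite mderivX mnm1E; case: eqP => [->|_]; last by rewrite scale0r.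
by rewrite scale1r (_ : (U_(i) - U_(i))%MM = 0%MM) ?mpolyX0 //; apply/mnmP => k;
  rewrite mnmBE subnn mnm0E.
Qed.

Lemma eq_of_multiple (A : pzRingType) (a b e c : A) : e = 0 -> a - b = c * e -> a = b.
Proof. by move=> ->; rewrite mulr0 => /eqP; rewrite subr_eq0 => /eqP. Qed.

Section RankOne.
Variable K : numClosedFieldType.
Implicit Types (x : 'rV[K]_6) (v : 'rV[K]_3).

(** The partial derivatives of [G], in terms of the cofactors. *)
Definition gradient_form (x : 'I_6 -> K) : seq K :=
  let c := cofactor_form x in
  [:: 2 * c`_0; c`_3 + 2 * c`_2; 2 * c`_5; - 2 * c`_1; 2 * c`_4; - 8 * c`_2].

Lemma Gpoly_deriv (x : 'I_6 -> K) i : ((Gpoly K)^`M(i)).@[x] = (gradient_form x)`_i.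
Proof.
rewrite /Gpoly /det_form !expr2.
rewrite !(mderivD, mderivN, mderivM, mderiv1, mderivXU).
rewrite !(mevalD, mevalN, mevalM, mevalXU, meval1, meval0, mevalMn).
by case: i => [[|[|[|[|[|[|?]]]]]] ?] //=; rewrite /gradient_form /cofactor_form /=; ring.
Qed.

(** The matrix with coordinates [x] has rank at most one: its cofactors vanish. *)
Definition rank_le1 x : Prop := forall i : 'I_6, (cofactor_form (x 0))`_i = 0.

Lemma gradient_rank_le1 x :
  (forall i : 'I_6, ((Gpoly K)^`M(i)).@[x 0] = 0) <-> rank_le1 x.
Proof.
have two : (2 : K) != 0 by rewrite pnatr_eq0.
have eight : (-8 : K) != 0 by rewrite oppr_eq0 pnatr_eq0.
split=> [g0|c0 i].
  have g i : (gradient_form (x 0))`_(i : 'I_6) = 0 by rewrite -Gpoly_deriv.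
  have c2 : (cofactor_form (x 0))`_2 = 0 by apply: (mulfI eight); rewrite mulr0; exact: (g 5).
  case=> [[|[|[|[|[|[|?]]]]]] ?] //.
  - by apply: (mulfI two); rewrite mulr0; exact: (g 0).
  - have /eqP := g 3; rewrite /= mulNr oppr_eq0 mulf_eq0 (negbTE two) => /eqP //.
  - by have := g 1; rewrite [X in X = 0 -> _]/= -[X in _ + 2 * X]/((cofactor_form (x 0))`_2) c2 mulr0 addr0.
  - by apply: (mulfI two); rewrite mulr0; exact: (g 4).
  - by apply: (mulfI two); rewrite mulr0; exact: (g 2).
rewrite Gpoly_deriv /gradient_form.
have {}c0 k (k6 : (k < 6)%N) : (cofactor_form (x 0))`_k = 0 by apply: (c0 (Ordinal k6)).
move: (cofactor_form (x 0)) c0 => s s0.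
by case: i => [[|[|[|[|[|[|?]]]]]] ?] //=; rewrite !s0 // ?(mulr0, addr0).
Qed.

Lemma rank_le1_det x : rank_le1 x -> (Gpoly K).@[x 0] = 0.
Proof.
move=> c0; rewrite Gpoly_eval.
have -> : det_form (x 0) = 2 * x 0 0 * (cofactor_form (x 0))`_0
   - x 0 3 * (cofactor_form (x 0))`_1 + (x 0 1 - 4 * x 0 5) * (cofactor_form (x 0))`_2.
  by rewrite /det_form /cofactor_form /=; ring.
by rewrite (c0 0) (c0 1) (c0 2) !mulr0 subr0 addr0.
Qed.

(** The parametrization of the Veronese surface by the points (s : t : u). *)
Definition nu v : 'rV[K]_6 :=
  let s := v 0 0 in let t := v 0 1 in let u := v 0 2 in
  row_of 6 [:: s ^+ 2; 2 * u ^+ 2; t ^+ 2; - 2 * u * s; 2 * u * t;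
               2^-1 * (- s * t + u ^+ 2)].

Lemma row6P (x y : 'rV[K]_6) : x 0 0 = y 0 0 -> x 0 1 = y 0 1 -> x 0 2 = y 0 2 ->
  x 0 3 = y 0 3 -> x 0 4 = y 0 4 -> x 0 5 = y 0 5 -> x = y.
Proof.
move=> e0 e1 e2 e3 e4 e5; apply/rowP; case=> [[|[|[|[|[|[|?]]]]]] i6] //.
- by rewrite (_ : Ordinal i6 = 0) //; apply: val_inj.
- by rewrite (_ : Ordinal i6 = 1) //; apply: val_inj.
- by rewrite (_ : Ordinal i6 = 2) //; apply: val_inj.
- by rewrite (_ : Ordinal i6 = 3) //; apply: val_inj.
- by rewrite (_ : Ordinal i6 = 4) //; apply: val_inj.
- by rewrite (_ : Ordinal i6 = 5) //; apply: val_inj.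
Qed.

Lemma row3P (v w : 'rV[K]_3) : v 0 0 = w 0 0 -> v 0 1 = w 0 1 -> v 0 2 = w 0 2 -> v = w.
Proof.
move=> e0 e1 e2; apply/rowP; case=> [[|[|[|?]]] i3] //.
- by rewrite (_ : Ordinal i3 = 0) //; apply: val_inj.
- by rewrite (_ : Ordinal i3 = 1) //; apply: val_inj.
- by rewrite (_ : Ordinal i3 = 2) //; apply: val_inj.
Qed.

Lemma row_ofE n (s : seq K) (i : 'I_n) : row_of n s 0 i = s`_i.
Proof. by rewrite mxE. Qed.

Lemma nu_neq0 v : v != 0 -> nu v != 0.
Proof.
apply: contraNneq => nu0; apply/eqP.
have n i : nu v 0 i = 0 by rewrite nu0 mxE.
have := (n 0, n 1, n 2); rewrite !row_ofE /= => -[[s0 u0] t0].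
have two : (2 : K) != 0 by rewrite pnatr_eq0.
apply: row3P; rewrite mxE.
- by apply/eqP; move/eqP: s0; rewrite sqrf_eq0.
- by apply/eqP; move/eqP: t0; rewrite sqrf_eq0.
- by apply/eqP; move/eqP: u0; rewrite mulf_eq0 (negbTE two) sqrf_eq0.
Qed.

Lemma nu_rank_le1 c v : rank_le1 (c *: nu v).
Proof.
have two : (2 : K) != 0 by rewrite pnatr_eq0.
by case=> [[|[|[|[|[|[|?]]]]]] ?] //=; rewrite !mxE /=; field.
Qed.

(** The rows of [sym_mx x]; their last two entries are exchanged, since the matrix
    of [nu (s, t, u)] is 2 w^T w for w = (s, u, t). *)
Definition pick_row (k : nat) x : 'rV[K]_3 :=
  let y := x 0 1 - 4 * x 0 5 in
  row_of 3 (nth [::] [:: [:: 2 * x 0 0; y; - x 0 3]; [:: - x 0 3; x 0 4; x 0 1];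
                         [:: y; 2 * x 0 2; x 0 4]] k).
(** The diagonal entries of [sym_mx x]. *)
Definition diag_entry (k : nat) x : K := nth 0 [:: 2 * x 0 0; x 0 1; 2 * x 0 2] k.

(** A rank one matrix is determined by any of its rows with nonzero diagonal entry. *)
Lemma pick_row_nu k x : (k < 3)%N -> rank_le1 x ->
  (2 * diag_entry k x) *: x = nu (pick_row k x).
Proof.
move=> k3 c0; have two : (2 : K) != 0 by rewrite pnatr_eq0.
have := (c0 0, c0 1, c0 2, c0 3, c0 4, c0 5); rewrite /cofactor_form /=.
case=> [] [] [] [] [] h0 h1 h2 h3 h4 h5.
case: k k3 => [|[|[|]]] //= _; apply: row6P; rewrite !mxE /=.
- by rewrite /diag_entry /=; ring.
- by apply: (eq_of_multiple h5 (c := 2)); rewrite /diag_entry /=; field.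
- by apply: (eq_of_multiple h3 (c := 1)); rewrite /diag_entry /=; field.
- by rewrite /diag_entry /=; ring.
- by apply: (eq_of_multiple h4 (c := (-2))); rewrite /diag_entry /=; field.
- by apply: (eq_of_multiple h5 (c := 2^-1)); rewrite /diag_entry /=; field.
- by apply: (eq_of_multiple h5 (c := 1)); rewrite /diag_entry /=; field.
- by rewrite /diag_entry /=; ring.
- by apply: (eq_of_multiple h0 (c := 1)); rewrite /diag_entry /=; field.
- by rewrite /diag_entry /=; ring.
- by rewrite /diag_entry /=; ring.
- by apply: (eq_of_multiple h2 (c := 2^-1)); rewrite /diag_entry /=; field.
- by apply: (eq_of_multiple h3 (c := 1)); rewrite /diag_entry /=; field.
- by apply: (eq_of_multiple h0 (c := 2)); rewrite /diag_entry /=; field.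
- by rewrite /diag_entry /=; ring.
- by apply: (eq_of_multiple h1 (c := 2)); rewrite /diag_entry /=; field.
- by rewrite /diag_entry /=; ring.
- by apply: (eq_of_multiple h0 (c := 2^-1)); rewrite /diag_entry /=; field.
Qed.

Lemma diag_entry_neq0 x : x != 0 -> rank_le1 x ->
  exists2 k, (k < 3)%N & diag_entry k x != 0.
Proof.
move=> x0 c0; have two : (2 : K) != 0 by rewrite pnatr_eq0.
have four : (4 : K) != 0 by rewrite pnatr_eq0.
have := (c0 0, c0 1, c0 2, c0 3, c0 4, c0 5); rewrite /cofactor_form /=.
case=> [] [] [] [] [] h0 h1 h2 h3 h4 h5.
have [d0|d0] := eqVneq (diag_entry 0 x) 0; last by exists 0%N.
have [d1|d1] := eqVneq (diag_entry 1 x) 0; last by exists 1%N.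
have [d2|d2] := eqVneq (diag_entry 2 x) 0; last by exists 2%N.
case/eqP: x0; move: d0 d1 d2; rewrite /diag_entry /= => d0 d1 d2.
have z0 : x 0 0 = 0 by apply/eqP; move/eqP: d0; rewrite mulf_eq0 (negbTE two).
have z2 : x 0 2 = 0 by apply/eqP; move/eqP: d2; rewrite mulf_eq0 (negbTE two).
rewrite z0 d1 z2 in h0 h3 h5.
have z3 : x 0 3 = 0.
  by apply/eqP; move/eqP: h5; rewrite !mulr0 sub0r oppr_eq0 sqrf_eq0.
have z4 : x 0 4 = 0.
  by apply/eqP; move/eqP: h0; rewrite !mulr0 sub0r oppr_eq0 sqrf_eq0.
have z5 : x 0 5 = 0.
  apply/eqP; move/eqP: h3; rewrite !mulr0 !sub0r oppr_eq0 sqrf_eq0 oppr_eq0.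
  by rewrite mulf_eq0 (negbTE four).
by apply: row6P; rewrite mxE.
Qed.

Lemma pick_row_neq0 k x : (k < 3)%N -> diag_entry k x != 0 -> pick_row k x != 0.
Proof.
case: k => [|[|[|]]] //= _; rewrite /diag_entry /=; apply: contraNneq => r0.
- have : pick_row 0 x 0 0 = 0 by rewrite r0 mxE.
  by rewrite row_ofE /= => ->.
- have : pick_row 1 x 0 2 = 0 by rewrite r0 mxE.
  by rewrite row_ofE /= => ->.
- have : pick_row 2 x 0 1 = 0 by rewrite r0 mxE.
  by rewrite row_ofE /= => ->.
Qed.

(** The symmetric matrices of rank one are the points of the Veronese surface. *)
Lemma rank_one_nu x : x != 0 /\ rank_le1 x <->
  exists2 v, v != 0 & exists2 c, c != 0 & x = c *: nu v.
Proof.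
have two : (2 : K) != 0 by rewrite pnatr_eq0.
split=> [[x0 c0]|[v v0 [c c0 ->]]].
  have [k k3 dk] := diag_entry_neq0 x0 c0; exists (pick_row k x).
    exact: pick_row_neq0.
  exists (2 * diag_entry k x)^-1; first by rewrite invr_neq0 ?mulf_neq0.
  by rewrite -pick_row_nu // scalerA mulVf ?scale1r ?mulf_neq0.
by split; [rewrite scaler_eq0 negb_or c0 nu_neq0 | apply: nu_rank_le1].
Qed.

End RankOne.

(** * Symmetric matrices of rank two *)

Section Polar.
Variable K : numClosedFieldType.
Implicit Types (x : 'rV[K]_6) (p q v w : 'rV[K]_3).

Let two_neq0 : (2 : K) != 0. Proof. by rewrite pnatr_eq0. Qed.
Let four_neq0 : (4 : K) != 0. Proof. by rewrite pnatr_eq0. Qed.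

(** The polarization of [nu]: the coordinates of the matrix [p^T q + q^T p], where
    the vectors are written in the order (s, u, t). *)
Definition polar p q : 'rV[K]_6 :=
  let s := p 0 0 in let t := p 0 1 in let u := p 0 2 in
  let s' := q 0 0 in let t' := q 0 1 in let u' := q 0 2 in
  row_of 6 [:: s * s'; 2 * u * u'; t * t'; - (s * u' + u * s'); u * t' + t * u';
               4^-1 * (2 * u * u' - s * t' - t * s')].

Lemma polar_nu v : polar v v = nu v.
Proof. by apply: row6P; rewrite !mxE /=; field. Qed.

Lemma polarC p q : polar p q = polar q p.
Proof. by apply: row6P; rewrite !mxE /=; field. Qed.

Lemma polarDl p p' q : polar (p + p') q = polar p q + polar p' q.
Proof. by apply: row6P; rewrite !mxE /=; field. Qed.

Lemma polarZl c p q : polar (c *: p) q = c *: polar p q.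
Proof. by apply: row6P; rewrite !mxE /=; field. Qed.

Lemma polarDr p q q' : polar p (q + q') = polar p q + polar p q'.
Proof. by rewrite polarC polarDl !(polarC p). Qed.

Lemma polarZr c p q : polar p (c *: q) = c *: polar p q.
Proof. by rewrite polarC polarZl (polarC p). Qed.

Lemma polar_span a b c d p q : polar (a *: p + b *: q) (c *: p + d *: q)
  = (a * c) *: nu p + (a * d + b * c) *: polar p q + (b * d) *: nu q.
Proof.
rewrite polarDl !polarDr !polarZl !polarZr !polar_nu (polarC q p) !scalerA.
by rewrite scalerDl -!addrA.
Qed.

Lemma nu_polar_sub r l : nu r - nu l = polar (r - l) (r + l).
Proof.
by rewrite -scaleN1r -[r in r + _]scale1r -[l in _ + l]scale1r -[r in r + _]scale1r
  -[l in polar _ (_ + l)]scale1r -polar_nu -polar_nu; apply: row6P; rewrite !mxE /=; field.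
Qed.

(** A degenerate binary quadratic form is minus the square of a linear form. *)
Lemma binary_square (a b c : K) : a * c = b ^+ 2 ->
  exists l m, [/\ l ^+ 2 = - a, l * m = - b & m ^+ 2 = - c].
Proof.
move=> abc; pose l := sqrtC (- a); have l2 : l ^+ 2 = - a by rewrite sqrtCK.
have [a0|a0] := eqVneq a 0.
  exists 0, (sqrtC (- c)); rewrite sqrtCK a0 oppr0 expr0n mul0r; split=> //.
  by apply/esym/eqP; rewrite oppr_eq0 -sqrf_eq0 -abc a0 mul0r.
have l0 : l != 0 by rewrite -sqrf_eq0 l2 oppr_eq0.
exists l, (- b / l); split=> //; first by rewrite mulrCA mulfV ?mulr1.
by rewrite expr_div_n l2 sqrrN -abc; field.
Qed.

(** A degenerate ternary quadratic form is a product of two linear forms. *)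
Lemma det0_polar x : (Gpoly K).@[x 0] = 0 -> exists p q, x = polar p q.
Proof.
rewrite Gpoly_eval => x0.
have main k l : (k < 3)%N -> diag_entry k x != 0 ->
    (2 * diag_entry k x) *: x = nu (pick_row k x) - nu l -> exists p q, x = polar p q.
  move=> k3 dk; rewrite nu_polar_sub => xE.
  exists ((2 * diag_entry k x)^-1 *: (pick_row k x - l)), (pick_row k x + l).
  by rewrite polarZl -xE scalerA mulVf ?scale1r ?mulf_neq0.
set y := x 0 1 - 4 * x 0 5.
have [d0|d0] := eqVneq (diag_entry 0 x) 0; last first.
  have [|l [m [l2 lm m2]]] := @binary_square (2 * x 0 0 * x 0 1 - x 0 3 ^+ 2)
    (2 * x 0 0 * x 0 4 + x 0 3 * y) (4 * x 0 0 * x 0 2 - y ^+ 2).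
    by apply: (eq_of_multiple x0 (c := 2 * x 0 0)); rewrite /det_form /y; ring.
  (* Completing the square with respect to a nonzero diagonal entry leaves a
     degenerate form in two variables. *)
  apply: (main 0%N (row_of 3 [:: 0; m; l])) => //.
  apply: row6P; rewrite !mxE /= ?l2 ?m2 /diag_entry /= -?[_ * l * m]mulrA ?lm /y;
    by [ring | field].
have [d1|d1] := eqVneq (diag_entry 1 x) 0; last first.
  have [|l [m [l2 lm m2]]] := @binary_square (2 * x 0 0 * x 0 1 - x 0 3 ^+ 2)
    (x 0 1 * y + x 0 3 * x 0 4) (2 * x 0 1 * x 0 2 - x 0 4 ^+ 2).
    by apply: (eq_of_multiple x0 (c := x 0 1)); rewrite /det_form /y; ring.
  apply: (main 1%N (row_of 3 [:: l; m; 0])) => //.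
  apply: row6P; rewrite !mxE /= ?l2 ?m2 /diag_entry /= ?mulNr ?lm /y;
    by [ring | field].
have [d2|d2] := eqVneq (diag_entry 2 x) 0; last first.
  have [|l [m [l2 lm m2]]] := @binary_square (4 * x 0 0 * x 0 2 - y ^+ 2)
    (- (2 * x 0 2 * x 0 3) - x 0 4 * y) (2 * x 0 1 * x 0 2 - x 0 4 ^+ 2).
    by apply: (eq_of_multiple x0 (c := 2 * x 0 2)); rewrite /det_form /y; ring.
  apply: (main 2%N (row_of 3 [:: l; 0; m])) => //.
  apply: row6P; rewrite !mxE /= ?l2 ?m2 /diag_entry /= -?[_ * m * l]mulrA ?[m * l]mulrC ?lm /y;
    by [ring | field].
have z0 : x 0 0 = 0 by apply/eqP; move/eqP: d0; rewrite /diag_entry /= mulf_eq0 (negbTE two_neq0).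
have z2 : x 0 2 = 0 by apply/eqP; move/eqP: d2; rewrite /diag_entry /= mulf_eq0 (negbTE two_neq0).
have z1 : x 0 1 = 0 by [].
have : x 0 3 * (x 0 4 * x 0 5) = 0.
  apply: (mulfI two_neq0); apply: (mulfI four_neq0); rewrite !mulr0 -x0 /det_form z0 z1 z2.
  ring.
move/eqP; rewrite !mulf_eq0 => /orP[/eqP z3|/orP[/eqP z4|/eqP z5]].
- exists (row_of 3 [:: 0; 1; 0]), (row_of 3 [:: -4 * x 0 5; 0; x 0 4]).
  by apply: row6P; rewrite !mxE /= ?z0 ?z1 ?z2 ?z3; field.
- exists (row_of 3 [:: 1; 0; 0]), (row_of 3 [:: 0; -4 * x 0 5; - x 0 3]).
  by apply: row6P; rewrite !mxE /= ?z0 ?z1 ?z2 ?z4; field.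
- exists (row_of 3 [:: 0; 0; 1]), (row_of 3 [:: - x 0 3; x 0 4; 0]).
  by apply: row6P; rewrite !mxE /= ?z0 ?z1 ?z2 ?z5; field.
Qed.
End Polar.

(** * Density of the planes and secants of the Veronese surface *)

Section Density.
Variable K : numClosedFieldType.
Implicit Types (x : 'rV[K]_6) (p q w : 'rV[K]_3) (v : 'cV[K]_2).

Let two_neq0 : (2 : K) != 0. Proof. by rewrite pnatr_eq0. Qed.

(** The square of [v] in [Sym^2 K^2], as a point [(s : t : u)]. *)
Definition sqv v : 'rV[K]_3 :=
  let a := v 0 0 in let b := v 1 0 in row_of 3 [:: a ^+ 2; - b ^+ 2; - (a * b)].

(** The determinant of two vectors of the plane. *)
Definition det2 v v' : K := v 0 0 * v' 1 0 - v' 0 0 * v 1 0.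

(** The points of the plane of the pair [v], [v'], in the coordinates given by the
    squares of the two and their product. *)
Definition plane_point v v' (c0 c1 c2 : K) : 'rV[K]_6 :=
  c0 *: nu (sqv v) + c1 *: polar (sqv v) (sqv v') + c2 *: nu (sqv v').

(** The quadratic form on [Sym^2 K^2] vanishing on squares, and twice its
    polarization. *)
Definition qf (A : pzRingType) (s t u : A) : A := u ^+ 2 + s * t.
Definition bf (A : pzRingType) (s t u s' t' u' : A) : A := 2 * u * u' + s * t' + t * s'.

(** The same forms on the coordinates of vectors. *)
Definition qfr w := qf (w 0 0) (w 0 1) (w 0 2).
Definition bfr w w' := bf (w 0 0) (w 0 1) (w 0 2) (w' 0 0) (w' 0 1) (w' 0 2).

(** The discriminant of [qf] on the line through [p] and [q], which vanishes when
    the line is tangent to the conic of squares. *)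
Definition pencil_disc p q := bfr p q ^+ 2 - 4 * qfr p * qfr q.

(** The isotropic vectors are the multiples of squares. *)
Lemma isotropic_sqv w : w != 0 -> qfr w = 0 ->
  exists v, exists2 k, k != 0 & w = k *: sqv v.
Proof.
rewrite /qfr /qf => w0 q0; have [s0|s0] := eqVneq (w 0 0) 0.
  have u0 : w 0 2 = 0 by apply/eqP; move/eqP: q0; rewrite s0 mul0r addr0 sqrf_eq0.
  exists (\col_i (i == 1)%:R), (- w 0 1).
    rewrite oppr_eq0; apply: contraNneq w0 => t0; apply/eqP.
    by apply: row3P; rewrite mxE.
  by apply: row3P; rewrite !mxE /= ?s0 ?u0; ring.
exists (\col_i nth 0 [:: w 0 0; - w 0 2] i), (w 0 0)^-1; first by rewrite invr_eq0.
have t0 : w 0 2 ^+ 2 = - (w 0 0 * w 0 1) by apply/eqP; rewrite -addr_eq0 q0.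
by apply: row3P; rewrite !mxE /= ?sqrrN ?t0; field.
Qed.

Lemma bfr_sqv v v' : 2 * bfr (sqv v) (sqv v') = - 2 * det2 v v' ^+ 2.
Proof. by rewrite /bfr /bf /det2 !mxE /=; ring. Qed.

(** Two points spanning a generic pencil lie in the plane of a pair of squares. *)
Lemma generic_pencil p q : qfr q != 0 -> pencil_disc p q != 0 ->
  exists v v', det2 v v' != 0 /\ exists a b c d,
    p = a *: sqv v + b *: sqv v' /\ q = c *: sqv v + d *: sqv v'.
Proof.
move=> q0 d0; pose dl := sqrtC (pencil_disc p q).
have dl2 : dl ^+ 2 = pencil_disc p q by rewrite sqrtCK.
have dl0 : dl != 0 by rewrite -sqrf_eq0 dl2.
(* The squares on the line are its points [p + z e *: q] with [e] = 1 or -1. *)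
pose z (e : K) := (- bfr p q + e * dl) / (2 * qfr q).
have zq e : e ^+ 2 = 1 -> qfr p + z e * bfr p q + z e ^+ 2 * qfr q = 0.
  move=> e2; have -> : z e ^+ 2 = (bfr p q ^+ 2 - 2 * e * dl * bfr p q + pencil_disc p q) / (4 * qfr q ^+ 2).
    have <- : (e * dl) ^+ 2 = pencil_disc p q by rewrite exprMn e2 mul1r.
    by rewrite /z; field; rewrite q0.
  by rewrite /z /pencil_disc; field; rewrite q0.
have wq e : e ^+ 2 = 1 -> qfr (p + z e *: q) = 0.
  move/zq => <-; rewrite /qfr /bfr /qf /bf !mxE; ring.
have zd : z 1 - z (-1) = dl / qfr q by rewrite /z; field; rewrite q0.
have zd0 : z 1 - z (-1) != 0 by rewrite zd mulf_neq0 ?invr_eq0.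
have bw : bfr (p + z 1 *: q) (p + z (-1) *: q) != 0.
  have -> : bfr (p + z 1 *: q) (p + z (-1) *: q)
     = 2 * qfr p + (z 1 + z (-1)) * bfr p q + 2 * z 1 * z (-1) * qfr q.
    by rewrite /qfr /bfr /qf /bf !mxE; ring.
  have -> : z 1 + z (-1) = - bfr p q / qfr q by rewrite /z; field; rewrite q0.
  have -> : 2 * z 1 * z (-1) * qfr q = (bfr p q ^+ 2 - pencil_disc p q) / (2 * qfr q).
    by rewrite -dl2 /z; field; rewrite q0.
  rewrite (_ : _ + _ = - pencil_disc p q / qfr q).
    by rewrite mulf_neq0 ?oppr_eq0 ?invr_eq0.
  by rewrite /pencil_disc; field; rewrite q0.
have wn0 : p + z 1 *: q != 0.
  by apply: contraNneq bw => ->; rewrite /bfr /bf !mxE; apply/eqP; ring.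
have wn1 : p + z (-1) *: q != 0.
  by apply: contraNneq bw => ->; rewrite /bfr /bf !mxE; apply/eqP; ring.
have [v [k k0 wv]] := isotropic_sqv wn0 (wq 1 (expr1n _ _)).
have [v' [k' k0' wv']] := isotropic_sqv wn1 (wq (-1) (sqrr_sign _ 1)).
exists v, v'; split.
  have : k * k' * (2 * bfr (sqv v) (sqv v')) != 0.
    have -> : k * k' * (2 * bfr (sqv v) (sqv v')) = 2 * bfr (k *: sqv v) (k' *: sqv v').
      by rewrite /bfr /bf !mxE; ring.
    by rewrite -wv -wv'; apply: mulf_neq0 two_neq0 bw.
  by rewrite bfr_sqv; apply: contraNneq => ->; rewrite expr0n mulr0 mulr0.
pose D := z 1 - z (-1).
have qE : q = (k / D) *: sqv v + (- k' / D) *: sqv v'.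
  rewrite [k / D]mulrC [- k' / D]mulrC -!scalerA scaleNr -wv -wv' -scalerDr.
  by rewrite opprD addrACA subrr add0r -scalerBl scalerA mulVf ?scale1r.
exists (k - z 1 * (k / D)), (z 1 * (k' / D)), (k / D), (- k' / D); split=> //.
have {1}-> : p = (p + z 1 *: q) - z 1 *: q by rewrite addrK.
rewrite wv {1}qE scalerDr !scalerA scalerBl mulNr mulrN scaleNr opprD opprK addrA.
by [].
Qed.

Lemma polar_neq0 p q : pencil_disc p q != 0 -> polar p q != 0.
Proof.
apply: contraNneq => pq0; apply/eqP; pose x := polar p q.
have four : (4 : K) != 0 by rewrite pnatr_eq0.
have -> : pencil_disc p q = (2 * x 0 1 - 4 * x 0 5) ^+ 2 - 4 * (x 0 1 ^+ 2 / 4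
   - x 0 3 * x 0 4 - x 0 1 * (x 0 1 - 4 * x 0 5) / 2 + x 0 0 * x 0 2).
  by rewrite /x /pencil_disc /bfr /bf /qfr /qf !mxE /=; field.
by rewrite /x pq0 !mxE; field.
Qed.

(** The polynomial c + d X. *)
Definition offset (c d : K) : {poly K} := c%:P + d *: 'X.

(** The points of the planes of pairs of squares are dense in [det = 0]. *)
Lemma planes_dense (H : {mpoly K[6]}) :
  (forall x v v' c0 c1 c2, det2 v v' != 0 -> x = plane_point v v' c0 c1 c2 -> x != 0 ->
     H.@[x 0] = 0) ->
  forall p q, polar p q != 0 -> H.@[polar p q 0] = 0.
Proof.
move=> H0 p q pq0.
(* The line through [p + e p'] and [q + e q'] is in general position for all but
   finitely many [e]. *)
pose p' : 'rV[K]_3 := row_of 3 [:: 1; 1; 0]; pose q' : 'rV[K]_3 := row_of 3 [:: 0; 0; 1].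
pose pe e := p + e *: p'; pose qe e := q + e *: q'.
pose x1 := polar p q' + polar p' q; pose x2 := polar p' q'.
have xe e : polar (pe e) (qe e) = polar p q + e *: x1 + e ^+ 2 *: x2.
  rewrite /pe /qe polarDl !polarDr !polarZl !polarZr scalerA /x1 scalerDr.
  by rewrite -expr2 !addrA.
pose X i : {poly K} := (polar p q 0 i)%:P + (x1 0 i *: 'X + x2 0 i *: 'X^2).
pose h : {poly K} := mmap (@polyC K) X H.
have hE e : h.[e] = H.@[polar (pe e) (qe e) 0].
  rewrite /h /mmap horner_sum mevalE; apply: eq_bigr => m _.
  rewrite hornerM hornerC; congr (_ * _).
  rewrite /mmap1 horner_prod; apply: eq_bigr => i _; rewrite horner_exp; congr (_ ^+ _).
  have addE (a b : 'rV[K]_6) : (a + b) 0 i = a 0 i + b 0 i by rewrite mxE.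
  have scaleE c (a : 'rV[K]_6) : (c *: a) 0 i = c * a 0 i by rewrite mxE.
  rewrite xe !addE !scaleE !(hornerD, hornerC, hornerZ, hornerX, hornerXn).
  by ring.
pose De e := qfr (qe e) * pencil_disc (pe e) (qe e).
pose D : {poly K} :=
  let s := offset (p 0 0) 1 in let t := offset (p 0 1) 1 in let u := offset (p 0 2) 0 in
  let s' := offset (q 0 0) 0 in let t' := offset (q 0 1) 0 in let u' := offset (q 0 2) 1 in
  qf s' t' u' * (bf s t u s' t' u' ^+ 2 - 4%:P * qf s t u * qf s' t' u').
have DE e : D.[e] = De e.
  rewrite /D /De /pencil_disc /qfr /bfr /qf /bf /pe /qe.
  rewrite !(hornerM, hornerD, hornerN, hornerC, hornerZ, hornerX, horner_exp) !mxE /=.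
  by ring.
have D0 : D != 0.
  (* [D] has degree 6 and leading coefficient -4; its sixth difference is
     -4 * 6! = -2880. *)
  apply/eqP => D0; have De0 e : De e = 0 by rewrite -DE D0 horner0.
  have : De 6 - 6 * De 5 + 15 * De 4 - 20 * De 3 + 15 * De 2 - 6 * De 1 + De 0 = - 2880%:R.
    rewrite /De /pencil_disc /qfr /bfr /qf /bf /pe /qe !mxE /=.
    move: (p 0 0) (p 0 1) (p 0 2) (q 0 0) (q 0 1) (q 0 2) => *; ring.
  rewrite !De0 !mulr0 !(subr0, addr0) => /esym/eqP.
  by rewrite oppr_eq0 pnatr_eq0.
have hD : h * D = 0.
  apply: poly_eq0_everywhere => e; rewrite hornerM.
  have [->|] := eqVneq D.[e] 0; first by rewrite mulr0.
  rewrite DE /De mulf_eq0 negb_or => /andP[q0 d0].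
  have [v [v' [dv [a [b [c [d [pE qE]]]]]]]] := generic_pencil q0 d0.
  rewrite hE (H0 _ v v' (a * c) (a * d + b * c) (b * d)) ?mul0r ?polar_neq0 //.
  by rewrite [in LHS]pE [in LHS]qE polar_span.
have h0 : h = 0 by apply/eqP; move/eqP: hD; rewrite mulf_eq0 (negbTE D0) orbF.
by have := hE 0; rewrite h0 horner0 /pe /qe !scale0r !addr0.
Qed.

End Density.

Section Secants.
Variable K : numClosedFieldType.
Implicit Types (v w p q : 'rV[K]_3).

Lemma polar_nu_sub p q : polar p q = 4^-1 *: nu (p + q) + - 4^-1 *: nu (p - q).
Proof.
have four : (4 : K) != 0 by rewrite pnatr_eq0.
by apply: row6P; rewrite !mxE /=; field.
Qed.

(** Every point of [det = 0] lies on a secant line of the Veronese surface. *)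
Lemma polar_secant p q : polar p q != 0 -> exists v w, exists a b : K,
  [/\ v != 0, w != 0, (forall c, nu v <> c *: nu w)
    & polar p q = a *: nu v + b *: nu w].
Proof.
have nu0 : nu (0 : 'rV[K]_3) = 0 by apply: row6P; rewrite !mxE /=; ring.
have single w d : d *: nu w != 0 -> polar p q = d *: nu w ->
    exists v w, exists a b : K, [/\ v != 0, w != 0, (forall c, nu v <> c *: nu w)
      & polar p q = a *: nu v + b *: nu w].
  move=> dw0 pqE; have w0 : w != 0.
    by apply: contraNneq dw0 => ->; rewrite nu0 scaler0.
  pose e i : 'rV[K]_3 := delta_mx 0 i.
  have e0 i : e i != 0.
    apply/eqP => /rowP/(_ i); rewrite !mxE !eqxx => /eqP; rewrite oner_eq0.
    by [].
  (* A multiple of a point of the surface lies on the line through it and any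
     other point. *)
  have [[c cE]|H] := pselect (exists c, nu w = c *: nu (e 0)); last first.
    exists w, (e 0), d, 0; split=> //; last by rewrite scale0r addr0.
    by move=> c cE; apply: H; exists c.
  exists w, (e 1), d, 0; split=> //; last by rewrite scale0r addr0.
  move=> c' cE'; have /rowP/(_ 0) := cE; rewrite cE' !mxE /= => c0.
  have c00 : c = 0 by rewrite -[LHS]mulr1 -[X in c * X](expr1n _ 2) -c0; ring.
  by case/eqP: (nu_neq0 w0); rewrite cE c00 scale0r.
move=> pq0; have pqE := polar_nu_sub p q.
have [l0|l0] := eqVneq (p - q) 0.
  by move: pqE; rewrite l0 nu0 scaler0 addr0 => pqE; apply: (single _ _ _ pqE); rewrite -pqE.
have [r0|r0] := eqVneq (p + q) 0.
  by move: pqE; rewrite r0 nu0 scaler0 add0r => pqE; apply: (single _ _ _ pqE); rewrite -pqE.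
have [[c cE]|H] := pselect (exists c, nu (p + q) = c *: nu (p - q)); last first.
  by exists (p + q), (p - q), 4^-1, (- 4^-1); split=> // c cE; apply: H; exists c.
move: pqE; rewrite cE scalerA -scalerDl => pqE.
by apply: (single _ _ _ pqE); rewrite -pqE.
Qed.
End Secants.

(** * Intersections of planes *)

Section Planes.
Variable K : numClosedFieldType.
Implicit Types (x : 'rV[K]_6) (p q w l : 'rV[K]_3) (u v : 'cV[K]_2).

Let two_neq0 : (2 : K) != 0. Proof. by rewrite pnatr_eq0. Qed.

(** The value on [l] and [l'] of the symmetric matrix with coordinates [x]. *)
Definition contr l l' x : K :=
  let y := x 0 1 - 4 * x 0 5 in
  let: (a, b, c) := (l 0 0, l 0 1, l 0 2) in
  let: (a', b', c') := (l' 0 0, l' 0 1, l' 0 2) in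
  2 * x 0 0 * a * a' - x 0 3 * (a * c' + c * a') + y * (a * b' + b * a')
  + x 0 1 * c * c' + x 0 4 * (b * c' + c * b') + 2 * x 0 2 * b * b'.

(** The value of the linear form [l] on [w]. *)
Definition pairing l w : K := l 0 0 * w 0 0 + l 0 1 * w 0 1 + l 0 2 * w 0 2.

Lemma contr_polar l l' p q : contr l l' (polar p q)
  = pairing l p * pairing l' q + pairing l q * pairing l' p.
Proof. by rewrite /contr /pairing !mxE /=; field. Qed.

Lemma contrD l l' x y : contr l l' (x + y) = contr l l' x + contr l l' y.
Proof. by rewrite /contr !mxE /=; ring. Qed.

Lemma contrZ l l' c x : contr l l' (c *: x) = c * contr l l' x.
Proof. by rewrite /contr !mxE /=; ring. Qed.

(** The linear form on [Sym^2 K^2] whose value on the square of [v] is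
    [det2 u v * det2 u' v]. *)
Definition det_form2 u u' : 'rV[K]_3 :=
  row_of 3 [:: u 1 0 * u' 1 0; - (u 0 0 * u' 0 0); u 0 0 * u' 1 0 + u 1 0 * u' 0 0].

Lemma pairing_sqv u u' v : pairing (det_form2 u u') (sqv v) = det2 u v * det2 u' v.
Proof. by rewrite /pairing /det2 !mxE /=; ring. Qed.

Lemma det2_diag v : det2 v v = 0. Proof. by rewrite /det2; ring. Qed.
Lemma det2C u v : det2 u v = - det2 v u. Proof. by rewrite /det2; ring. Qed.

Lemma det2_neq0 u v : det2 u v != 0 -> u != 0 /\ v != 0.
Proof.
by move=> uv; split; apply: contraNneq uv => ->; rewrite /det2 !mxE; apply/eqP; ring.
Qed.

Lemma contr_plane l l' v v' c0 c1 c2 : contr l l' (plane_point v v' c0 c1 c2)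
  = 2 * c0 * (pairing l (sqv v) * pairing l' (sqv v))
  + c1 * (pairing l (sqv v) * pairing l' (sqv v') + pairing l (sqv v') * pairing l' (sqv v))
  + 2 * c2 * (pairing l (sqv v') * pairing l' (sqv v')).
Proof. by rewrite /plane_point !contrD !contrZ -!polar_nu !contr_polar; ring. Qed.

(** The three coefficients of a point of a plane. *)
Lemma plane_coefs v v' c0 c1 c2 : let d := det2 v v' in
  let x := plane_point v v' c0 c1 c2 in
  let l := det_form2 v v in let l' := det_form2 v' v' in
  [/\ contr l' l' x = 2 * c0 * d ^+ 4, contr l l' x = c1 * d ^+ 4
    & contr l l x = 2 * c2 * d ^+ 4].
Proof.
move=> d x l l'; rewrite /x !contr_plane !pairing_sqv !det2_diag (det2C v' v) -/d.
by split; ring.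
Qed.

Lemma plane_point_inj v v' c0 c1 c2 : det2 v v' != 0 ->
  plane_point v v' c0 c1 c2 = 0 -> [/\ c0 = 0, c1 = 0 & c2 = 0].
Proof.
move=> d0 x0; have := plane_coefs v v' c0 c1 c2; rewrite /= x0.
have z l l' : contr l l' 0 = 0 by rewrite /contr !mxE /=; ring.
have d4 : det2 v v' ^+ 4 != 0 by rewrite expf_neq0.
rewrite !z => -[e0 e1 e2]; split.
- by apply: (mulfI two_neq0); apply: (mulIf d4); rewrite -e0 mulr0 mul0r.
- by apply: (mulIf d4); rewrite -e1 mul0r.
- by apply: (mulfI two_neq0); apply: (mulIf d4); rewrite -e2 mulr0 mul0r.
Qed.

Lemma plane_rank_one v v' c0 c1 c2 : det2 v v' != 0 ->
  rank_le1 (plane_point v v' c0 c1 c2) <-> c1 ^+ 2 = 4 * c0 * c2.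
Proof.
move=> d0; set x := plane_point _ _ _ _ _; split=> [rx|cE].
  have d8 : det2 v v' ^+ 8 != 0 by rewrite expf_neq0.
  have [x0|x0] := eqVneq x 0.
    by have [-> -> ->] := plane_point_inj d0 x0; ring.
  have [z z0 [c c_neq0 xE]] := (rank_one_nu x).1 (conj x0 rx).
  have [e0 e1 e2] := plane_coefs v v' c0 c1 c2.
  apply: (mulIf d8).
  have -> : c1 ^+ 2 * det2 v v' ^+ 8 = (c1 * det2 v v' ^+ 4) ^+ 2 by ring.
  have -> : 4 * c0 * c2 * det2 v v' ^+ 8
    = (2 * c0 * det2 v v' ^+ 4) * (2 * c2 * det2 v v' ^+ 4) by ring.
  rewrite -e0 -e1 -e2 -/x xE !contrZ -!polar_nu !contr_polar; ring.
have [c00|c00] := eqVneq c0 0.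
  have c10 : c1 = 0 by apply/eqP; rewrite -sqrf_eq0 cE c00 mulr0 mul0r.
  by rewrite /x /plane_point c00 c10 !scale0r !add0r; apply: nu_rank_le1.
have -> : x = c0 *: nu (1 *: sqv v + (c1 / (2 * c0)) *: sqv v').
  rewrite -polar_nu polar_span /x /plane_point !scalerDr !scalerA.
  congr (_ *: _ + _ *: _ + _ *: _); first by ring.
    by field.
  have -> : c0 * (c1 / (2 * c0) * (c1 / (2 * c0))) = c1 ^+ 2 / (4 * c0) by field.
  by rewrite cE; field.
exact: nu_rank_le1.
Qed.

Lemma det2_mix v v' a b c d :
  det2 (a *: v + b *: v') (c *: v + d *: v') = (a * d - b * c) * det2 v v'.
Proof. by rewrite /det2 !mxE; ring. Qed.

Lemma sqv_mix v v' a b : sqv (a *: v + b *: v') = a ^+ 2 *: sqv v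
  + (a * b) *: row_of 3 [:: 2 * v 0 0 * v' 0 0; - (2 * v 1 0 * v' 1 0);
      - (v 0 0 * v' 1 0 + v 1 0 * v' 0 0)] + b ^+ 2 *: sqv v'.
Proof. by apply: row3P; rewrite !mxE /=; ring. Qed.

(** A point of rank at most one of a plane lies in the plane of another pair, one
    member of which is independent of [v] and of [v']. *)
Lemma other_plane v v' c0 c1 c2 : det2 v v' != 0 -> c1 ^+ 2 = 4 * c0 * c2 ->
  exists u u' a b, [/\ det2 u u' != 0, a != 0, b != 0, u = a *: v + b *: v' &
    exists d0 d1 d2, plane_point v v' c0 c1 c2 = plane_point u u' d0 d1 d2].
Proof.
move=> d0 cE.
have one : (1 : K) != 0 by rewrite oner_eq0.
have vv' : v = 1 *: v + 0 *: v' by rewrite scale1r scale0r addr0.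
have v'v : v' = 0 *: v + 1 *: v' by rewrite scale1r scale0r add0r.
have [c00|c00] := eqVneq c0 0.
  have c10 : c1 = 0 by apply/eqP; rewrite -sqrf_eq0 cE c00 mulr0 mul0r.
  exists (1 *: v + 1 *: v'), v', 1, 1; split=> //.
    by rewrite [X in det2 _ X]v'v det2_mix mulr1 mulr0 subr0 mul1r.
  by exists 0, 0, c2; rewrite /plane_point c00 c10 !scale0r !add0r.
have [c20|c20] := eqVneq c2 0.
  have c10 : c1 = 0 by apply/eqP; rewrite -sqrf_eq0 cE c20 mulr0.
  exists (1 *: v + 1 *: v'), v, 1, 1; split=> //.
    by rewrite [X in det2 _ X]vv' det2_mix mulr1 mulr0 sub0r mulNr oppr_eq0 mul1r.
  by exists 0, 0, c0; rewrite /plane_point c20 c10 !scale0r !addr0 !add0r.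
(* The point is [c0] times the square of sqv v + m sqv v'.  For every [k] one has
   (m + k^2) (sqv v + m sqv v') = m sqv (v + k v') + sqv (k v - m v'). *)
pose m := c1 / (2 * c0).
have m0 : m != 0.
  by rewrite mulf_neq0 ?invr_eq0 ?mulf_neq0 // -sqrf_eq0 cE !mulf_neq0 // pnatr_eq0.
have [k k0 mk] : exists2 k : K, k != 0 & m + k ^+ 2 != 0.
  have [m1|m1] := eqVneq (m + 1) 0; last by exists 1; rewrite ?expr1n.
  exists 2; first by rewrite pnatr_eq0.
  have -> : m + 2 ^+ 2 = (m + 1) + 3 by ring.
  by rewrite m1 add0r pnatr_eq0.
exists (1 *: v + k *: v'), (k *: v + (- m) *: v'), 1, k; split=> //.
  rewrite det2_mix mul1r (_ : - m - k * k = - (m + k ^+ 2)); last by ring.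
  by rewrite mulf_neq0 // oppr_eq0.
pose n := m + k ^+ 2.
have zE : sqv v + m *: sqv v' =
    (m / n) *: sqv (1 *: v + k *: v') + n^-1 *: sqv (k *: v + (- m) *: v').
  rewrite !sqv_mix; move: (row_of 3 _) => p.
  by apply: row3P; rewrite !mxE /n; field.
exists (c0 * (m / n * (m / n))), (c0 * (m / n * n^-1 + n^-1 * (m / n))), (c0 * (n^-1 * n^-1)).
have -> : plane_point v v' c0 c1 c2 = c0 *: nu (sqv v + m *: sqv v').
  rewrite -[sqv v in RHS]scale1r -polar_nu polar_span /plane_point !scalerDr !scalerA.
  congr (_ *: _ + _ *: _ + _ *: _); first by ring.
    by rewrite /m; field.
  have -> : c0 * (m * m) = c1 ^+ 2 / (4 * c0) by rewrite /m; field.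
  by rewrite cE; field.
by rewrite zE -polar_nu polar_span /plane_point !scalerDr !scalerA.
Qed.

Lemma det2_eq0 u v : u != 0 -> v != 0 -> det2 u v = 0 -> exists2 k, k != 0 & v = k *: u.
Proof.
move=> u0 v0 /eqP; rewrite /det2 subr_eq0 => /eqP d0.
have colP2 (w w' : 'cV[K]_2) : w 0 0 = w' 0 0 -> w 1 0 = w' 1 0 -> w = w'.
  move=> e0 e1; apply/colP; case=> [[|[|?]] i2] //.
    by rewrite (_ : Ordinal i2 = 0) //; apply: val_inj.
  by rewrite (_ : Ordinal i2 = 1) //; apply: val_inj.
suff [k vE] : exists k, v = k *: u.
  by exists k => //; apply: contraNneq v0 => k0; rewrite vE k0 scale0r.
have [u00|u00] := eqVneq (u 0 0) 0; last first.
  exists (v 0 0 / u 0 0); apply: colP2; rewrite mxE; first by rewrite mulfVK.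
  by rewrite mulrAC -d0 mulrC mulKf.
have u10 : u 1 0 != 0.
  by apply: contraNneq u0 => u10; apply/eqP; apply: colP2; rewrite mxE.
exists (v 1 0 / u 1 0); apply: colP2; rewrite mxE; last by rewrite mulfVK.
by rewrite mulrAC -[v 1 0 * _]mulrC d0 mulfK.
Qed.

(** If the planes of two pairs share a point of rank two, each member of one pair is
    proportional to a member of the other. *)
Lemma planes_meet v v' u u' c0 c1 c2 d0 d1 d2 :
  plane_point v v' c0 c1 c2 = plane_point u u' d0 d1 d2 -> det2 v v' != 0 ->
  c1 ^+ 2 != 4 * c0 * c2 ->
  det2 u v * det2 u' v = 0 /\ det2 u v' * det2 u' v' = 0.
Proof.
move=> xE dv cN; pose n := det_form2 u u'; pose l := det_form2 v v; pose l' := det_form2 v' v'.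
(* [n] vanishes at the squares of [u] and [u'], so it annihilates the matrix; as
   the rank is two, it also vanishes at the squares of [v] and [v']. *)
have nx w : contr n w (plane_point v v' c0 c1 c2) = 0.
  by rewrite xE contr_plane /n !pairing_sqv !det2_diag; ring.
have dv2 : det2 v v' ^+ 2 != 0 by rewrite expf_neq0.
have := nx l; have := nx l'; rewrite !contr_plane /n /l /l' !pairing_sqv !det2_diag (det2C v' v).
move: (det2 u v * _) (det2 u v' * _) => a b.
move=> e1 e2.
have {}e1 : 2 * c0 * a + c1 * b = 0.
  by apply: (mulIf dv2); rewrite mul0r -[RHS]e1; ring.
have {}e2 : c1 * a + 2 * c2 * b = 0.
  by apply: (mulIf dv2); rewrite mul0r -[RHS]e2; ring.
have det0 : c1 ^+ 2 - 4 * c0 * c2 != 0 by rewrite subr_eq0.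
split; apply: (mulfI det0); rewrite mulr0.
  have -> : (c1 ^+ 2 - 4 * c0 * c2) * a = c1 * (c1 * a + 2 * c2 * b) - 2 * c2 * (2 * c0 * a + c1 * b).
    by ring.
  by rewrite e1 e2 !mulr0 subr0.
have -> : (c1 ^+ 2 - 4 * c0 * c2) * b = c1 * (2 * c0 * a + c1 * b) - 2 * c0 * (c1 * a + 2 * c2 * b).
  by ring.
by rewrite e1 e2 !mulr0 subr0.
Qed.
End Planes.

(** * Cartan subalgebras of 2 x 2 matrices *)

Section DiagonalAlgebra.
Variable K : fieldType.
Implicit Types (Q A : 'M[K]_2) (v w : 'cV[K]_2).

(** The matrix with eigenvectors the columns of [Q] and eigenvalues [d]. *)
Definition diag_conj Q (d : 'rV[K]_2) : 'M[K]_2 := Q *m diag_mx d *m invmx Q.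

Lemma diag_conj_is_linear Q : linear (diag_conj Q).
Proof. by move=> c d d'; rewrite /diag_conj linearP mulmxDr mulmxDl -scalemxAr -scalemxAl. Qed.

HB.instance Definition _ Q :=
  GRing.isLinear.Build K 'rV[K]_2 'M[K]_2 *:%R (diag_conj Q) (diag_conj_is_linear Q).

(** The algebra of the matrices having the columns of [Q] as eigenvectors. *)
Definition diag_algebra Q : {vspace 'M[K]_2} := limg (linfun (diag_conj Q)).

Lemma diag_algebraP Q A : reflect (exists d, A = diag_conj Q d) (A \in diag_algebra Q).
Proof.
apply: (iffP memv_imgP) => [[d _ ->]|[d ->]]; exists d; rewrite ?lfunE //.
exact: memvf.
Qed.

Lemma diag_conjM Q d d' : Q \in unitmx ->
  diag_conj Q d *m diag_conj Q d' = diag_conj Q (\row_i (d 0 i * d' 0 i)).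
Proof.
by move=> Qu; rewrite /diag_conj !mulmxA mulmxKV // -(mulmxA Q) mulmx_diag.
Qed.

Lemma diag_conj1 Q : Q \in unitmx -> diag_conj Q (const_mx 1) = 1%:M.
Proof. by move=> Qu; rewrite /diag_conj diag_const_mx mulmx1 mulmxV. Qed.

Lemma diag_conj_inj Q : Q \in unitmx -> injective (diag_conj Q).
Proof.
move=> Qu d d' /(congr1 (fun A => invmx Q *m A *m Q)).
rewrite /diag_conj -!mulmxA !mulVmx // !mulmx1 !mulKmx // => dd'.
by apply/rowP => i; move/matrixP/(_ i i): dd'; rewrite !mxE eqxx.
Qed.

Lemma dim_diag_algebra Q : Q \in unitmx -> \dim (diag_algebra Q) = 2%N.
Proof.
move=> Qu; rewrite limg_dim_eq ?dimvf // (_ : lker _ = 0%VS) ?capv0 //.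
by apply/eqP/lker0P => d d'; rewrite !lfunE; apply: diag_conj_inj.
Qed.

Lemma row_mx_diag v w (d : 'rV[K]_2) :
  (row_mx v w : 'M[K]_2) *m diag_mx d = row_mx (d 0 0 *: v) (d 0 1 *: w).
Proof.
apply/matrixP => i j; rewrite mul_mx_diag !mxE.
by case: splitP => k jk; rewrite !mxE mulrC; congr (d _ _ * _);
  apply: val_inj; rewrite /= jk ord1.
Qed.

Lemma diag_conj_eigen v w d : (row_mx v w : 'M[K]_2) \in unitmx ->
  diag_conj (row_mx v w) d *m v = d 0 0 *: v /\ diag_conj (row_mx v w) d *m w = d 0 1 *: w.
Proof.
move=> Qu.
have : diag_conj (row_mx v w) d *m (row_mx v w : 'M[K]_2) = row_mx (d 0 0 *: v) (d 0 1 *: w).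
  by rewrite /diag_conj mulmxKV // row_mx_diag.
by move/(etrans (esym (mul_mx_row _ v w)))/eq_row_mx.
Qed.

Lemma diag_algebra_eigen v w A : (row_mx v w : 'M[K]_2) \in unitmx ->
  A \in diag_algebra (row_mx v w) <->
  (exists a, A *m v = a *: v) /\ (exists b, A *m w = b *: w).
Proof.
move=> Qu; split=> [/diag_algebraP[d ->]|[[a av] [b bw]]].
  by have [-> ->] := diag_conj_eigen d Qu; split; [exists (d 0 0) | exists (d 0 1)].
apply/diag_algebraP; exists (\row_i [:: a; b]`_i).
by rewrite /diag_conj row_mx_diag !mxE /= -av -bw -mul_mx_row mulmxK.
Qed.

Lemma det_row_mx v w : \det (row_mx v w : 'M[K]_2) = v 0 0 * w 1 0 - w 0 0 * v 1 0.
Proof.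
have e0 i : row_mx v w i (0 : 'I_2) = v i 0.
  by rewrite (_ : (0 : 'I_2) = lshift 1 (0 : 'I_1)) ?row_mxEl //; apply: val_inj.
have e1 i : row_mx v w i (1 : 'I_2) = w i 0.
  by rewrite (_ : (1 : 'I_2) = rshift 1 (0 : 'I_1)) ?row_mxEr //; apply: val_inj.
by rewrite det_mx2 !e0 !e1.
Qed.

End DiagonalAlgebra.

Section Eigenvectors.
Variable K : numClosedFieldType.
Implicit Types (u v w : 'cV[K]_2).

Lemma unitmx_det2 v w : ((row_mx v w : 'M[K]_2) \in unitmx) = (det2 v w != 0).
Proof. by rewrite unitmxE unitfE det_row_mx. Qed.

Lemma col2P u v : u 0 0 = v 0 0 -> u 1 0 = v 1 0 -> u = v.
Proof.
move=> e0 e1; apply/colP; case=> [[|[|?]] i2] //.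
  by rewrite (_ : Ordinal i2 = 0) //; apply: val_inj.
by rewrite (_ : Ordinal i2 = 1) //; apply: val_inj.
Qed.

(** Cramer's rule. *)
Lemma cramer2 u v w : det2 v w *: u = det2 u w *: v + det2 v u *: w.
Proof. by apply: col2P; rewrite !mxE /det2; ring. Qed.

(** An eigenvector of all matrices with eigenvectors [v] and [w] is a multiple of
    [v] or of [w]. *)
Lemma diag_algebra_eigenvector v w u : det2 v w != 0 ->
  (forall A, A \in diag_algebra (row_mx v w) -> exists c, A *m u = c *: u) ->
  det2 u w = 0 \/ det2 v u = 0.
Proof.
move=> vw eig; have Qu : (row_mx v w : 'M[K]_2) \in unitmx by rewrite unitmx_det2.
pose d : 'rV[K]_2 := \row_i [:: 1; 0]`_i; pose A := diag_conj (row_mx v w) d.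
have [c cE] : exists c, A *m u = c *: u by apply: eig; apply/diag_algebraP; exists d.
have [] := diag_conj_eigen d Qu; rewrite -/A !mxE /= scale1r scale0r => Av Aw.
have := congr1 (mulmx A) (cramer2 u v w).
rewrite -scalemxAr cE mulmxDr -!scalemxAr Av Aw scaler0 addr0 scalerA mulrC -scalerA cramer2.
move=> /(congr1 (fun x => (det2 v x, det2 x w))).
have e1 a b k : det2 v (k *: (a *: v + b *: w)) = k * b * det2 v w.
  by rewrite /det2 !mxE; ring.
have e2 a b k : det2 (k *: (a *: v + b *: w)) w = k * a * det2 v w.
  by rewrite /det2 !mxE; ring.
have e3 a : det2 v (a *: v) = 0 by rewrite /det2 !mxE; ring.
have e4 a : det2 (a *: v) w = a * det2 v w by rewrite /det2 !mxE; ring.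
rewrite e1 e2 e3 e4 => -[h1 h2].
have [c0|c0] := eqVneq c 0.
  by left; apply: (mulIf vw); rewrite -h2 c0 !mul0r.
by right; apply: (mulIf vw); apply: (mulfI c0); rewrite mulrA h1 mul0r mulr0.
Qed.
End Eigenvectors.

Section Cartan.
Variable R : realType.
Local Notation C := R[i].
Implicit Types (K : {vspace 'M[C]_2}) (v w : 'cV[C]_2).

(** Every pair of independent vectors is an eigenbasis of a Cartan subalgebra. *)
Lemma cartan_diag_algebra v w : det2 v w != 0 -> cartan (diag_algebra (row_mx v w)).
Proof.
rewrite -unitmx_det2 => Qu; split.
- by apply/diag_algebraP; exists (const_mx 1); rewrite diag_conj1.
- move=> _ _ /diag_algebraP[d ->] /diag_algebraP[d' ->]; apply/diag_algebraP.
  by rewrite diag_conjM //; exists (\row_i (d 0 i * d' 0 i)).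
- exact: dim_diag_algebra.
exists (invmx (row_mx v w)); first by rewrite unitmx_inv.
apply/allP => A /vbasis_mem/diag_algebraP[d ->]; rewrite inE.
apply/diagonalizable_forLR; first by rewrite unitmx_inv.
by exists d; rewrite invmxK; apply/esym/conjumx.
Qed.

Lemma eigenbasis_diag_algebra v w : det2 v w != 0 ->
  eigenbasis (diag_algebra (row_mx v w)) v w.
Proof. by rewrite -unitmx_det2 => Qu; split=> // A /diag_algebra_eigen; apply. Qed.

Lemma cartan_eigenbasis K : cartan K -> exists v w, eigenbasis K v w.
Proof.
case=> _ _ _ [P Pu /allP PK]; pose Q : 'M[C]_(2, 1 + 1) := invmx P.
have Qu : (row_mx (lsubmx Q) (rsubmx Q) : 'M[C]_2) \in unitmx by rewrite hsubmxK unitmx_inv.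
exists (lsubmx Q), (rsubmx Q); split=> // A AK; apply/(diag_algebra_eigen _ Qu).
suff /subvP : (K <= diag_algebra (row_mx (lsubmx Q) (rsubmx Q)))%VS by apply.
rewrite hsubmxK -(span_basis (vbasisP K)); apply/span_subvP => B BK.
have := PK _ BK; rewrite inE => /diagonalizable_forLR-/(_ Pu)[d ->].
by apply/diag_algebraP; exists d; apply: conjumx; rewrite unitmx_inv.
Qed.

Lemma eigenbasis_det2 K v w : eigenbasis K v w -> det2 v w != 0.
Proof. by case; rewrite unitmx_det2. Qed.

(** A Cartan subalgebra is determined by its eigenvectors. *)
Lemma cartan_eq K v w : cartan K -> eigenbasis K v w -> K = diag_algebra (row_mx v w).
Proof.
case=> _ _ dK _ [Qu eig]; apply/eqP; rewrite eqEdim dK dim_diag_algebra // andbT.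
by apply/subvP => A /eig /(diag_algebra_eigen _ Qu).
Qed.
End Cartan.

(** * The spaces B^2_K *)

Lemma product22C (K : comPzRingType) (V : Type) (p q : V -> V -> K) x y z t :
  product22 p q x y z t = product22 q p x y z t.
Proof. by rewrite /product22; ring. Qed.

Section Squares.
Variables (F : fieldType) (n : nat).
Implicit Types w a b : ext F n.

Lemma wedgeC2 a b : ext_degree 2 a -> ext_degree 2 b -> a \^ b = b \^ a.
Proof.
move=> da db; apply: eval4_inj => [||x y z t].
- exact: (ext_degree_wedge da db).
- exact: (ext_degree_wedge db da).
- by apply: etrans (eval4_wedge _ _ _ _ da db) _; rewrite product22C -eval4_wedge.
Qed.

(** The bookkeeping of a square, in terms of given products. *)
Lemma combination_square (a b c : F) (m11 m12 m22 m1s m2s mss : ext F n) :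
  a *: (a *: m11 + c *: m1s + b *: m12) + c *: (a *: m1s + c *: mss + b *: m2s)
    + b *: (a *: m12 + c *: m2s + b *: m22)
  = a ^+ 2 *: m11 + (2 * a * b) *: m12 + b ^+ 2 *: m22 + (2 * a * c) *: m1s
    + (2 * b * c) *: m2s + c ^+ 2 *: mss.
Proof.
have addE (m m' : ext F n) A : (m + m') A = (m A : F) + m' A by rewrite ffunE.
have scaleE k (m : ext F n) A : (k *: m) A = k * (m A : F) by rewrite ffunE.
apply/ffunP => A; rewrite !(addE, scaleE).
move: (m11 A : F) (m12 A : F) (m22 A : F) (m1s A : F) (m2s A : F) (mss A : F) => *.
by rewrite -[@GRing.add _]/(@GRing.add F); ring.
Qed.

(** The square of a combination of three commuting forms. *)
Lemma wedge_square w1 w2 ws (a b c : F) :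
  w2 \^ w1 = w1 \^ w2 -> ws \^ w1 = w1 \^ ws -> ws \^ w2 = w2 \^ ws ->
  (a *: w1 + c *: ws + b *: w2) \^ (a *: w1 + c *: ws + b *: w2) =
  a ^+ 2 *: (w1 \^ w1) + (2 * a * b) *: (w1 \^ w2) + b ^+ 2 *: (w2 \^ w2)
  + (2 * a * c) *: (w1 \^ ws) + (2 * b * c) *: (w2 \^ ws) + c ^+ 2 *: (ws \^ ws).
Proof.
move=> e21 es1 es2; rewrite -combination_square.
have expand u : u \^ (a *: w1 + c *: ws + b *: w2) = a *: (u \^ w1) + c *: (u \^ ws) + b *: (u \^ w2).
  by rewrite !wedgeDr !wedgeZr.
rewrite !wedgeDl !wedgeZl !expand e21 es1 es2; reflexivity.
Qed.
End Squares.

Section PlaneSymmetries.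
Variable K : numClosedFieldType.
Implicit Types (v w : 'cV[K]_2).

Lemma sqvZ k v : sqv (k *: v) = k ^+ 2 *: sqv v.
Proof. by apply: row3P; rewrite !mxE /=; ring. Qed.

Lemma plane_pointC v w c0 c1 c2 : plane_point v w c0 c1 c2 = plane_point w v c2 c1 c0.
Proof. by rewrite /plane_point (polarC (sqv v)) addrC addrA [RHS]addrAC. Qed.

Lemma plane_pointZ k l v w c0 c1 c2 : plane_point (k *: v) (l *: w) c0 c1 c2
  = plane_point v w (c0 * k ^+ 4) (c1 * k ^+ 2 * l ^+ 2) (c2 * l ^+ 4).
Proof.
rewrite /plane_point !sqvZ -!polar_nu !polarZl !polarZr !scalerA.
by congr (_ *: _ + _ *: _ + _ *: _); ring.
Qed.

(** Two pairs of independent vectors that agree up to order and scaling have the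
    same plane. *)
Lemma same_plane v w u u' c0 c1 c2 : det2 u u' != 0 -> det2 v w != 0 ->
  (det2 u w = 0 \/ det2 v u = 0) -> (det2 u' w = 0 \/ det2 v u' = 0) ->
  exists d0 d1 d2, plane_point u u' c0 c1 c2 = plane_point v w d0 d1 d2.
Proof.
move=> uu vw uE u'E.
have [u0 u'0] := det2_neq0 uu; have [v0 w0] := det2_neq0 vw.
have dep z k l : det2 (k *: z) (l *: z) = 0 by rewrite /det2 !mxE; ring.
have pick z : z != 0 -> det2 z w = 0 \/ det2 v z = 0 ->
    (exists k, z = k *: w) \/ (exists k, z = k *: v).
  move=> z0 [zw|vz]; [left | right].
    by have [|k _ ->] := det2_eq0 w0 z0; [rewrite det2C zw oppr0 | exists k].
  by have [k _ ->] := det2_eq0 v0 z0 vz; exists k.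
have [[k uk]|[k uk]] := pick _ u0 uE; have [[l ul]|[l ul]] := pick _ u'0 u'E.
- by move/eqP: uu; rewrite uk ul dep.
- by rewrite uk ul plane_pointC plane_pointZ; do 3 eexists.
- by rewrite uk ul plane_pointZ; do 3 eexists.
- by move/eqP: uu; rewrite uk ul dep.
Qed.

(** The coordinates of the square of [a omega_1 + c omega_sigma + b omega_2]. *)
Definition square_coords (a c b : K) : 'rV[K]_6 :=
  row_of 6 [:: a ^+ 2; 2 * a * b; b ^+ 2; 2 * a * c; 2 * b * c; c ^+ 2].

Lemma square_coords_sqv v :
  square_coords (v 0 0 ^+ 2) (v 0 0 * v 1 0) (v 1 0 ^+ 2) = nu (sqv v).
Proof. by apply: row6P; rewrite !mxE /=; field. Qed.

Lemma square_coords_polar v w :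
  square_coords (2 * v 0 0 * w 0 0) (v 0 0 * w 1 0 + w 0 0 * v 1 0) (2 * v 1 0 * w 1 0)
  = 4 *: polar (sqv v) (sqv w).
Proof. by apply: row6P; rewrite !mxE /=; field. Qed.

Lemma plane_point_span v w x :
  (exists c0 c1 c2, x = c0 *: (4 *: polar (sqv v) (sqv w)) + c1 *: nu (sqv v) + c2 *: nu (sqv w))
  <-> exists c0 c1 c2, x = plane_point v w c0 c1 c2.
Proof.
have four : (4 : K) != 0 by rewrite pnatr_eq0.
split=> [[c0 [c1 [c2 ->]]]|[c0 [c1 [c2 ->]]]].
  exists c1, (c0 * 4), c2; rewrite /plane_point scalerA.
  by rewrite [_ *: polar _ _ + _]addrC.
exists (c1 / 4), c0, c2; rewrite scalerA mulfVK //.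
by rewrite [_ *: polar _ _ + _]addrC.
Qed.
End PlaneSymmetries.

Lemma mem_span3_image (F : fieldType) (U : lmodType F) (V : vectType F) (f : U -> V)
    (a b c x : U) (a' b' c' : V) :
  (forall y z, f (y + z) = f y + f z) -> (forall k y, f (k *: y) = k *: f y) ->
  injective f -> a' = f a -> b' = f b -> c' = f c ->
  f x \in <<[:: a'; b'; c']>>%VS <-> exists c0 c1 c2, x = c0 *: a + c1 *: b + c2 *: c.
Proof.
move=> fD fZ finj -> -> ->; rewrite !span_cons span_nil addv0; split.
  case/memv_addP => _ /vlineP[c0 ->] [_ /memv_addP[_ /vlineP[c1 ->] [_ /vlineP[c2 ->] ->]]].
  by rewrite -!fZ -!fD addrA => /finj ->; exists c0, c1, c2.
case=> c0 [c1 [c2 ->]]; rewrite -addrA !fD !fZ.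
by apply: memv_add; [|apply: memv_add]; apply: memvZ; apply: memv_line.
Qed.

Section Cartan.
Variables (R : realType) (E dt : 'M[rat]_4).
Hypothesis basis_dt : symplectic_basis E dt.
Local Notation C := R[i].
Implicit Types (K : {vspace 'M[C]_2}) (v w : 'cV[C]_2) (x : 'rV[C]_6).

Lemma square_theta (a b c : C) :
  (a *: omega1 R dt + c *: omega_sigma R dt + b *: omega2 R dt)
    \^ (a *: omega1 R dt + c *: omega_sigma R dt + b *: omega2 R dt)
  = theta dt (square_coords a c b).
Proof.
have d1 := @ext_degree_omega1 R dt; have d2 := @ext_degree_omega2 R dt.
have ds := @ext_degree_omega_sigma R dt.
apply: etrans (wedge_square _ _ _ (wedgeC2 d2 d1) (wedgeC2 ds d1) (wedgeC2 ds d2)) _.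
by rewrite /theta !row_ofE.
Qed.

Lemma omega_v_square v : omega_v dt v \^ omega_v dt v = theta dt (nu (sqv v)).
Proof.
by apply: etrans (square_theta _ _ _) _; rewrite (square_coords_sqv v).
Qed.

Lemma omega_K_square v w :
  omega_K dt v w \^ omega_K dt v w = theta dt (4 *: polar (sqv v) (sqv w)).
Proof.
by apply: etrans (square_theta _ _ _) _; rewrite (square_coords_polar v w).
Qed.

(** In any eigenbasis, the space B^2_K is given by the plane of the pair. *)
Lemma B2K_plane K v w x : cartan K -> eigenbasis K v w ->
  B2K dt K (theta dt x) <-> exists c0 c1 c2, x = plane_point v w c0 c1 c2.
Proof.
move=> cK eK; have dvw := eigenbasis_det2 eK.
have KE := cartan_eq cK eK.
have spanE u u' : (theta dt x \in <<[:: omega_K dt u u' \^ omega_K dt u u';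
      omega_v dt u \^ omega_v dt u; omega_v dt u' \^ omega_v dt u']>>%VS)
    <-> exists c0 c1 c2, x = plane_point u u' c0 c1 c2.
  apply: iff_trans (plane_point_span u u' x).
  exact: (mem_span3_image _ (@thetaD R dt) (@thetaZ R dt) (theta_inj basis_dt)
    (omega_K_square u u') (omega_v_square u) (omega_v_square u')).
split=> [[u [u' [eU /spanE[c0 [c1 [c2 ->]]]]]]|xE]; last by exists v, w; split=> //; apply/spanE.
have eig z : (forall A, A \in K -> exists a, A *m z = a *: z) -> det2 z w = 0 \/ det2 v z = 0.
  by rewrite KE; apply: diag_algebra_eigenvector.
apply: same_plane => //; first exact: eigenbasis_det2 eU.
  by apply: eig => A /(proj2 eU)[].
by apply: eig => A /(proj2 eU)[].
Qed.

End Cartan.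

(** * Equations of the parametrization and of the conics *)

Section Equations.
Variable K : numClosedFieldType.
Implicit Types (x : 'rV[K]_6) (p q v w : 'rV[K]_3).

Let two_neq0 : (2 : K) != 0. Proof. by rewrite pnatr_eq0. Qed.

(** A quadratic form in two linear forms is degenerate. *)
Lemma pencil_det p q c0 c1 c2 :
  (Gpoly K).@[(c0 *: nu p + c1 *: polar p q + c2 *: nu q) 0] = 0.
Proof. by rewrite Gpoly_eval /det_form !mxE /=; field. Qed.

Lemma Gpoly_neq0 : Gpoly K != 0.
Proof.
pose x (i : 'I_6) : K := if i == 1 then 1 else 0.
apply/eqP => G0; have := Gpoly_eval x; rewrite G0 meval0 /det_form /x /=.
move/eqP; rewrite !(mulr0, mul0r, mulr1, mul1r, addr0, add0r, subr0, sub0r, oppr0).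
by rewrite eq_sym oppr_eq0 oner_eq0.
Qed.

Section Homogeneity.
Variables (n : nat).
Implicit Types (f g : {mpoly K[n]}).

Lemma dhomogXU (i : 'I_n) : ('X_i : {mpoly K[n]}) \is 1.-homog.
Proof. by rewrite dhomogX /= mdeg1. Qed.

Lemma dhomog_natl k d f : f \is d.-homog -> k%:R * f \is d.-homog.
Proof. by move=> fd; rewrite mulr_natl rpredMn. Qed.

Lemma dhomogB d f g : f \is d.-homog -> g \is d.-homog -> f - g \is d.-homog.
Proof. by move=> fd gd; rewrite rpredB. Qed.

Lemma dhomog_opp d f : f \is d.-homog -> - f \is d.-homog.
Proof. by move=> fd; rewrite rpredN. Qed.

Lemma dhomogM11 f g : f \is 1.-homog -> g \is 1.-homog -> f * g \is 2.-homog.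
Proof. exact: (@dhomogM _ _ _ 1 _ 1). Qed.

Lemma dhomogM12 f g : f \is 1.-homog -> g \is 2.-homog -> f * g \is 3.-homog.
Proof. exact: (@dhomogM _ _ _ 1 _ 2). Qed.
End Homogeneity.

Lemma Gpoly_homog : Gpoly K \is 3.-homog.
Proof.
pose X (i : 'I_6) : {mpoly K[6]} := 'X_i; have x1 i : X i \is 1.-homog := dhomogXU i.
have y1 : X 1 - 4 * X 5 \is 1.-homog by apply/dhomogB/dhomog_natl.
have x2 i j : X i * X j \is 2.-homog by apply: dhomogM11.
have -> : Gpoly K = 2 * (X 0 * (2 * (X 1 * X 2) - X 4 * X 4))
   + X 3 * (- (2 * (X 2 * X 3)) - X 4 * (X 1 - 4 * X 5))
   + (X 1 - 4 * X 5) * (- (X 3 * X 4) - X 1 * (X 1 - 4 * X 5)).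
  by rewrite /Gpoly /det_form /X !expr2 !mulrA.
have q1 := dhomog_natl 2 (x2 1 2); have q2 := dhomog_opp (dhomog_natl 2 (x2 2 3)).
apply: dhomogD; first apply: dhomogD.
- by apply/dhomog_natl/dhomogM12 => //; apply: dhomogB.
- by apply: dhomogM12 => //; apply: dhomogB => //; apply: dhomogM11.
- apply: dhomogM12 => //; apply: dhomogB; last exact: dhomogM11.
  exact: dhomog_opp.
Qed.

(** The quadratic forms giving [nu]. *)
Definition nu_poly (j : nat) : {mpoly K[3]} :=
  nth 0 [:: 'X_0 * 'X_0; 2 * ('X_2 * 'X_2); 'X_1 * 'X_1; - (2 * ('X_2 * 'X_0));
    2 * ('X_2 * 'X_1); 2^-1 *: (- ('X_0 * 'X_1) + 'X_2 * 'X_2)] j.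

Lemma nu_poly_homog (j : 'I_6) : nu_poly j \is 2.-homog.
Proof.
have x2 (i k : 'I_3) : ('X_i * 'X_k : {mpoly K[3]}) \is 2.-homog.
  by apply: dhomogM11; apply: dhomogXU.
case: j => [[|[|[|[|[|[|?]]]]]] ?] //; rewrite /nu_poly [nth _ _ _]/= //.
- exact: dhomog_natl.
- exact/dhomog_opp/dhomog_natl.
- exact: dhomog_natl.
- by apply: dhomogZ; apply: dhomogD; first exact: dhomog_opp.
Qed.

Lemma nu_poly_eval v : \row_(j < 6) (nu_poly j).@[v 0] = nu v.
Proof.
by apply: row6P; rewrite !mxE /nu_poly /=
  ?(mevalD, mevalN, mevalM, mevalZ, mevalXU, meval1); ring.
Qed.

(** The linear forms giving the rows of the symmetric matrix. *)
Definition row_poly (k j : nat) : {mpoly K[6]} :=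
  let y := 'X_1 - 4 * 'X_5 in
  nth 0 (nth [::] [:: [:: 2 * 'X_0; y; - 'X_3]; [:: - 'X_3; 'X_4; 'X_1];
                      [:: y; 2 * 'X_2; 'X_4]] k) j.

Lemma row_poly_homog k (j : 'I_3) : (k < 3)%N -> row_poly k j \is 1.-homog.
Proof.
have x1 := @dhomogXU 6.
have y1 : ('X_1 - 4 * 'X_5 : {mpoly K[6]}) \is 1.-homog by apply/dhomogB/dhomog_natl.
by case: j k => [[|[|[|?]]] ?] [|[|[|?]]] // _; rewrite /row_poly [nth _ _ _]/= //;
  by [exact: dhomog_natl | exact: dhomog_opp].
Qed.

Lemma row_poly_eval k x : (k < 3)%N -> \row_(j < 3) (row_poly k j).@[x 0] = pick_row k x.
Proof.
by case: k => [|[|[|?]]] // _; apply: row3P; rewrite !mxE /row_poly /=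
  ?(mevalD, mevalN, mevalM, mevalXU, meval1); ring.
Qed.

(** Right multiplication by this matrix turns the six monomials of degree 2 into
    the coordinates of [nu]. *)
Definition veronese_mx : 'M[K]_6 := \matrix_(i < 6, j < 6)
  nth 0 (nth [::] [:: [:: 1; 0; 0; 0; 0; 0]; [:: 0; 0; 0; 0; 0; - 2^-1];
    [:: 0; 0; 0; - 2; 0; 0]; [:: 0; 0; 1; 0; 0; 0];
    [:: 0; 0; 0; 0; 2; 0]; [:: 0; 2; 0; 0; 0; 2^-1]] i) j.

Lemma mul_veronese_mx x : x *m veronese_mx = row_of 6 [:: x 0 0; 2 * x 0 5; x 0 3;
  - 2 * x 0 2; 2 * x 0 4; 2^-1 * (x 0 5 - x 0 1)].
Proof.
have sum6 (f : 'I_6 -> K) : \sum_i f i = f 0 + f 1 + f 2 + f 3 + f 4 + f 5.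
  rewrite 6!big_ord_recl big_ord0 addr0 !addrA.
  by congr (f _ + f _ + f _ + f _ + f _ + f _); apply: val_inj.
by apply: row6P; rewrite !mxE sum6 !mxE /=; field.
Qed.

Lemma veronese_mx_unit : veronese_mx \in unitmx.
Proof.
rewrite -row_free_unit; apply: inj_row_free => x; rewrite mul_veronese_mx => x0.
have z i : row_of 6 [:: x 0 0; 2 * x 0 5; x 0 3; - 2 * x 0 2; 2 * x 0 4;
  2^-1 * (x 0 5 - x 0 1)] 0 i = 0 by rewrite x0 mxE.
have := (z 0, z 1, z 2, z 3, z 4, z 5); rewrite !row_ofE /=.
move=> [[[[[h0 h1] h2] h3] h4] h5].
have {}h1 : x 0 5 = 0 by apply: (mulfI two_neq0); rewrite mulr0.
have {}h3 : x 0 2 = 0.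
  by apply: (mulfI two_neq0); apply: oppr_inj; rewrite -mulNr h3 mulr0 oppr0.
have {}h4 : x 0 4 = 0 by apply: (mulfI two_neq0); rewrite mulr0.
have {}h5 : x 0 1 = 0.
  by apply: oppr_inj; apply: (mulfI (invr_neq0 two_neq0)); rewrite oppr0 mulr0 -[RHS]h5 h1 sub0r.
by apply: row6P; rewrite [RHS]mxE.
Qed.

Lemma conics_map_nu v : conics_map v *m veronese_mx = nu v.
Proof. by rewrite mul_veronese_mx; apply: row6P; rewrite !mxE /=; field. Qed.

(** The rows of the matrix of a rank one point are multiples of the point. *)
Lemma pick_row_of_nu k c v : (k < 3)%N ->
  pick_row k (c *: nu v) = (2 * c * nth 0 [:: v 0 0; v 0 2; v 0 1] k) *: v.
Proof. by case: k => [|[|[|]]] //= _; apply: row3P; rewrite !mxE /=; field. Qed.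

Lemma nuZ c v : nu (c *: v) = c ^+ 2 *: nu v.
Proof. by rewrite -!polar_nu polarZl polarZr scalerA expr2. Qed.

(** The first row of the matrix with coordinates [x] that has a nonzero diagonal
    entry, or else the last row. *)
Definition nu_inv x : 'rV[K]_3 :=
  if diag_entry 0 x != 0 then pick_row 0 x
  else if diag_entry 1 x != 0 then pick_row 1 x else pick_row 2 x.

Lemma nu_inv_row x : x != 0 -> rank_le1 x ->
  exists2 k, (k < 3)%N & nu_inv x = pick_row k x /\ pick_row k x != 0.
Proof.
move=> x0 rx; rewrite /nu_inv.
have [d0|d0] := eqVneq (diag_entry 0 x) 0; last first.
  by exists 0%N => //; split=> //; apply: pick_row_neq0.
have [d1|d1] := eqVneq (diag_entry 1 x) 0; last first.
  by exists 1%N => //; split=> //; apply: pick_row_neq0.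
exists 2%N => //; split=> //; apply: pick_row_neq0 => //.
have [[|[|[|]]]] // := diag_entry_neq0 x0 rx; first by rewrite d0 eqxx.
by rewrite d1 eqxx.
Qed.

End Equations.

Section PlaneConic.
Variable K : numClosedFieldType.
Implicit Types (v w : 'cV[K]_2) (z : 'rV[K]_3).

(** The basis of the plane of a pair. *)
Definition plane_mx v w : 'M[K]_(3, 6) := \matrix_(i < 3, j < 6)
  (nth 0 [:: nu (sqv v); polar (sqv v) (sqv w); nu (sqv w)] i : 'rV[K]_6) 0 j.

Let sum3 (f : 'I_3 -> K) : \sum_i f i = f 0 + f 1 + f 2.
Proof.
rewrite 3!big_ord_recl big_ord0 addr0 !addrA.
by congr (f _ + f _ + f _); apply: val_inj.
Qed.

Lemma mul_plane_mx v w z : z *m plane_mx v w = plane_point v w (z 0 0) (z 0 1) (z 0 2).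
Proof. by apply/rowP => j; rewrite mxE sum3 !mxE. Qed.

Lemma plane_mx_eq0 v w z : det2 v w != 0 -> (z *m plane_mx v w == 0) = (z == 0).
Proof.
move=> vw; rewrite mul_plane_mx; apply/eqP/eqP => [/(plane_point_inj vw)[z0 z1 z2]|->].
  by apply: row3P; rewrite [RHS]mxE.
by rewrite -mul_plane_mx mul0mx.
Qed.

Lemma plane_mx_free v w : det2 v w != 0 -> row_free (plane_mx v w).
Proof.
by move=> vw; apply: inj_row_free => z /eqP; rewrite plane_mx_eq0 // => /eqP.
Qed.

(** The matrix of the quadratic form z_1^2 - 4 z_0 z_2. *)
Definition conic_mx : 'M[K]_3 := \matrix_(i < 3, j < 3)
  nth 0 (nth [::] [:: [:: 0; 0; - 2]; [:: 0; 1; 0]; [:: - 2; 0; 0]] i) j.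

Lemma conic_mx_sym : conic_mx^T = conic_mx.
Proof. by apply/matrixP => -[[|[|[|?]]] ?] [[|[|[|?]]] ?]; rewrite !mxE. Qed.

Lemma conic_mx_unit : conic_mx \in unitmx.
Proof.
rewrite unitmxE unitfE det_mx3 !mxE /= (_ : _ + _ = - 4%:R); first by rewrite oppr_eq0 pnatr_eq0.
by ring.
Qed.

Lemma conic_mxE z : (z *m conic_mx *m z^T) 0 0 = z 0 1 ^+ 2 - 4 * z 0 0 * z 0 2.
Proof. by rewrite mxE sum3 !mxE !sum3 !mxE /=; ring. Qed.

Lemma det2_span v w a b : let u := a *: v + b *: w in
  det2 u w = a * det2 v w /\ det2 v u = b * det2 v w.
Proof. by rewrite /= /det2 !mxE; split; ring. Qed.
End PlaneConic.

(** * The fourfold Z *)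

From mathcomp Require Import classical_sets functions.

Section Membership.
Variables (F : fieldType) (n : nat).
Implicit Types (x : 'rV[F]_n) (G : {mpoly F[n]}) (X : set 'rV[F]_n).

(** In the definitions of [zeros] and [zclosure], the condition [x != 0] bears on
    the function underlying the matrix [x]. *)
Lemma zerosP G x : zeros G x <-> x != 0 /\ G.@[x 0] = 0.
Proof.
split=> -[x0 Gx]; split=> //; apply: contraNneq x0 => x0.
  by apply/eqP; rewrite x0; apply/funext => i; apply/funext => j; rewrite mxE.
by apply/eqP/matrixP => i j; rewrite x0 mxE.
Qed.

Lemma zclosureP X x :
  zclosure X x <-> x != 0 /\ forall G, in_ideal X G -> G.@[x 0] = 0.
Proof.
split=> -[x0 Gx]; split=> //; apply: contraNneq x0 => x0.
  by apply/eqP; rewrite x0; apply/funext => i; apply/funext => j; rewrite mxE.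
by apply/eqP/matrixP => i j; rewrite x0 mxE.
Qed.

Lemma same_point_refl x : same_point x x.
Proof. by exists 1; rewrite ?oner_eq0 // scale1r. Qed.

Lemma same_point_sym x y : same_point x y -> same_point y x.
Proof.
by case=> c c0 ->; exists c^-1; rewrite ?invr_eq0 // scalerA mulVf // scale1r.
Qed.

Lemma same_point_trans x y z : same_point x y -> same_point y z -> same_point x z.
Proof.
by case=> c c0 -> [d d0 ->]; exists (c * d); rewrite ?mulf_neq0 // scalerA.
Qed.
End Membership.

Section Fourfold.
Variable K : numClosedFieldType.
Local Notation X := (zeros (Gpoly K)).
Local Notation S := (singular_locus 4 X).

Lemma zeros_hypersurface : hypersurface 3 (Gpoly K) X.
Proof.
split=> //; [exact: Gpoly_homog | exact: Gpoly_neq0 |].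
move=> H [_ H0]; apply: Gpoly_ideal => v v0 Gv; apply: H0; exact/zerosP.
Qed.

(** The singular points are the matrices of rank one. *)
Lemma singularP x : S x <-> x != 0 /\ rank_le1 x.
Proof.
have [_ _ _ ideal] := zeros_hypersurface; split=> [[/zerosP[x0 _] sing]|[x0 rx]].
  split=> //; apply/gradient_rank_le1 => i; apply: contrapT => di; apply: sing.
  exists (fun _ => Gpoly K); split=> [_|].
    by split; [exists 3%N; apply: Gpoly_homog | move=> y /zerosP[]].
  rewrite rank_rV (_ : _ != 0) //; apply/eqP => /matrixP/(_ 0 i).
  by rewrite !mxE.
split; first by apply/zerosP; split=> //; apply: rank_le1_det.
case=> H [HX]; suff -> : \matrix_(i, j) ((H i)^`M(j)).@[x 0] = 0 by rewrite mxrank0.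
apply/matrixP => i j; rewrite !mxE; have [Q ->] := ideal _ (HX i); rewrite mderivM mevalD !mevalM.
by rewrite ((gradient_rank_le1 x).2 rx) (rank_le1_det rx) !mulr0 addr0.
Qed.

Lemma singular_nu x : S x <-> exists2 v, v != 0 & same_point x (nu v).
Proof. by apply: iff_trans (singularP x) _; apply: rank_one_nu. Qed.

Lemma singular_veronese : veronese_surface S.
Proof.
exists (veronese_mx K); first exact: veronese_mx_unit.
apply/seteqP; split=> x.
  by move=> /singular_nu[v v0 xv]; exists v; rewrite ?conics_map_nu.
by case=> v v0; rewrite conics_map_nu => xv; apply/singular_nu; exists v.
Qed.

Lemma zeros_secant : X = secant_variety S.
Proof.
apply/seteqP; split=> x.
  move=> /zerosP[x0 Gx]; apply/zclosureP; split=> // H [_ H0]; apply: (H0 x); split=> //.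
  have [p [q xE]] := det0_polar Gx; rewrite xE in x0 *.
  have [v [w [a [b [v0 w0 vw ->]]]]] := polar_secant x0.
  exists (nu v), (nu w); split; last by exists a, b.
  - by apply/singular_nu; exists v => //; apply: same_point_refl.
  - by apply/singular_nu; exists w => //; apply: same_point_refl.
  - by case=> c _; apply: vw.
move=> /zclosureP[x0 H0]; apply/zerosP; split=> //; apply: H0; split.
  by exists 3%N; apply: Gpoly_homog.
move=> y [_ [p [q [/singular_nu[v _ [c _ ->]] /singular_nu[w _ [d _ ->]] _ [a [b ->]]]]]].
by have := pencil_det v w (a * c) 0 (b * d); rewrite scale0r addr0 !scalerA.
Qed.

Lemma nu_inv_same_point y : S y -> nu_inv y != 0 /\
  forall v, same_point y (nu v) -> same_point (nu_inv y) v.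
Proof.
move=> /singularP[y0 ry]; have [k k3 [-> r0]] := nu_inv_row y0 ry; split=> // v [c c0 yE].
move: r0; rewrite yE pick_row_of_nu // scaler_eq0 negb_or => /andP[m0 _].
by eexists; [exact: m0|].
Qed.

Lemma same_point_nu (v w : 'rV[K]_3) : same_point v w -> same_point (nu v) (nu w).
Proof. by case=> c c0 ->; exists (c ^+ 2); rewrite ?expf_neq0 // nuZ. Qed.

Lemma nu_pisomorphism : pisomorphism (pspace K 3) S (@nu K).
Proof.
have Snu v : v != 0 -> S (nu v).
  by move=> v0; apply/singular_nu; exists v => //; apply: same_point_refl.
exists (@nu_inv K); split.
- move=> v v0; exists 2%N, (fun j => nu_poly K j); split.
  + exact: nu_poly_homog.
  + by rewrite nu_poly_eval; apply: nu_neq0.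
  + by move=> w _ _; rewrite nu_poly_eval; apply: same_point_refl.
- move=> x /singularP[x0 rx]; have [k k3 [_ r0]] := nu_inv_row x0 rx.
  exists 1%N, (fun j => row_poly K k j); split.
  + by move=> j; apply: row_poly_homog.
  + by rewrite row_poly_eval.
  move=> y Sy; rewrite row_poly_eval // => ry0.
  have [_ inv] := nu_inv_same_point Sy; have /singular_nu[v _ yv] := Sy.
  apply: same_point_trans (inv _ yv) (same_point_sym _).
  case: yv ry0 => c _ ->; rewrite pick_row_of_nu // scaler_eq0 negb_or => /andP[m0 _].
  by eexists; [exact: m0|].
- move=> v v0; split; first exact: Snu.
  by have [_ inv] := nu_inv_same_point (Snu _ v0); apply: inv; apply: same_point_refl.
- move=> y Sy; have [g0 inv] := nu_inv_same_point Sy; split=> //.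
  have /singular_nu[v _ yv] := Sy.
  by apply: same_point_trans (same_point_nu (inv _ yv)) (same_point_sym yv).
Qed.
End Fourfold.

Section Conics.
Variables (R : realType) (E dt : 'M[rat]_4).
Hypothesis basis_dt : symplectic_basis E dt.
Local Notation C := R[i].
Implicit Types (K : {vspace 'M[C]_2}) (v w : 'cV[C]_2) (x : 'rV[C]_6).

Lemma PB2KP K v w x : cartan K -> eigenbasis K v w ->
  PB2K dt K x <-> x != 0 /\ exists c0 c1 c2, x = plane_point v w c0 c1 c2.
Proof.
by move=> cK eK; split=> -[x0 Bx]; split=> //; apply/(B2K_plane basis_dt _ cK eK).
Qed.

(** The closure of the union of the planes is the determinantal cubic. *)
Lemma Z_zeros : Z R dt = zeros (Gpoly C).
Proof.
apply/seteqP; split=> x.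
  move=> /zclosureP[x0 Hx]; apply/zerosP; split=> //; apply: Hx; split.
    by exists 3%N; apply: Gpoly_homog.
  move=> y [K cK]; have [v [w eK]] := cartan_eigenbasis cK.
  by case/(PB2KP _ cK eK) => _ [c0 [c1 [c2 ->]]]; apply: pencil_det.
move=> /zerosP[x0 Gx]; apply/zclosureP; split=> // H [_ H0].
have [p [q xE]] := det0_polar Gx; rewrite xE in x0 *.
apply: planes_dense x0 => y v w c0 c1 c2 vw yE y0; apply: H0.
have cK := cartan_diag_algebra vw; exists (diag_algebra (row_mx v w)) => //.
by apply/(PB2KP _ cK (eigenbasis_diag_algebra vw)); split=> //; exists c0, c1, c2.
Qed.

Lemma G_Gpoly : G R = Gpoly C.
Proof. exact: (@det_sym_mx {mpoly C[6]} (fun i => 'X_i)). Qed.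

(** The points of a plane that lie in the plane of another Cartan subalgebra are
    its rank one points. *)
Lemma CK_rank_one K x : cartan K -> CK dt K x <-> PB2K dt K x /\ rank_le1 x.
Proof.
move=> cK; have [v [w eK]] := cartan_eigenbasis cK; have vw := eigenbasis_det2 eK.
have KE := cartan_eq cK eK.
split=> -[Kx]; move: (Kx) => /(PB2KP _ cK eK)[x0 [c0 [c1 [c2 xE]]]].
  case=> K' [cK' K'K]; have [u [u' eK']] := cartan_eigenbasis cK'.
  case/(PB2KP _ cK' eK') => _ [d0 [d1 [d2 xE']]]; split=> //.
  rewrite xE; apply/(plane_rank_one _ _ _ vw); apply: contrapT => /eqP cN.
  have [hv hw] := planes_meet (etrans (esym xE) xE') vw cN.
  have uu := eigenbasis_det2 eK'.
  have [u0 u'0] := det2_neq0 uu; have [v0 w0] := det2_neq0 vw.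
  have eig z : z != 0 -> det2 u z * det2 u' z = 0 ->
      forall A, A \in K' -> exists a, A *m z = a *: z.
    move=> z0 /eqP; rewrite mulf_eq0 => /orP[] /eqP dz A AK'.
      have [k _ ->] := det2_eq0 u0 z0 dz; have [[a aE] _] := proj2 eK' A AK'.
      by exists a; rewrite -scalemxAr aE scalerA mulrC -scalerA.
    have [k _ ->] := det2_eq0 u'0 z0 dz; have [_ [a aE]] := proj2 eK' A AK'.
    by exists a; rewrite -scalemxAr aE scalerA mulrC -scalerA.
  apply: K'K; rewrite KE; apply: cartan_eq => //; split; first exact: (proj1 eK).
  by move=> A AK'; split; apply: eig AK'.
move=> rx; split; first exact: Kx.
have /(plane_rank_one _ _ _ vw) cE : rank_le1 (plane_point v w c0 c1 c2) by rewrite -xE.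
have [u [u' [a [b [uu a0 b0 uE [d0 [d1 [d2 dE]]]]]]]] := other_plane vw cE.
have cK' := cartan_diag_algebra uu; have eK' := eigenbasis_diag_algebra uu.
exists (diag_algebra (row_mx u u')); split; [exact: cK' | | ]; last first.
  apply: (PB2KP x cK' eK').2; split; first exact: x0.
  exact (ex_intro _ d0 (ex_intro _ d1 (ex_intro _ d2 (etrans xE dE)))).
move=> K'K; have : det2 u w = 0 \/ det2 v u = 0.
  apply: diag_algebra_eigenvector vw _ => A; rewrite -KE -K'K => AK.
  by have [_ /(_ _ AK)[]] := eK'.
have [-> ->] : det2 u w = a * det2 v w /\ det2 v u = b * det2 v w by rewrite uE; apply: det2_span.
by case=> /eqP; rewrite mulf_eq0 (negbTE vw) orbF; apply/negP.
Qed.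

Lemma CK_conic K : cartan K -> conic_in (PB2K dt K) (CK dt K).
Proof.
move=> cK; have [v [w eK]] := cartan_eigenbasis cK; have vw := eigenbasis_det2 eK.
exists (plane_mx v w), (conic_mx C).
have planeP x : PB2K dt K x <-> exists2 z, z != 0 & z *m plane_mx v w = x.
  apply: iff_trans (PB2KP _ cK eK) _; split=> [[x0 [c0 [c1 [c2 xE]]]]|[z z0 <-]].
    have {}xE : row_of 3 [:: c0; c1; c2] *m plane_mx v w = x.
      by rewrite mul_plane_mx !row_ofE xE.
    by exists (row_of 3 [:: c0; c1; c2]); rewrite // -(plane_mx_eq0 _ vw) xE.
  split; first by rewrite plane_mx_eq0.
  by rewrite mul_plane_mx; do 3 eexists.
split; [exact: plane_mx_free | by split; [apply: conic_mx_sym | apply: conic_mx_unit] | | ].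
  by apply/seteqP; split=> x; [move/planeP => [z z0 <-]; exists z | case=> z z0 <-; apply/planeP; exists z].
have conicP z : rank_le1 (z *m plane_mx v w) <-> (z *m conic_mx C *m z^T) 0 0 = 0.
  rewrite mul_plane_mx conic_mxE; apply: iff_trans (plane_rank_one _ _ _ vw) _.
  by split=> [->|/eqP]; rewrite ?subrr // subr_eq0 => /eqP.
apply/seteqP; split=> x.
  by move/(CK_rank_one _ cK) => [/planeP[z z0 <-] /conicP zq]; exists z.
case=> z [z0 zq] <-; apply/(CK_rank_one _ cK); split; first by apply/planeP; exists z.
exact/conicP.
Qed.
End Conics.

Theorem theorem4p2 (R : realType) (J : abelianSurface R) (E dt : 'M[rat]_4)
    (polE : is_polarization (periods J) E)
    (general : hodge_group J = symplectic_group R E)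
    (basis_dt : symplectic_basis E dt) :
  let S := singular_locus 4 (Z R dt) in
  [/\ set_bij [set: 'rV[R[i]]_6]%classic (hodgeC J 2) (theta dt),
      hypersurface 3 (G R) (Z R dt),
      veronese_surface S /\ Z R dt = secant_variety S,
      pisomorphism (pspace R[i] 3) S (@nu' R) &
      forall K : {vspace 'M[R[i]]_2}, cartan K ->
        conic_in (PB2K dt K) (CK dt K) /\
        (PB2K dt K `&` S)%classic = CK dt K].
Proof.
rewrite /= (Z_zeros R basis_dt) G_Gpoly; split.
- split=> [x _|x y _ _|a].
  + exact: hodgeC_theta polE basis_dt x.
  + exact: (theta_inj basis_dt).
  + by move=> /(theta_hodgeC polE general basis_dt)[x <-]; exists x.
- exact: zeros_hypersurface.
- by split; [apply: singular_veronese | apply: zeros_secant].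
- exact: nu_pisomorphism.
- move=> K cK; split; first exact: (CK_conic basis_dt cK).
  apply/seteqP; split=> x.
    by move=> [Kx /singularP[_ rx]]; apply/(CK_rank_one basis_dt _ cK).
  move=> /(CK_rank_one basis_dt _ cK)[Kx rx]; split=> //; apply/singularP; split=> //.
  by case: Kx.
Qed.
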